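(* For all integers $k,m\ge1$, the motivic integral $G_{k,m}(t,\mathbb{L})$, regarded as a rational function of $t$ and $\mathbb{L}$, satisfies $$G_{k,m}(t^{-1},\mathbb{L}^{-1})=t^{-2(k-1)(m-1)}\,\mathbb{L}^{2k+2m-2}\cdot G_{k,m}(t,\mathbb{L}).$$
   Context: Arcs: $\mathcal{L}$ is the space of arcs at the origin of $\mathbb{C}^2$, i.e. pairs $\gamma=(x(s),y(s))$ of formal power series over $\mathbb{C}$ without constant terms. $\mathcal{L}_n$ is the space of their $n$-jets (truncations modulo $s^{n+1}$, so $\mathcal{L}_n\cong\mathbb{C}^{2n}$) and $\pi_n:\mathcal{L}\to\mathcal{L}_n$ is the truncation map. $\mathrm{Ord}$ denotes the order of a power series in $s$. Grothendieck ring: $K_0(Var_{\mathbb{C}})$ is generated by isomorphism classes $[X]$ of complex quasi-projective varieties modulo $[X]=[Y]+[X\setminus Y]$ for $Y\subset X$ Zariski closed, with product $[X][Y]=[X\times Y]$; $\mathbb{L}$ is the class of the affine line. $\mathcal{M}$ is the completion of $K_0(Var_{\mathbb{C}})[\mathbb{L}^{-1}]$ with respect to the filtration in which $F_k$ is generated by the elements $[X]\mathbb{L}^{-n}$ with $n-\dim X\ge k$. Motivic measure (Kontsevich, Denef–Loeser): a set $A\subset\mathcal{L}$ is cylindric if $A=\pi_n^{-1}(A_n)$ for some $n$ and some constructible $A_n\subset\mathcal{L}_n$, and its measure is $[A_n]\mathbb{L}^{-2n}\in\mathcal{M}$; this extends to an additive $\mathcal{M}$-valued measure $\chi_g$ on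 a suitable algebra of subsets of $\mathcal{L}$. For a function $f$ with countably many values and measurable level sets, $\int f\,d\gamma=\sum_g g\cdot\chi_g(f^{-1}(g))$ whenever this sum converges. The integrals: $\mu(\gamma)$ is the Milnor number of the germ of plane curve parametrised by $\gamma$, i.e. $\mu=\dim_{\mathbb{C}}\mathbb{C}[[x,y]]/(f_x,f_y)$ for a reduced equation $f=0$ of the branch when $\gamma$ is a primitive parametrisation; for non-primitive arcs (a set of measure zero) $\mu(\gamma)=\infty$ and $t^{\infty}=0$. For integers $k,m\ge1$, $$G_{k,m}(t,\mathbb{L})=\int_{\{\mathrm{Ord}\,x=k,\ \mathrm{Ord}\,y=m\}}t^{\mu(\gamma)}d\gamma=\sum_{n\ge 0}t^n\chi_g\{\gamma:\mathrm{Ord}\,x=k,\ \mathrm{Ord}\,y=m,\ \mu(\gamma)=n\}\in\mathcal{M}[[t]].$$ Each $G_{k,m}$ is the expansion as a power series in $t$ of a rational function in $t$ and $\mathbb{L}$ (with $\mathbb{L}$ treated as an indeterminate); $G_{k,m}(t^{-1},\mathbb{L}^{-1})$ means the substitution $t\mapsto t^{-1}$, $\mathbb{L}\mapsto\mathbb{L}^{-1}$ in that rational function. *)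

(* Defs.v *)
From HB Require Import structures.
From mathcomp Require Import all_boot all_order all_algebra.
From mathcomp Require Import generic_quotient ring_quotient fraction complex.
From mathcomp Require Import boolp classical_sets functions reals.
From mathcomp Require Import mpoly.

Set Implicit Arguments.
Unset Strict Implicit.
Unset Printing Implicit Defensive.

Import GRing.Theory Num.Theory.
Local Open Scope classical_set_scope.
Local Open Scope ring_scope.
Local Open Scope quotient_scope.

(* A subset of the projective space P(K^n) is represented by the set of its
  homogeneous coordinate vectors, a subset of K^n \ {0}; all the sets below
  are invariant under nonzero scaling.  In particular P(K^n) has dimension
  n - 1, and is empty for n = 0. *)

Section Varieties.
Variable K : closedFieldType.

Definition ev n (p : {mpoly K[n]}) (v : 'rV[K]_n) : K := p.@[v 0].

Definition homogeneous n (p : {mpoly K[n]}) : Prop := exists d, p \is d.-homog.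

Definition zero_locus n (F : seq {mpoly K[n]}) : set 'rV[K]_n :=
  [set v | v != 0 /\ forall p, p \in F -> ev p v = 0].

Definition proj_closed n (Z : set 'rV[K]_n) : Prop :=
  exists2 F : seq {mpoly K[n]},
    (forall p, p \in F -> homogeneous p) & Z = zero_locus F.

Definition quasi_projective n (X : set 'rV[K]_n) : Prop :=
  exists Z W : set 'rV[K]_n, [/\ proj_closed Z, proj_closed W & X = Z `\` W].

Record qpvar n := QPVar {
  qpset :> set 'rV[K]_n;
  qpsetP : quasi_projective qpset }.

Definition closed_in n (X Y : set 'rV[K]_n) : Prop :=
  exists2 Z, proj_closed Z & Y = X `&` Z.

Definition irreducible n (X Y : set 'rV[K]_n) : Prop :=
  Y !=set0 /\ forall Z1 Z2, closed_in X Z1 -> closed_in X Z2 ->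
    Y `<=` Z1 `|` Z2 -> Y `<=` Z1 \/ Y `<=` Z2.

Definition irreducible_chain n (X : set 'rV[K]_n) (l : nat)
    (Z : nat -> set 'rV[K]_n) : Prop :=
  (forall i, (i <= l)%N -> closed_in X (Z i) /\ irreducible X (Z i)) /\
  (forall i, (i < l)%N -> Z i `<` Z i.+1).

(* dim X <= d, for the Krull dimension; d may be negative, since the empty
   variety has dimension -oo. *)
Definition dim_le n (X : set 'rV[K]_n) (d : int) : Prop :=
  forall l Z, irreducible_chain X l Z -> l%:Z <= d.

Definition same_point n (v w : 'rV[K]_n) : Prop :=
  exists2 c : K, c != 0 & v = c *: w.

(* f acts on homogeneous coordinates; around each point v of X, on a basic
   open neighbourhood {h != 0}, it must be given by a tuple p of homogeneous
   polynomials of the same degree. *)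
Definition regular_map a b (X : set 'rV[K]_a) (Y : set 'rV[K]_b)
    (f : 'rV[K]_a -> 'rV[K]_b) : Prop :=
  (forall v, X v -> Y (f v)) /\
  (forall v, X v -> exists (h : {mpoly K[a]}) (d : nat) (p : 'I_b -> {mpoly K[a]}),
    [/\ homogeneous h, forall i, p i \is d.-homog, ev h v != 0 &
        forall w, X w -> ev h w != 0 ->
          same_point (f w) (\row_i ev (p i) w)]).

Definition isomorphic a b (X : set 'rV[K]_a) (Y : set 'rV[K]_b) : Prop :=
  exists (f : 'rV[K]_a -> 'rV[K]_b) (g : 'rV[K]_b -> 'rV[K]_a),
    [/\ regular_map X Y f, regular_map Y X g,
        forall v, X v -> same_point (g (f v)) v &
        forall w, Y w -> same_point (f (g w)) w].

(* The product variety, through the Segre embedding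
   P(K^a) x P(K^b) -> P(K^a (x) K^b) = P(K^(a * b)). *)
Definition segre a b (X : set 'rV[K]_a) (Y : set 'rV[K]_b) : set 'rV[K]_(a * b) :=
  [set z | exists v w, [/\ X v, Y w & z = mxvec (v^T *m w)]].

(* The affine space K^N is the chart {w_0 != 0} of P(K^(1 + N)). *)
Definition affine_chart N (A : set 'rV[K]_N) : set 'rV[K]_(1 + N) :=
  [set w | lsubmx w 0 0 != 0 /\ A ((lsubmx w 0 0)^-1 *: rsubmx w)].

Lemma proj_closed_all n : proj_closed [set v : 'rV[K]_n | v != 0].
Proof.
exists [::] => //; apply/seteqP; split=> [v nz|v [] //].
by split.
Qed.

Lemma qp_affine_line : quasi_projective (affine_chart [set: 'rV[K]_1]).
Proof.
exists [set v | v != 0], (zero_locus [:: 'X_0]); split.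
- exact: proj_closed_all.
- exists [:: 'X_0] => // p; rewrite inE => /eqP ->.
  by exists 1%N; rewrite dhomogX /= mdeg1.
have lE (w : 'rV[K]_(1 + 1)) : lsubmx w 0 0 = w 0 0.
  by rewrite mxE; congr (w _ _); apply: val_inj.
apply/seteqP; split=> w.
  rewrite /affine_chart /= lE => -[w0 _]; split.
    by apply: contraNneq w0 => ->; rewrite mxE.
  move=> [_ /(_ _ (mem_head _ _))]; rewrite /ev mevalXU => w00.
  by rewrite w00 eqxx in w0.
move=> [nz H]; split=> //; rewrite lE; apply/eqP => w0; apply: H; split=> // p.
by rewrite inE => /eqP ->; rewrite /ev mevalXU.
Qed.

Lemma qp_point : quasi_projective [set v : 'rV[K]_1 | v != 0].
Proof.
exists [set v | v != 0], set0; split; first exact: proj_closed_all.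
- exists [:: 1] => [p|]; first by rewrite inE => /eqP ->; exists 0%N; exact: dhomog1.
  apply/seteqP; split=> // v [_ /(_ _ (mem_head _ _))].
  by rewrite /ev meval1 => /eqP; rewrite oner_eq0.
by rewrite setD0.
Qed.

Definition affine_line : qpvar (1 + 1) := QPVar qp_affine_line.
Definition point : qpvar 1 := QPVar qp_point.

(* The ring K_0(Var)[L^-1] is presented as the commutative ring generated by the symbols [X], for X
  a quasi-projective variety, and an inverse of [affine_line]. *)

Inductive kexpr : Type :=
| Kcls n of qpvar n
| Klinv
| Kzero
| Kone
| Kopp of kexpr
| Kadd of kexpr & kexpr
| Kmul of kexpr & kexpr.

Inductive keq : kexpr -> kexpr -> Prop :=
| keq_iso a b (X : qpvar a) (Y : qpvar b) :
    isomorphic X Y -> keq (Kcls X) (Kcls Y)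
| keq_scissor n (X Y Z : qpvar n) :
    closed_in X Y -> qpset Z = X `\` Y -> keq (Kcls X) (Kadd (Kcls Y) (Kcls Z))
| keq_prod a b (X : qpvar a) (Y : qpvar b) (Z : qpvar (a * b)) :
    qpset Z = segre X Y -> keq (Kmul (Kcls X) (Kcls Y)) (Kcls Z)
| keq_point : keq (Kcls point) Kone
| keq_linv : keq (Kmul (Kcls affine_line) Klinv) Kone
| keq_refl x : keq x x
| keq_sym x y : keq x y -> keq y x
| keq_trans x y z : keq x y -> keq y z -> keq x z
| keq_opp x y : keq x y -> keq (Kopp x) (Kopp y)
| keq_add x y z t : keq x y -> keq z t -> keq (Kadd x z) (Kadd y t)
| keq_mul x y z t : keq x y -> keq z t -> keq (Kmul x z) (Kmul y t)
| keq_addA x y z : keq (Kadd x (Kadd y z)) (Kadd (Kadd x y) z)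
| keq_addC x y : keq (Kadd x y) (Kadd y x)
| keq_add0 x : keq (Kadd Kzero x) x
| keq_addN x : keq (Kadd (Kopp x) x) Kzero
| keq_mulA x y z : keq (Kmul x (Kmul y z)) (Kmul (Kmul x y) z)
| keq_mulC x y : keq (Kmul x y) (Kmul y x)
| keq_mul1 x : keq (Kmul Kone x) x
| keq_mulDl x y z : keq (Kmul (Kadd x y) z) (Kadd (Kmul x z) (Kmul y z)).

HB.instance Definition _ := gen_eqMixin kexpr.
HB.instance Definition _ := gen_choiceMixin kexpr.

Definition keqb (x y : kexpr) : bool := `[< keq x y >].

Lemma keqb_refl : forall x, keqb x x.
Proof. by move=> x; apply/asboolP; exact: keq_refl. Qed.

Lemma keqb_sym : ssrbool.symmetric keqb.
Proof. by move=> x y; apply/asboolP/asboolP; exact: keq_sym. Qed.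

Lemma keqb_trans : transitive keqb.
Proof.
by move=> y x z /asboolP xy /asboolP yz; apply/asboolP; apply: keq_trans yz.
Qed.

Canonical keqb_equiv := EquivRel keqb keqb_refl keqb_sym keqb_trans.

Definition K0L : Type := {eq_quot keqb}.

HB.instance Definition _ := Choice.on K0L.
HB.instance Definition _ := Quotient.on K0L.

Lemma K0L_eqP (x y : kexpr) : (\pi_K0L x = \pi_K0L y) <-> keq x y.
Proof.
split=> [/(@eqquotP _ _ {eq_quot keqb})/asboolP //|xy].
by apply/(@eqquotP _ _ {eq_quot keqb}); apply/asboolP.
Qed.

Lemma K0L_reprK (x : kexpr) : keq (repr (\pi_K0L x)) x.
Proof. by apply/K0L_eqP; rewrite reprK. Qed.

Definition K0L_zero : K0L := \pi_K0L Kzero.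
Definition K0L_one : K0L := \pi_K0L Kone.
Definition K0L_opp (x : K0L) : K0L := \pi_K0L (Kopp (repr x)).
Definition K0L_add (x y : K0L) : K0L := \pi_K0L (Kadd (repr x) (repr y)).
Definition K0L_mul (x y : K0L) : K0L := \pi_K0L (Kmul (repr x) (repr y)).

Lemma K0L_pi_opp x : K0L_opp (\pi_K0L x) = \pi_K0L (Kopp x).
Proof. by apply/K0L_eqP; apply: keq_opp; exact: K0L_reprK. Qed.

Lemma K0L_pi_add x y : K0L_add (\pi_K0L x) (\pi_K0L y) = \pi_K0L (Kadd x y).
Proof. by apply/K0L_eqP; apply: keq_add; exact: K0L_reprK. Qed.

Lemma K0L_pi_mul x y : K0L_mul (\pi_K0L x) (\pi_K0L y) = \pi_K0L (Kmul x y).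
Proof. by apply/K0L_eqP; apply: keq_mul; exact: K0L_reprK. Qed.

Lemma K0L_ind (P : K0L -> Prop) : (forall x, P (\pi_K0L x)) -> forall x, P x.
Proof. by move=> H x; rewrite -[x]reprK. Qed.

Fact K0L_addA : associative K0L_add.
Proof.
elim/K0L_ind=> x; elim/K0L_ind=> y; elim/K0L_ind=> z.
by rewrite !K0L_pi_add; apply/K0L_eqP; exact: keq_addA.
Qed.

Fact K0L_addC : commutative K0L_add.
Proof.
elim/K0L_ind=> x; elim/K0L_ind=> y.
by rewrite !K0L_pi_add; apply/K0L_eqP; exact: keq_addC.
Qed.

Fact K0L_add0 : left_id K0L_zero K0L_add.
Proof.
elim/K0L_ind=> x.
by rewrite /K0L_zero K0L_pi_add; apply/K0L_eqP; exact: keq_add0.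
Qed.

Fact K0L_addN : left_inverse K0L_zero K0L_opp K0L_add.
Proof.
elim/K0L_ind=> x.
by rewrite K0L_pi_opp K0L_pi_add; apply/K0L_eqP; exact: keq_addN.
Qed.

HB.instance Definition _ :=
  GRing.isZmodule.Build K0L K0L_addA K0L_addC K0L_add0 K0L_addN.

Fact K0L_mulA : associative K0L_mul.
Proof.
elim/K0L_ind=> x; elim/K0L_ind=> y; elim/K0L_ind=> z.
by rewrite !K0L_pi_mul; apply/K0L_eqP; exact: keq_mulA.
Qed.

Fact K0L_mulC : commutative K0L_mul.
Proof.
elim/K0L_ind=> x; elim/K0L_ind=> y.
by rewrite !K0L_pi_mul; apply/K0L_eqP; exact: keq_mulC.
Qed.

Fact K0L_mul1 : left_id K0L_one K0L_mul.
Proof.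
elim/K0L_ind=> x.
by rewrite /K0L_one K0L_pi_mul; apply/K0L_eqP; exact: keq_mul1.
Qed.

Fact K0L_mulDl : left_distributive K0L_mul K0L_add.
Proof.
elim/K0L_ind=> x; elim/K0L_ind=> y; elim/K0L_ind=> z.
rewrite (K0L_pi_add x y) !K0L_pi_mul K0L_pi_add.
by apply/K0L_eqP; exact: keq_mulDl.
Qed.

(* Only a "possibly zero" ring: 1 != 0 in K_0(Var) is not needed here. *)
HB.instance Definition _ :=
  GRing.Zmodule_isComPzRing.Build K0L K0L_mulA K0L_mulC K0L_mul1 K0L_mulDl.

Definition cls n (X : qpvar n) : K0L := \pi_K0L (Kcls X).
Definition Lef : K0L := cls affine_line.
Definition LefV : K0L := \pi_K0L Klinv.

Lemma LefK : Lef * LefV = 1.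
Proof.
apply: etrans (K0L_pi_mul (Kcls affine_line) Klinv) _.
by apply/K0L_eqP; exact: keq_linv.
Qed.

Definition Lefpow (e : int) : K0L :=
  match e with Posz i => Lef ^+ i | Negz i => LefV ^+ i.+1 end.

Lemma LefpowS (e : int) : Lef * Lefpow e = Lefpow (e + 1).
Proof.
case: e => [i|[|i]].
- by rewrite [_ + 1]addrC -intS /= exprS.
- by rewrite /= expr1 LefK.
- have -> : Negz i.+1 + 1 = Negz i.
    by rewrite !NegzE (intS i.+1) opprD addrAC addNr add0r.
  by rewrite /= exprS mulrA LefK mul1r.
Qed.

(* [Fil k] is the subgroup F_k.  The completion M is the group of sequences that
  are Cauchy for the F_k, modulo those converging to 0.  Only its group
  structure and the multiplication by L are used. *)

Inductive Fil (k : int) : K0L -> Prop :=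
| Fil_gen n (X : qpvar n) (e : int) :
    dim_le X (e - k) -> Fil k (cls X * Lefpow (- e))
| Fil_zero : Fil k 0
| Fil_sub x y : Fil k x -> Fil k y -> Fil k (x - y).

Lemma Fil_opp k x : Fil k x -> Fil k (- x).
Proof. by move=> Fx; rewrite -sub0r; apply: Fil_sub => //; exact: Fil_zero. Qed.

Lemma Fil_Lef k x : Fil (k + 1) x -> Fil k (Lef * x).
Proof.
elim=> [n X e dX||y z _ Fy _ Fz]; last by rewrite mulrBr; exact: Fil_sub.
- have -> : Lef * (cls X * Lefpow (- e)) = cls X * Lefpow (- (e - 1)).
    by rewrite mulrCA LefpowS opprB addrC.
  by apply: Fil_gen; rewrite -addrA -opprD [1 + k]addrC.
- by rewrite mulr0; exact: Fil_zero.
Qed.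

Definition cauchy (u : nat -> K0L) : Prop :=
  forall k, exists N, forall i j, (N <= i)%N -> (N <= j)%N -> Fil k (u i - u j).

Definition tends_to0 (u : nat -> K0L) : Prop :=
  forall k, exists N, forall i, (N <= i)%N -> Fil k (u i).

Definition cauchyb : {pred nat -> K0L} := fun u => `[< cauchy u >].

Fact cauchyb_zmod : zmod_closed cauchyb.
Proof.
split.
  by apply/asboolP => k; exists 0%N => i j _ _; rewrite subrr; exact: Fil_zero.
move=> u v /asboolP Cu /asboolP Cv; apply/asboolP => k.
have [N HN] := Cu k; have [N' HN'] := Cv k.
exists (maxn N N') => i j; rewrite !geq_max => /andP[Ni N'i] /andP[Nj N'j].
have -> : (u - v) i - (u - v) j = (u i - u j) - (v i - v j).
  by rewrite !fctE !opprB addrACA [RHS]addrACA; congr (_ + _); rewrite addrC.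
by apply: Fil_sub; [exact: HN|exact: HN'].
Qed.

HB.instance Definition _ := GRing.isZmodClosed.Build _ cauchyb cauchyb_zmod.

Record cauchy_seq := CauchySeq {
  cseq :> nat -> K0L;
  cseqP : cseq \in cauchyb }.

HB.instance Definition _ := [isSub for cseq].
HB.instance Definition _ := [Choice of cauchy_seq by <:].
HB.instance Definition _ := [SubChoice_isSubZmodule of cauchy_seq by <:].

Definition nullb : {pred cauchy_seq} := fun u => `[< tends_to0 u >].

Fact nullb_zmod : zmod_closed nullb.
Proof.
split; first by apply/asboolP => k; exists 0%N => i _; exact: Fil_zero.
move=> u v /asboolP Nu /asboolP Nv; apply/asboolP => k.
have [N HN] := Nu k; have [N' HN'] := Nv k.
exists (maxn N N') => i; rewrite geq_max => /andP[Ni N'i].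
by apply: Fil_sub; [exact: HN|exact: HN'].
Qed.

HB.instance Definition _ := GRing.isZmodClosed.Build _ nullb nullb_zmod.

Definition Mcompl : Type := Quotient.quot nullb.

HB.instance Definition _ := GRing.Zmodule.on Mcompl.
HB.instance Definition _ := Quotient.on Mcompl.

Lemma cst_cauchy (x : K0L) : (fun=> x) \in cauchyb.
Proof.
by apply/asboolP => k; exists 0%N => i j _ _; rewrite subrr; exact: Fil_zero.
Qed.

Definition toM (x : K0L) : Mcompl := \pi_Mcompl (CauchySeq (cst_cauchy x)).

Lemma Lef_cauchy (u : cauchy_seq) : (fun i => Lef * u i) \in cauchyb.
Proof.
apply/asboolP => k; have /asboolP/(_ (k + 1))[N HN] := cseqP u.
by exists N => i j Ni Nj; rewrite -mulrBr; apply: Fil_Lef; exact: HN.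
Qed.

Definition Lef_seq (u : cauchy_seq) : cauchy_seq := CauchySeq (Lef_cauchy u).

Definition Lefact (g : Mcompl) : Mcompl := \pi_Mcompl (Lef_seq (repr g)).

Lemma Lefact_pi u : Lefact (\pi_Mcompl u) = \pi_Mcompl (Lef_seq u).
Proof.
apply/eqP; rewrite -Quotient.idealrBE; apply/asboolP => k.
have : repr (\pi_Mcompl u) - u \in nullb.
  by rewrite Quotient.idealrBE; apply/eqP; rewrite reprK.
move=> /asboolP/(_ (k + 1))[N HN]; exists N => i /HN /Fil_Lef.
set v := repr _; rewrite -[(v - u) i]/(v i - u i) mulrBr.
by rewrite -[(Lef_seq v - _) i]/(Lef * v i - Lef * u i).
Qed.

(* q(L) . g, for an integral polynomial q. *)
Definition polyact (q : {poly int}) (g : Mcompl) : Mcompl :=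
  \sum_(j < size q) (iter j Lefact g) *~ q`_j.

Definition series := nat -> K.

Record arc := Arc {
  arcx : series;
  arcy : series;
  arcx0 : arcx 0%N = 0;
  arcy0 : arcy 0%N = 0 }.

Definition has_order (a : series) (k : nat) : Prop :=
  (forall i, (i < k)%N -> a i = 0) /\ a k != 0.

(* The coefficients of degrees 1, ..., n of x, followed by those of y. *)
Definition jet n (g : arc) : 'rV[K]_(n + n) :=
  row_mx (\row_(i < n) arcx g i.+1) (\row_(i < n) arcy g i.+1).

(* A is constructible, i.e. a finite disjoint union of locally closed subsets
   of the affine space K^N, and a is the sum of their classes. *)
Definition constructible_class N (A : set 'rV[K]_N) (a : K0L) : Prop :=
  exists (l : nat) (X : 'I_l -> qpvar (1 + N)),
    [/\ trivIset setT (fun i => qpset (X i)),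
        affine_chart A = \bigcup_(i in setT) qpset (X i) &
        a = \sum_i cls (X i)].

Definition cylinder_measure (A : set arc) (g : Mcompl) : Prop :=
  exists (n : nat) (An : set 'rV[K]_(n + n)) (a : K0L),
    [/\ A = jet n @^-1` An, constructible_class An a &
        g = toM (a * LefV ^+ (2 * n))].

(* The motivic measure on cylindric sets, with the dummy value 0 elsewhere.  It
   is only applied to the sets where the orders of x, y and the Milnor number
   are prescribed and finite, which are cylindric by finite determinacy. *)
Definition chi_g (A : set arc) : Mcompl := xget 0 (cylinder_measure A).

Definition smul (a b : series) : series :=
  fun n => \sum_(i < n.+1) a i * b (n - i)%N.

Definition spow (a : series) (j : nat) : series :=
  iter j (smul a) (fun n => (n == 0%N)%:R).

(* a(phi(s)), for phi without constant term. *)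
Definition scomp (a phi : series) : series :=
  fun n => \sum_(i < n.+1) a i * spow phi i n.

(* g is not obtained from another arc by a substitution s := phi(s) with phi
   of order at least 2. *)
Definition primitive (g : arc) : Prop :=
  ~ exists (d : arc) (phi : series),
      [/\ phi 0%N = 0, phi 1%N = 0,
          arcx g = scomp (arcx d) phi & arcy g = scomp (arcy d) phi].

(* The element \sum_(i, j) f i j x^i y^j of K[[x, y]]. *)
Definition series2 := nat -> nat -> K.

Definition smul2 (f g : series2) : series2 :=
  fun i j => \sum_(p < i.+1) \sum_(q < j.+1) f p q * g (i - p)%N (j - q)%N.

Definition dx (f : series2) : series2 := fun i j => f i.+1 j *+ i.+1.
Definition dy (f : series2) : series2 := fun i j => f i j.+1 *+ j.+1.

(* f(x(s), y(s)); the sum is finite because x^i y^j has order >= i + j. *)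
Definition pullback (g : arc) (f : series2) : series :=
  fun n => \sum_(i < n.+1) \sum_(j < n.+1)
    f i j * smul (spow (arcx g) i) (spow (arcy g) j) n.

(* f = 0 is a reduced equation of the branch parametrised by g: f generates
   the ideal of the series vanishing on it. *)
Definition reduced_equation (g : arc) (f : series2) : Prop :=
  forall h : series2,
    (forall n, pullback g h n = 0) <-> exists u, h = smul2 u f.

Definition jacobian_ideal (f : series2) : set series2 :=
  [set h | exists u v : series2,
     forall i j, h i j = smul2 u (dx f) i j + smul2 v (dy f) i j].

(* dim_K K[[x, y]] / J = n: the classes of b_0, ..., b_(n-1) form a basis. *)
Definition quotient_dim (J : set series2) (n : nat) : Prop :=
  exists b : 'I_n -> series2, forall h : series2,
    exists! c : 'rV[K]_n, J (fun i j => h i j - \sum_(l < n) c 0 l * b l i j).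

Definition has_milnor (g : arc) (n : nat) : Prop :=
  exists2 f, reduced_equation g f & quotient_dim (jacobian_ideal f) n.

(* None stands for infinity. *)
Definition milnor (g : arc) : option nat :=
  if pselect (primitive g /\ exists n, has_milnor g n) is left H
  then Some (projT1 (cid H.2)) else None.

Definition level_set (k m n : nat) : set arc :=
  [set g | [/\ has_order (arcx g) k, has_order (arcy g) m & milnor g = Some n]].

(* The coefficients of G_{k,m} in M[[t]]. *)
Definition Gseries (k m : nat) : nat -> Mcompl := fun n => chi_g (level_set k m n).

(* {poly {poly int}} is Z[L][t]: the outer variable is t. *)
Local Notation ratfun := {fraction {poly {poly int}}}.

Definition tvar : ratfun := tofrac 'X.
Definition Lvar : ratfun := tofrac ('X%:P).

Definition eval2 (p : {poly {poly int}}) (a b : ratfun) : ratfun :=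
  (map_poly (fun c : {poly int} => (map_poly intr c).[b]) p).[a].

(* R(t^-1, L^-1); independent of the representation of R as a quotient. *)
Definition subst_inv (R : ratfun) : ratfun :=
  eval2 \n_(repr R) tvar^-1 Lvar^-1 / eval2 \d_(repr R) tvar^-1 Lvar^-1.

(* R = P / Q with Q(L) g = P(L) in M[[t]].  A monic polynomial in L is
   invertible in M (expand in powers of L^-1), so that Q is invertible in
   M[[t]] and g is determined by R. *)
Definition is_expansion (R : ratfun) (g : nat -> Mcompl) : Prop :=
  exists P Q : {poly {poly int}},
    [/\ Q`_0 \is monic, R = tofrac P / tofrac Q &
        forall n, \sum_(i < n.+1) polyact Q`_i (g (n - i)%N) = polyact P`_n (toM 1)].

End Varieties.

(* Main.v *)
(* Let g be an arc with Ord x = k.  In characteristic 0 it can be written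
  x = c tau^k, y = sum_i Y_i tau^i for a parameter tau whose coefficients are
  polynomials in those of x and in 1 / x_k.  Let e_i be the gcd of k and of
  the exponents j <= i with Y_j <> 0.  The arc is primitive if and only if the
  e_i reach 1, and its Milnor number is then the sum of the e_i - 1, i >= 1: the
  equation of the branch is the product of the y - Y(z s) for z^k = 1 and
  s^k = x / c, and dim K[[x, y]] / (f_x, f_y) is computed by splitting f_y into
  Puiseux factors.

  Since Y_i is y_i plus a function of x and of the y_j with j < i, the level sets
  of the Milnor number are cylinders that fibre one coefficient at a time.  If
  e = e_i divides i + 1, then Y_(i+1) is free and contributes L t^(e - 1);
  otherwise Y_(i+1) = 0 contributes t^(e - 1), and Y_(i+1) <> 0 contributes
  (L - 1) t^(d - 1) with d = gcd(e, i + 1).  Hence G_{k,m} is, up to the factor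
  (1 - L^-1)^2 L^-(k+m-2) t^((k-1)(m-1) + e - 1) with e = gcd(k, m), the rational
  function phi_e given by phi_1 = 1 and
    (1 - L^-(e-1) t^(e(e-1))) phi_e =
      sum_(0 < r < e) L^-(r-1) (1 - L^-1) t^((r-1)(e-1) + d - 1) phi_d
  with d = gcd(e, r).  The substitution r -> e - r in this recursion yields
  phi_e(t^-1, L^-1) = t^(2(e-1)) phi_e(t, L), from which the symmetry of G_{k,m}
  follows. *)
From HB Require Import structures.
From mathcomp Require Import all_boot all_order all_algebra.
From mathcomp Require Import cyclic separable cyclotomic.
From mathcomp Require Import generic_quotient fraction complex.
From mathcomp Require Import boolp classical_sets functions reals.
From mathcomp Require Import mpoly.
From mathcomp Require Import zify ring.
Require Import Defs.

Set Implicit Arguments.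
Unset Strict Implicit.
Unset Printing Implicit Defensive.

Import GRing.Theory Num.Theory.
Local Open Scope ring_scope.

(** * Formal power series *)

(** A germ F(x, y) is a series in y whose coefficients are series in x, an element of [ps (ps K)].
    Division by y - e then works for every e without constant term and leaves the remainder F(e);
    this one device yields evaluation, composition, the chain rule and factorisation along roots. In
    general roots exist only after x := s^N; as K[[s]] is free of rank N over K[[s^N]], the
    codimension found there is N times the wanted one. The ring [K0L] might be zero and its
    completion is used only as a group on which L acts, so no rational function is evaluated there.
    All counting is done on N-jets with polynomials in L and t. A coefficient met while the gcd
    exceeds 1 carries a factor t, so finitely many of them decide modulo t^(n+1), and the passage to
    G is a congruence of polynomials once a denominator that is monic in L at t = 0 has been
    cleared. The measure requires that the class of a constructible set depend neither on its
    decomposition nor on the order of the jets. Its computation requires the normalised coefficients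
    to be rational with only x_k in the denominators, so that prescribing the next one gives a graph
    or the complement of a graph. *)

Lemma strong_rec (T : Type) (t0 : T) (G : (nat -> T) -> nat -> T) :
  (forall u v n, (forall i, (i < n)%N -> u i = v i) -> G u n = G v n) ->
  exists u, forall n, u n = G u n.
Proof.
(* The n-th entry of the j-th iterate of [G] is the same for all j > n, so the diagonal of the
   iterates solves the equation. *)
move=> HG; pose v := fix v j := if j is j'.+1 then G (v j') else fun=> t0.
have Hv n : forall j, (n < j)%N -> v j n = v n.+1 n.
  elim/ltn_ind: n => n IH [//|j]; rewrite ltnS => nj /=.
  by apply: HG => i i_n; rewrite (IH _ i_n j (leq_trans i_n nj)) (IH _ i_n n).
exists (fun n => v n.+1 n) => n; rewrite {1}/v -/v.
by apply: HG => i i_n; rewrite (Hv i).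
Qed.

Definition ps (A : nzRingType) : Type := nat -> A.

Fact ps_key : unit. Proof. exact: tt. Qed.

Section PsRing.
Variable A : comNzRingType.
Implicit Types a b : ps A.

Lemma psP a b : (forall n, a n = b n) -> a = b.
Proof. by move=> ab; apply/funext. Qed.

HB.instance Definition _ := gen_eqMixin (ps A).
HB.instance Definition _ := gen_choiceMixin (ps A).

Definition ps_add a b : ps A := fun n => a n + b n.
Definition ps_opp a : ps A := fun n => - a n.
Definition ps_zero : ps A := fun=> 0.

Fact ps_addA : associative ps_add.
Proof. by move=> a b c; apply: psP => n; rewrite /ps_add addrA. Qed.
Fact ps_addC : commutative ps_add.
Proof. by move=> a b; apply: psP => n; rewrite /ps_add addrC. Qed.
Fact ps_add0 : left_id ps_zero ps_add.
Proof. by move=> a; apply: psP => n; rewrite /ps_add add0r. Qed.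
Fact ps_addN : left_inverse ps_zero ps_opp ps_add.
Proof. by move=> a; apply: psP => n; rewrite /ps_add addNr. Qed.

HB.instance Definition _ :=
  GRing.isZmodule.Build (ps A) ps_addA ps_addC ps_add0 ps_addN.

(* Locked: otherwise failing unification problems on series unfold the
   convolution products. *)
Definition ps_mul : ps A -> ps A -> ps A := locked_with ps_key
  (fun a b n => \sum_(i < n.+1) a i * b (n - i)%N).
Lemma ps_mulE a b n : ps_mul a b n = \sum_(i < n.+1) a i * b (n - i)%N.
Proof. by rewrite /ps_mul unlock. Qed.
Definition ps_one : ps A := fun n => (n == 0%N)%:R.

(* Ring identities follow from those of polynomials by truncation. *)
Definition ps_trunc N a : {poly A} := \poly_(i < N) a i.

Lemma ps_mul_trunc N a b n : (n < N)%N ->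
  ps_mul a b n = (ps_trunc N a * ps_trunc N b)`_n.
Proof.
move=> nN; rewrite ps_mulE coefM; apply: eq_bigr => i _; rewrite !coef_poly.
by rewrite (leq_ltn_trans (leq_ord i) nN) (leq_ltn_trans (leq_subr _ _) nN).
Qed.

Lemma coefM_eq (p q p' q' : {poly A}) N : (forall i, (i < N)%N -> p`_i = p'`_i) ->
  (forall i, (i < N)%N -> q`_i = q'`_i) ->
  forall n, (n < N)%N -> (p * q)`_n = (p' * q')`_n.
Proof.
move=> pp qq n nN; rewrite !coefM; apply: eq_bigr => i _.
by rewrite pp ?qq ?(leq_ltn_trans (leq_subr _ _) nN) ?(leq_ltn_trans (leq_ord i) nN).
Qed.

Lemma trunc_mul N a b n : (n < N)%N ->
  (ps_trunc N (ps_mul a b))`_n = (ps_trunc N a * ps_trunc N b)`_n.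
Proof. by move=> nN; rewrite coef_poly nN; exact: ps_mul_trunc. Qed.

Fact ps_mulA : associative ps_mul.
Proof.
move=> a b c; apply: psP => n.
rewrite !(ps_mul_trunc (N := n.+1)) //.
rewrite (coefM_eq (N := n.+1) (p' := ps_trunc n.+1 a)
  (q' := ps_trunc n.+1 b * ps_trunc n.+1 c)) //; last by move=> i /trunc_mul->.
rewrite [RHS](coefM_eq (N := n.+1) (p' := ps_trunc n.+1 a * ps_trunc n.+1 b)
  (q' := ps_trunc n.+1 c)) ?mulrA // => i; exact: trunc_mul.
Qed.

Fact ps_mulC : commutative ps_mul.
Proof. by move=> a b; apply: psP => n; rewrite !(ps_mul_trunc (N := n.+1)) // mulrC. Qed.

Fact ps_mul1 : left_id ps_one ps_mul.
Proof.
move=> a; apply: psP => n; rewrite ps_mulE big_ord_recl /ps_one /= mul1r subn0.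
by rewrite big1 ?addr0 // => i _; rewrite mul0r.
Qed.

Fact ps_mulDl : left_distributive ps_mul ps_add.
Proof.
move=> a b c; apply: psP => n; rewrite /ps_add !ps_mulE -big_split /=.
by apply: eq_bigr => i _; rewrite mulrDl.
Qed.

Fact ps_1neq0 : ps_one != 0 :> ps A.
Proof.
apply/eqP => /(congr1 (fun a : ps A => a 0%N)) /eqP.
by rewrite /ps_one /= oner_eq0.
Qed.

HB.instance Definition _ := GRing.Zmodule_isComNzRing.Build (ps A)
  ps_mulA ps_mulC ps_mul1 ps_mulDl ps_1neq0.

Lemma psD a b n : (a + b) n = a n + b n. Proof. by []. Qed.
Lemma psN a n : (- a) n = - a n. Proof. by []. Qed.
Lemma psB a b n : (a - b) n = a n - b n. Proof. by []. Qed.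
Lemma psMn a m n : (a *+ m) n = a n *+ m.
Proof. by elim: m => // m IH; rewrite !mulrS psD IH. Qed.
Lemma ps0 n : (0 : ps A) n = 0. Proof. by []. Qed.
Lemma ps1 n : (1 : ps A) n = (n == 0%N)%:R. Proof. by []. Qed.
Lemma psM a b n : (a * b) n = \sum_(i < n.+1) a i * b (n - i)%N.
Proof. exact: ps_mulE. Qed.

Lemma ps_sum I (r : seq I) (P : pred I) (F : I -> ps A) n :
  (\sum_(i <- r | P i) F i) n = \sum_(i <- r | P i) F i n.
Proof. by elim/big_rec2: _ => // i x y _ <-. Qed.

Lemma psM0 a b : (a * b) 0%N = a 0%N * b 0%N.
Proof. by rewrite psM big_ord_recl big_ord0 addr0. Qed.

Lemma psX0 a n : (a ^+ n) 0%N = a 0%N ^+ n.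
Proof. by elim: n => [|n IH] //; rewrite !exprS psM0 IH. Qed.

Definition psC (c : A) : ps A := fun n => if n == 0%N then c else 0.
Definition psX : ps A := fun n => (n == 1%N)%:R.

Lemma psCM c a n : (psC c * a) n = c * a n.
Proof.
rewrite psM big_ord_recl /psC /= subn0 big1 ?addr0 // => i _.
by rewrite mul0r.
Qed.

Lemma psXM a n : (psX * a) n = if n is n'.+1 then a n' else 0.
Proof.
rewrite psM; case: n => [|n]; first by rewrite big_ord_recl big_ord0 addr0 mul0r.
rewrite big_ord_recl mul0r add0r big_ord_recl /psX /= mul1r subSS subn0 big1 ?addr0 //.
by move=> i _; rewrite mul0r.
Qed.

Lemma psXnM j a n : (psX ^+ j * a) n = if (n < j)%N then 0 else a (n - j)%N.
Proof.
elim: j n => [|j IH] n; first by rewrite mul1r subn0.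
by rewrite exprS -mulrA psXM; case: n => [|n] //; rewrite IH.
Qed.

Lemma psXn j n : (psX ^+ j) n = (n == j)%:R.
Proof.
rewrite -[_ ^+ j]mulr1 psXnM ps1.
case: ltngtP => // [jn|->]; last by rewrite subnn eqxx.
by rewrite subn_eq0 leqNgt jn.
Qed.

Fact psC_zmod : zmod_morphism psC.
Proof. by move=> a b; apply: psP => n; rewrite psB /psC; case: eqP => // _; rewrite subrr. Qed.
HB.instance Definition _ := GRing.isZmodMorphism.Build A (ps A) psC psC_zmod.
Fact psC_mul : monoid_morphism psC.
Proof.
split=> [|a b]; apply: psP => n; first by rewrite /psC ps1; case: eqP.
by rewrite psCM /psC; case: eqP => // _; rewrite mulr0.
Qed.
HB.instance Definition _ := GRing.isMonoidMorphism.Build A (ps A) psC psC_mul.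

Definition ps0c a : A := a 0%N.
Fact ps0c_zmod : zmod_morphism ps0c. Proof. by []. Qed.
HB.instance Definition _ := GRing.isZmodMorphism.Build (ps A) A ps0c ps0c_zmod.
Fact ps0c_mul : monoid_morphism ps0c.
Proof. by split=> // a b; exact: psM0. Qed.
HB.instance Definition _ := GRing.isMonoidMorphism.Build (ps A) A ps0c ps0c_mul.

Definition psder a : ps A := fun n => a n.+1 *+ n.+1.

Lemma psderD a b : psder (a + b) = psder a + psder b.
Proof. by apply: psP => n; rewrite /psder psD mulrnDl. Qed.
Lemma psderN a : psder (- a) = - psder a.
Proof. by apply: psP => n; rewrite /psder psN mulNrn. Qed.
Lemma psderB a b : psder (a - b) = psder a - psder b.
Proof. by rewrite psderD psderN. Qed.
Lemma psder0 : psder 0 = 0.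
Proof. by apply: psP => n; rewrite /psder mul0rn. Qed.
Lemma psderC c : psder (psC c) = 0.
Proof. by apply: psP => n; rewrite /psder /psC mul0rn. Qed.
Lemma psder1 : psder 1 = 0.
Proof. by rewrite -(rmorph1 psC) psderC. Qed.
Lemma psderX : psder psX = 1.
Proof. by apply: psP => -[|n]; rewrite /psder /psX ps1 // mul0rn. Qed.

Lemma trunc_der N a : ps_trunc N (psder a) = (ps_trunc N.+1 a)^`().
Proof.
apply/polyP => i; rewrite coef_deriv !coef_poly ltnS.
by case: ltnP => // _; rewrite mul0rn.
Qed.

Lemma psderM a b : psder (a * b) = psder a * b + a * psder b.
Proof.
apply: psP => n; rewrite psD /psder.
rewrite -[(a * b) n.+1]/(ps_mul a b n.+1) (ps_mul_trunc (N := n.+2)) //.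
rewrite -coef_deriv derivM coefD; congr (_ + _).
  rewrite -[RHS]/(ps_mul (psder a) b n) (ps_mul_trunc (N := n.+1)) // trunc_der.
  apply: (coefM_eq (N := n.+1)) => // i iN.
  by rewrite !coef_poly iN (ltn_trans iN).
rewrite -[RHS]/(ps_mul a (psder b) n) (ps_mul_trunc (N := n.+1)) // trunc_der.
apply: (coefM_eq (N := n.+1)) => // i iN.
by rewrite !coef_poly iN (ltn_trans iN).
Qed.

Lemma psderXn a n : psder (a ^+ n.+1) = a ^+ n * psder a *+ n.+1.
Proof.
elim: n => [|n IH]; first by rewrite expr1 expr0 mul1r.
rewrite exprS psderM IH [RHS]mulrS; congr (_ + _); first exact: mulrC.
by rewrite mulrnAr mulrA -exprS.
Qed.

End PsRing.

Arguments psX {A}.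

Section MapPs.
Variables (A B : comNzRingType) (f : {rmorphism A -> B}).
Definition map_ps (a : ps A) : ps B := fun n => f (a n).
Fact map_ps_zmod : zmod_morphism map_ps.
Proof. by move=> a b; apply: psP => n; rewrite /map_ps !psB rmorphB. Qed.
HB.instance Definition _ := GRing.isZmodMorphism.Build (ps A) (ps B) map_ps map_ps_zmod.
Fact map_ps_mul : monoid_morphism map_ps.
Proof.
split=> [|a b]; apply: psP => n; first by rewrite /map_ps !ps1 rmorph_nat.
by rewrite /map_ps !psM rmorph_sum; apply: eq_bigr => i _; rewrite rmorphM.
Qed.
HB.instance Definition _ := GRing.isMonoidMorphism.Build (ps A) (ps B) map_ps map_ps_mul.
Lemma map_psX : map_ps psX = psX.
Proof. by apply: psP => n; rewrite /map_ps /psX rmorph_nat. Qed.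
Lemma map_psC c : map_ps (psC c) = psC (f c).
Proof. by apply: psP => n; rewrite /map_ps /psC; case: eqP => // _; rewrite rmorph0. Qed.
Lemma map_psder a : map_ps (psder a) = psder (map_ps a).
Proof. by apply: psP => n; rewrite /map_ps /psder rmorphMn. Qed.
End MapPs.

(** The series rings carry only a commutative ring structure; the absence of zero divisors travels
    from [A] to [ps A] and [ps (ps A)] as a property. *)
Definition is_dom (A : nzRingType) := forall a b : A, a * b = 0 -> a = 0 \/ b = 0.

Definition leading (A : comNzRingType) (a : ps A) k :=
  (forall i, (i < k)%N -> a i = 0) /\ a k <> 0.

Section Order.
Variable A : comNzRingType.
Implicit Types a b : ps A.

Lemma leading_exists a : a <> 0 -> exists k, leading a k.
Proof.
move=> a0; have [k ak]: exists k, a k != 0.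
  apply: contra_notP a0 => H; apply: psP => n; apply/eqP/negP => an.
  by apply: H; exists n; apply/negP.
pose P k := a k != 0; have exP : exists k, P k by exists k.
exists (ex_minn exP); case: ex_minnP => l Pl lmin; split; last exact/eqP.
move=> i il; apply/eqP; apply: contraTT il => /lmin; by rewrite -leqNgt.
Qed.

Lemma leading_uniq a k l : leading a k -> leading a l -> k = l.
Proof.
by move=> [ak1 ak] [al1 al]; case: (ltngtP k l) => [/al1|/ak1|].
Qed.

Lemma leading_neq0 a k : leading a k -> a <> 0.
Proof. by move=> [_ ak] a0; apply: ak; rewrite a0. Qed.

Lemma leading0 a k : leading a k -> (0 < k)%N -> a 0%N = 0.
Proof. by move=> [ak _]; exact: ak. Qed.

Lemma mul_low a b k l n : (forall i, (i < k)%N -> a i = 0) ->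
  (forall i, (i < l)%N -> b i = 0) -> (n < k + l)%N -> (a * b) n = 0.
Proof.
move=> ak bl n_kl; rewrite psM big1 // => i _.
case: (ltnP i k) => [/ak->|ki]; first by rewrite mul0r.
by rewrite bl ?mulr0 //; have := ltn_ord i; lia.
Qed.

Lemma mul_at a b k l : (forall i, (i < k)%N -> a i = 0) ->
  (forall i, (i < l)%N -> b i = 0) -> (a * b) (k + l)%N = a k * b l.
Proof.
move=> ak bl; rewrite psM.
have kn : (k < (k + l).+1)%N by rewrite ltnS leq_addr.
rewrite (bigD1 (Ordinal kn)) //= addKn big1 ?addr0 // => i ik.
case: (ltngtP i k) => [/ak->|ki|e]; first by rewrite mul0r.
  by rewrite bl ?mulr0 //; have := ltn_ord i; lia.
by move/eqP: ik; case; apply: val_inj => /=; lia.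
Qed.

Lemma leadingM a b k l : is_dom A -> leading a k -> leading b l -> leading (a * b) (k + l).
Proof.
move=> dA [ak1 ak] [bl1 bl]; split; first by move=> i; exact: mul_low.
by rewrite mul_at // => /dA[].
Qed.

Lemma ps_dom : is_dom A -> is_dom (ps A).
Proof.
move=> dA a b ab; have [->|/leading_exists[k ak]] := EM (a = 0); first by left.
have [->|/leading_exists[l bl]] := EM (b = 0); first by right.
by have /leading_neq0 := leadingM dA ak bl.
Qed.

Lemma powlow a n i : a 0%N = 0 -> (i < n)%N -> (a ^+ n) i = 0.
Proof.
move=> a0; elim: n i => // n IH i i_n; rewrite exprS.
by apply: (mul_low (k := 1) (l := n)) => //; case.
Qed.

End Order.

Lemma domI (A : nzRingType) (a b c : A) : is_dom A -> a <> 0 -> a * b = a * c -> b = c.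
Proof.
move=> dA a0 abc; have : a * (b - c) = 0 by rewrite mulrBr abc subrr.
by case/dA => // /eqP; rewrite subr_eq0 => /eqP.
Qed.

Lemma field_dom (K : fieldType) : is_dom K.
Proof. by move=> a b /eqP; rewrite mulf_eq0 => /orP[]/eqP->; [left|right]. Qed.

(** * Evaluation and substitution *)

(* Substitutions are made total by first discarding the constant term of the
   substituted series. *)
Definition z0 (A : nzRingType) (e : ps A) : ps A := fun n => if n is 0%N then 0 else e n.

Lemma z0_id (A : nzRingType) (e : ps A) : e 0%N = 0 -> z0 e = e.
Proof. by move=> e0; apply/funext => -[|n] /=. Qed.

Section Eval.
Variable A : comNzRingType.
Implicit Types (F G : ps (ps A)) (e phi : ps A).

(** Substitution of [e] for the outer variable y. The sum may stop at n because [z0 e ^+ i] has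
    order at least i. *)
Definition evy : ps A -> ps (ps A) -> ps A := locked_with ps_key
  (fun e F n => \sum_(i < n.+1) (F i * z0 e ^+ i) n).
Lemma evyE e F n : evy e F n = \sum_(i < n.+1) (F i * z0 e ^+ i) n.
Proof. by rewrite /evy unlock. Qed.

Lemma mulpow_low e (a : ps A) i n : (n < i)%N -> (a * z0 e ^+ i) n = 0.
Proof. by move=> ni; apply: (mul_low (k := 0) (l := i)) => // j; exact: powlow. Qed.

Lemma evy_ext e F M n : (n <= M)%N -> evy e F n = \sum_(i < M.+1) (F i * z0 e ^+ i) n.
Proof.
move=> nM; rewrite evyE (big_ord_widen M.+1 (fun i => (F i * z0 e ^+ i) n)) //.
rewrite big_mkcond; apply: eq_bigr => i _; case: ltnP => // ni.
by rewrite mulpow_low.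
Qed.

Lemma evy_rec e F : evy e F = F 0%N + z0 e * evy e (fun i => F i.+1).
Proof.
apply: psP => n; rewrite psD evyE big_ord_recl expr0 mulr1; congr (_ + _).
transitivity (\sum_(i < n.+1) (F i.+1 * z0 e ^+ i.+1) n).
  by rewrite big_ord_recr /= [X in _ + X]mulpow_low ?addr0.
rewrite psM.
under [RHS]eq_bigr => l _ do rewrite (evy_ext _ _ (leq_subr l n)) mulr_sumr.
rewrite [RHS]exchange_big /=; apply: eq_bigr => i _.
by rewrite exprS mulrCA psM.
Qed.

(** The quotient of F - F(e) by y - e, as in synthetic division. *)
Definition evyQ e F : ps (ps A) := fun j => evy e (fun i => F (j + i).+1).

Lemma evy_factor e F : F = (psX - psC (z0 e)) * evyQ e F + psC (evy e F).
Proof.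
apply: psP => -[|j]; rewrite psD mulrBl psB psXM psCM /psC /=.
  by rewrite sub0r addrC evy_rec addrK.
by rewrite addr0 /evyQ evy_rec addn0 [X in _ * X](_ : _ = evy e (fun i => F (j.+1 + i).+1)) ?addrK //; congr evy; apply/funext => i; rewrite addnS.
Qed.

(** The quotient satisfies Q_j = e^n Q_(j+n) for all n, so its coefficients have infinite order. *)
Lemma evy_factor_uniq e (Q : ps (ps A)) r : (psX - psC (z0 e)) * Q = psC r -> r = 0.
Proof.
move=> H.
have HQ j : Q j = z0 e * Q j.+1.
  have /(congr1 (fun G : ps (ps A) => G j.+1)) := H.
  by rewrite mulrBl psB psXM psCM /psC /= => /eqP; rewrite subr_eq0 => /eqP.
have HQn n j : Q j = Q (j + n)%N * z0 e ^+ n.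
  elim: n j => [|n IH] j; first by rewrite addn0 mulr1.
  by rewrite HQ IH addSnnS mulrCA -exprS.
have Q0 : Q 0%N = 0 by apply: psP => n; rewrite (HQn n.+1) mulpow_low.
have /(congr1 (fun G : ps (ps A) => G 0%N)) := H.
by rewrite mulrBl psB psXM psCM Q0 mulr0 /psC /= subrr.
Qed.

Fact evy_zmod e : zmod_morphism (evy e).
Proof.
move=> F G; apply: psP => n; rewrite psB !evyE -sumrB; apply: eq_bigr => i _.
by rewrite psB mulrBl psB.
Qed.
HB.instance Definition _ e := GRing.isZmodMorphism.Build (ps (ps A)) (ps A) (evy e) (evy_zmod e).

Lemma evyC e c : evy e (psC c) = c.
Proof.
rewrite evy_rec [X in _ + X](_ : _ = 0) ?addr0 //.
by rewrite (_ : (fun _ => _) = (0 : ps (ps A))) ?raddf0 ?mulr0 //; apply/funext.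
Qed.

(** Evaluation is characterised as the remainder modulo y - e; its multiplicativity and its
    compatibility with composition follow from this without handling convolution sums. *)
Lemma evy_eq e F Q r : F = (psX - psC (z0 e)) * Q + psC r -> evy e F = r.
Proof.
rewrite {1}(evy_factor e F) => H; apply/eqP; rewrite -subr_eq0; apply/eqP.
apply: (@evy_factor_uniq e (Q - evyQ e F)).
by rewrite mulrBr rmorphB /=; apply/eqP; rewrite subr_eq addrAC eq_sym subr_eq addrC H addrC.
Qed.

Fact evy_mul e : monoid_morphism (evy e).
Proof.
split=> [|F G]; first by rewrite -(rmorph1 (@psC _)) evyC.
apply: (evy_eq (Q := evyQ e F * G + psC (evy e F) * evyQ e G)).
move: (evyQ e F) (evyQ e G) (evy e F) (evy e G) (evy_factor e F) (evy_factor e G).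
by move=> q r a b -> ->; rewrite rmorphM /=; ring.
Qed.
HB.instance Definition _ e := GRing.isMonoidMorphism.Build (ps (ps A)) (ps A) (evy e) (evy_mul e).

Lemma evyX e : evy e psX = z0 e.
Proof. by apply: (evy_eq (Q := 1)); rewrite mulr1 subrK. Qed.

Lemma evy_root e F : evy e F = 0 -> exists Q, F = (psX - psC (z0 e)) * Q.
Proof. by move=> F0; exists (evyQ e F); rewrite {1}(evy_factor e F) F0 rmorph0 addr0. Qed.

Lemma evy0 e F : evy e F 0%N = F 0%N 0%N.
Proof. by rewrite evy_rec psD psM0 mul0r addr0. Qed.

Definition comp phi (a : ps A) : ps A := evy phi (map_ps (@psC A) a).

Lemma compE phi a n : comp phi a n = \sum_(i < n.+1) a i * (z0 phi ^+ i) n.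
Proof. by rewrite /comp evyE; apply: eq_bigr => i _; rewrite psCM. Qed.

Fact comp_zmod e : zmod_morphism (comp e).
Proof. by move=> a b; rewrite /comp !rmorphB. Qed.
HB.instance Definition _ e := GRing.isZmodMorphism.Build (ps A) (ps A) (comp e) (comp_zmod e).
Fact comp_mul e : monoid_morphism (comp e).
Proof. by split=> [|a b]; rewrite /comp ?rmorph1 // !rmorphM. Qed.
HB.instance Definition _ e := GRing.isMonoidMorphism.Build (ps A) (ps A) (comp e) (comp_mul e).

Lemma compX phi : comp phi psX = z0 phi.
Proof. by rewrite /comp map_psX evyX. Qed.
Lemma compC phi c : comp phi (psC c) = psC c.
Proof. by rewrite /comp map_psC evyC. Qed.
Lemma comp0 phi a : comp phi a 0%N = a 0%N.
Proof. by rewrite /comp evy0. Qed.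

Lemma z0_comp phi e : z0 (comp phi (z0 e)) = comp phi (z0 e).
Proof. by rewrite z0_id // comp0. Qed.

Lemma comp_evy phi e F :
  comp phi (evy e F) = evy (comp phi (z0 e)) (map_ps (comp phi) F).
Proof.
symmetry; apply: (evy_eq (Q := map_ps (comp phi) (evyQ e F))).
rewrite {1}(evy_factor e F) rmorphD rmorphM rmorphB /= map_psX !map_psC /=.
by rewrite z0_comp.
Qed.

Lemma comp_comp phi psi a : comp phi (comp psi a) = comp (comp phi (z0 psi)) a.
Proof.
rewrite {2}/comp comp_evy; congr evy; apply: psP => n.
by rewrite /map_ps /= compC.
Qed.

Lemma comp_id a : comp psX a = a.
Proof.
apply: psP => n; rewrite compE (bigD1 ord_max) //= big1 ?addr0 => [|i ni].
  by rewrite z0_id // psXn eqxx mulr1.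
rewrite z0_id // psXn [_ == _](negbTE _) ?mulr0 //.
by apply: contraNneq ni => e; apply/eqP/val_inj.
Qed.

Lemma z0_der e : psder (z0 e) = psder e.
Proof. by apply: psP. Qed.

(** The chain rule d/ds F(s, e(s)) = F_s + F_y e'. Differentiating F = (y - e) Q + F(e) in each
    variable and evaluating at e expresses both partial derivatives through Q(e). *)
Lemma der_evy e F : psder (evy e F) =
  evy e (fun j => psder (F j)) + evy e (psder F) * psder e.
Proof.
have E1 : (fun j => psder (F j)) = psC (- psder e) * evyQ e F
    + (psX - psC (z0 e)) * (fun j => psder (evyQ e F j)) + psC (psder (evy e F)) :> ps (ps A).
  apply: psP => j; rewrite {1}(evy_factor e F) !psD psCM !mulrBl !psB !psXM !psCM.
  rewrite psderD psderB psderM z0_der.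
  case: j => [|j]; rewrite /psC /= ?psder0; ring.
have -> : psder F = evyQ e F + (psX - psC (z0 e)) * psder (evyQ e F).
  by rewrite {1}(evy_factor e F) psderD psderM psderB psderX !psderC subr0 mul1r addr0.
rewrite E1 !rmorphD !rmorphM !rmorphB /= !evyX !evyC subrr !mul0r !addr0.
by rewrite mulNr [X in - X + _]mulrC addrAC addNr add0r.
Qed.

Lemma der_comp phi a : psder (comp phi a) = comp phi (psder a) * psder phi.
Proof.
rewrite {1}/comp der_evy [X in evy _ X + _](_ : _ = (0 : ps (ps A))).
  by rewrite raddf0 add0r -map_psder.
by apply: psP => j; rewrite /map_ps psderC.
Qed.

Lemma ps_inv (a : ps A) d : a 0%N * d = 1 -> exists b, a * b = 1.
Proof.
move=> ad.
have [|b Hb] := @strong_rec A 0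
  (fun b n => d * ((n == 0%N)%:R - \sum_(i < n) a i.+1 * b (n - i.+1)%N)).
  move=> u v n uv; congr (_ * (_ - _)); apply: eq_bigr => i _; congr (_ * _).
  by apply: uv; have := ltn_ord i; lia.
exists b; apply: psP => n; rewrite psM big_ord_recl /= subn0 Hb mulrA ad mul1r ps1.
by rewrite subrK.
Qed.

Lemma psXnK N (a b : ps A) : psX ^+ N * a = psX ^+ N * b -> a = b.
Proof.
move=> ab; apply: psP => n; have := congr1 (fun c : ps A => c (n + N)%N) ab.
by rewrite !psXnM ltnNge leq_addl /= addnK.
Qed.

Lemma low_fact (a : ps A) k : (forall i, (i < k)%N -> a i = 0) ->
  a = psX ^+ k * (fun n => a (n + k)%N).
Proof.
by move=> ak; apply: psP => n; rewrite psXnM; case: ltnP => [/ak//|kn]; rewrite subnK.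
Qed.

Lemma comp_Xn N a n : (0 < N)%N ->
  comp (psX ^+ N) a n = if (N %| n)%N then a (n %/ N)%N else 0.
Proof.
move=> N0; have z : z0 (psX ^+ N : ps A) = psX ^+ N.
  by rewrite z0_id // psXn; case: N N0.
rewrite compE z; case: ifPn => Nn.
  have lt : (n %/ N < n.+1)%N by rewrite ltnS leq_div.
  rewrite (bigD1 (Ordinal lt)) //= -exprM psXn mulnC divnK // eqxx mulr1 big1 ?addr0 //.
  move=> i /eqP ni; rewrite -exprM psXn; case: eqP => [e|]; last by rewrite mulr0.
  by case: ni; apply: val_inj => /=; rewrite [X in (X %/ _)%N]e mulKn.
rewrite big1 // => i _; rewrite -exprM psXn; case: eqP => [e|]; last by rewrite mulr0.
by case/negP: Nn; apply/dvdnP; exists i; rewrite mulnC.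
Qed.

Lemma comp_scale c a n : comp (psC c * psX) a n = c ^+ n * a n.
Proof.
have z : z0 (psC c * psX) = psC c * psX by rewrite z0_id // psCM mulr0.
rewrite compE z (bigD1 ord_max) //= big1 ?addr0 => [|i ni].
  by rewrite exprMn -rmorphXn psCM psXn eqxx mulr1 mulrC.
rewrite exprMn -rmorphXn psCM psXn [_ == _](negbTE _) ?mulr0 //.
by apply: contraNneq ni => e; apply/eqP/val_inj.
Qed.

End Eval.

Section FieldSeries.
Variable K : fieldType.
Implicit Types a b phi : ps K.

Definition psK_dom : is_dom (ps K) := ps_dom (field_dom (K := K)).
Definition psKK_dom : is_dom (ps (ps K)) := ps_dom psK_dom.

Lemma leading_fact a k : leading a k -> exists2 u : ps K, a = psX ^+ k * u & u 0%N <> 0.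
Proof.
move=> [ak1 ak]; exists (fun n => a (n + k)%N); last by rewrite add0n.
exact: low_fact.
Qed.

Lemma leading_Xn k (u : ps K) : u 0%N <> 0 -> leading (psX ^+ k * u) k.
Proof.
move=> u0; split=> [i ik|]; first by rewrite psXnM ik.
by rewrite psXnM ltnn subnn.
Qed.

Lemma leadingX a k n : leading a k -> leading (a ^+ n) (k * n).
Proof.
move=> ak; elim: n => [|n IH].
  by rewrite muln0 expr0; split=> //; apply/eqP; rewrite ps1 oner_eq0.
by rewrite exprS mulnS; apply: leadingM => //; exact: field_dom.
Qed.

Lemma leading_comp phi a k l : leading phi k -> (0 < k)%N -> leading a l ->
  leading (comp phi a) (k * l).
Proof.
move=> pk k0 /leading_fact[u -> u0]; rewrite rmorphM rmorphXn /= compX.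
rewrite z0_id; last by case: pk => pk1 _; exact: pk1.
rewrite -[(k * l)%N]addn0; apply: leadingM; [exact: field_dom|exact: leadingX|].
by split=> //; rewrite comp0.
Qed.

Lemma comp_inj phi k a b : leading phi k -> (0 < k)%N -> comp phi a = comp phi b -> a = b.
Proof.
move=> pk k0 ab; apply/eqP; rewrite -subr_eq0; apply/eqP; apply: contrapT.
move=> /leading_exists[l /(leading_comp pk k0)/leading_neq0].
by rewrite rmorphB /= ab subrr.
Qed.

(** The system for the coefficients of a is triangular, with the powers of [phi 1] on the
    diagonal. *)
Lemma comp_surj phi b : leading phi 1 -> exists a, comp phi a = b.
Proof.
move=> [p0 /eqP p1]; have pz : z0 phi = phi by rewrite z0_id // p0.
have pn n : (phi ^+ n) n = phi 1%N ^+ n.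
  elim: n => // n IH; rewrite exprS -[in LHS]add1n mul_at ?IH ?exprS //.
  by move=> i; apply: powlow; rewrite p0.
have [|a Ha] := @strong_rec K 0
  (fun a n => (b n - \sum_(i < n) a i * (phi ^+ i) n) / phi 1%N ^+ n).
  by move=> u v n uv; congr ((_ - _) / _); apply: eq_bigr => i _; rewrite uv.
exists a; apply: psP => n; rewrite compE pz big_ord_recr /= [in X in _ + X]Ha pn.
by rewrite divfK ?expf_neq0 // addrC subrK.
Qed.

Lemma psK_inv a : a 0%N <> 0 -> exists b, a * b = 1.
Proof. by move=> /eqP a0; apply: (@ps_inv _ _ (a 0%N)^-1); rewrite divff. Qed.

Lemma psKK_inv (U : ps (ps K)) : U 0%N 0%N <> 0 -> exists V, U * V = 1.
Proof. by move=> /psK_inv[d Ud]; apply: ps_inv Ud. Qed.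

Definition theta a : ps K := fun n => a n *+ n.
Lemma thetaE a : theta a = psX * psder a.
Proof. by apply: psP => -[|n]; rewrite psXM // /theta mulr0n. Qed.

Hypothesis char0 : forall n, n.+1%:R != 0 :> K.

(** With theta = s d/ds, b^k = a implies k a theta(b) = b theta(a), and the n-th coefficient of this
    equation is the displayed recursion. It belongs to the conclusion because the rational
    dependence of b on the coefficients of a is read off it later. *)
Lemma ps_root k a (b0 : K) : (0 < k)%N -> a 0%N != 0 -> b0 ^+ k = a 0%N ->
  exists b : ps K, [/\ b ^+ k = a, b 0%N = b0 & forall n, (0 < n)%N ->
   b n = (\sum_(i < n) b i * a (n - i)%N * ((n - i)%:R - (k * i)%:R)) / ((n * k)%:R * a 0%N)].
Proof.
move=> k0 a0 b0k.
have [|b' Hb] := @strong_rec K 0 (fun b n => if n == 0%N then b0 else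
   (\sum_(i < n) b i * a (n - i)%N * ((n - i)%:R - (k * i)%:R)) / ((n * k)%:R * a 0%N)).
  move=> u v n uv; case: eqP => // _; congr (_ / _); apply: eq_bigr => i _.
  by rewrite uv.
move: b' Hb; change (nat -> K) with (ps K) => b Hb; exists b; have b00 : b 0%N = b0 by rewrite Hb.
split=> //; last by move=> n n0; rewrite {1}Hb; case: n n0.
have E : theta b * a *+ k = b * theta a.
  apply: psP => n.
  rewrite psMn !psM -sumrMnl; apply/eqP; rewrite -subr_eq0 -sumrB.
  rewrite (eq_bigr (fun i : 'I_n.+1 => - (b i * a (n - i)%N * ((n - i)%:R - (k * i)%:R)))); last first.
    move=> i _; rewrite /theta natrM.
    rewrite -(mulr_natr (b i)) -(mulr_natr (a _)) -mulr_natr; ring.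
  rewrite sumrN oppr_eq0 big_ord_recr /= subnn; case: n => [|n].
    by rewrite big_ord0 muln0 subrr mulr0 addr0.
  rewrite [in X in _ + X]Hb /=.
  have nk : (n.+1 * k)%:R != 0 :> K.
    by have -> : (n.+1 * k = (n.+1 * k).-1.+1)%N by nia.
  set S := \sum_(i < _) _; apply/eqP.
  have -> : S / ((n.+1 * k)%:R * a 0%N) * a 0%N * (0%:R - (k * n.+1)%:R) =
     - S * ((n.+1 * k)%:R / (n.+1 * k)%:R) * (a 0%N / a 0%N).
    by rewrite invfM [(k * n.+1)%N]mulnC; ring.
  by rewrite !divff // !mulr1 addrN.
have E2 : a * theta (b ^+ k) = b ^+ k * theta a.
  rewrite [theta (b ^+ k)]thetaE.
  have -> : psder (b ^+ k) = b ^+ k.-1 * psder b *+ k by rewrite -{1}(prednK k0) psderXn prednK.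
  have -> : b ^+ k = b ^+ k.-1 * b by rewrite -exprSr prednK.
  by rewrite -mulrA -E thetaE; ring.
(* Both b^k and a solve the linear equation a theta(w) = w theta(a), with the same constant term.
   Their difference has some order l + 1 > 0 if it is not zero, and the coefficient of that degree
   gives a_0 (l + 1) w_(l+1) = 0. *)
apply/eqP; rewrite -subr_eq0; apply/eqP; apply: contrapT => /leading_exists[l [wl1 wl]].
set w := b ^+ k - a in wl1 wl.
have E3 : a * theta w = w * theta a.
  by rewrite /w thetaE psderB mulrBr -!thetaE mulrBr E2 mulrBl.
have w0 : w 0%N = 0 by rewrite /w psB psX0 b00 b0k subrr.
case: l wl1 wl => [|l] wl1 wl; first by rewrite w0 in wl.
have := congr1 (fun c : ps K => c l.+1) E3.
rewrite -[l.+1 in LHS]add0n mul_at //; last by move=> i il; rewrite /theta wl1 ?mul0rn.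
rewrite (mul_low (k := l.+1) (l := 1)) ?addn1 //; last by case.
move=> /eqP; rewrite mulf_eq0 (negbTE a0) /= /theta -mulr_natr mulf_eq0.
by rewrite (negbTE (char0 l)) orbF => /eqP.
Qed.

End FieldSeries.

(** * Puiseux expansions *)

Section PolyPs.
Variable A : comNzRingType.

Definition poly2ps (p : {poly A}) : ps A := fun j => p`_j.
Fact poly2ps_zmod : zmod_morphism poly2ps.
Proof. by move=> p q; apply: psP => n; rewrite psB /poly2ps coefB. Qed.
HB.instance Definition _ := GRing.isZmodMorphism.Build {poly A} (ps A) poly2ps poly2ps_zmod.
Fact poly2ps_mul : monoid_morphism poly2ps.
Proof.
split=> [|p q]; apply: psP => n; first by rewrite /poly2ps coef1 ps1.
by rewrite psM /poly2ps coefM.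
Qed.
HB.instance Definition _ := GRing.isMonoidMorphism.Build {poly A} (ps A) poly2ps poly2ps_mul.

Lemma poly2psX : poly2ps 'X = psX.
Proof. by apply: psP => n; rewrite /poly2ps coefX. Qed.
Lemma poly2psC c : poly2ps c%:P = psC c.
Proof. by apply: psP => n; rewrite /poly2ps coefC. Qed.

End PolyPs.

Lemma evy_poly (A : comNzRingType) (e : ps A) (p : {poly ps A}) :
  e 0%N = 0 -> evy e (poly2ps p) = p.[e].
Proof.
move=> e0; elim/poly_ind: p => [|p c IH]; first by rewrite !raddf0 horner0.
rewrite rmorphD rmorphM rmorphD rmorphM /= poly2psX poly2psC evyX evyC z0_id //.
by rewrite IH hornerMXaddC.
Qed.

Lemma map_ps_poly (A B : comNzRingType) (f : {rmorphism A -> B}) (p : {poly A}) :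
  map_ps f (poly2ps p) = poly2ps (map_poly f p).
Proof. by apply: psP => n; rewrite /map_ps /poly2ps coef_map. Qed.

Section Ramification.
Variable A : comNzRingType.

(** The restriction F(0, y). *)
Definition red : ps (ps A) -> ps A := map_ps (@ps0c A).
HB.instance Definition _ := GRing.RMorphism.on red.

Definition ram N : ps (ps A) -> ps (ps A) := map_ps (comp (psX ^+ N)).
HB.instance Definition _ N := GRing.RMorphism.on (ram N).

Lemma redX : red psX = psX. Proof. exact: map_psX. Qed.
Lemma redC e : red (psC e) = psC (e 0%N). Proof. exact: map_psC. Qed.
Lemma ramX N : ram N psX = psX. Proof. exact: map_psX. Qed.
Lemma ramC N e : ram N (psC e) = psC (comp (psX ^+ N) e). Proof. exact: map_psC. Qed.

Lemma red_ram N F : red (ram N F) = red F.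
Proof. by apply: psP => n; rewrite /red /ram /map_ps /= /ps0c comp0. Qed.

Lemma comp_Xn_Xn M N (a : ps A) : (0 < M)%N -> (0 < N)%N ->
  comp (psX ^+ M) (comp (psX ^+ N) a) = comp (psX ^+ (N * M)) a.
Proof.
move=> M0 N0; rewrite comp_comp; congr (comp _ a).
rewrite z0_id; last by rewrite psXn; case: N N0.
rewrite rmorphXn /= compX z0_id; last by rewrite psXn; case: M M0.
by rewrite -exprM mulnC.
Qed.

Lemma ram_ram M N F : (0 < M)%N -> (0 < N)%N -> ram M (ram N F) = ram (N * M) F.
Proof. by move=> M0 N0; apply: psP => n; rewrite /ram /map_ps /= comp_Xn_Xn. Qed.

(** Exchanges the variables: a [series2] is indexed by the exponent of x first, whereas y is the
    outer variable of [ps (ps K)]. *)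
Definition transp (F : ps (ps A)) : ps (ps A) := fun n j => F j n.

Lemma transpM F G : transp (F * G) = transp F * transp G.
Proof.
apply: psP => n; apply: psP => j; rewrite psM ps_sum /transp psM ps_sum.
under eq_bigr do rewrite psM; under [RHS]eq_bigr do rewrite psM.
by rewrite exchange_big.
Qed.

End Ramification.

Section Puiseux.
Variable K : closedFieldType.
Hypothesis char0 : forall n, n.+1%:R != 0 :> K.

(** The unit is found degree by degree in x, hence the transposition. As F(0, y) = y^r u with u
    invertible, U_n can be chosen to cancel all terms y^j with j >= r in the coefficient of x^n of F
    U, except y^r itself for n = 0. *)
Lemma weierstrass (F : ps (ps K)) r : leading (red F) r ->
  exists (U : ps (ps K)) (W : {poly ps K}),
    [/\ U 0%N 0%N <> 0, W \is monic, size W = r.+1,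
        forall j, (j < r)%N -> W`_j 0%N = 0 & F * U = poly2ps W].
Proof.
move=> /leading_fact[u Fu u0]; have [v uv] := psK_inv u0.
pose sh (a : ps K) : ps K := fun n => a (n + r)%N.
have shE (a : ps K) n : (r <= n)%N -> (psX ^+ r * sh a) n = a n.
  by move=> rn; rewrite psXnM ltnNge rn /= /sh subnK.
pose T (U : ps (ps K)) n : ps K := (if n == 0%N then psX ^+ r else 0)
   - \sum_(i < n) transp F i.+1 * U (n - i.+1)%N.
have [|U0 HU] := @strong_rec (ps K) 0 (fun U n => v * sh (T U n)).
  move=> U V n UV; congr (_ * sh _); rewrite /T; congr (_ - _).
  by apply: eq_bigr => i _; rewrite UV //; have := ltn_ord i; lia.
move: U0 HU; change (nat -> ps K) with (ps (ps K)) => U HU.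
have TF : transp F 0%N = psX ^+ r * u by rewrite -Fu.
have HFU n j : (r <= j)%N -> (transp F * U) n j = ((n == 0%N) && (j == r))%:R.
  move=> rj; rewrite psM big_ord_recl /= subn0 TF.
  rewrite {1}HU.
  have -> : psX ^+ r * u * (v * sh (T U n)) = (u * v) * (psX ^+ r * sh (T U n)) by ring.
  rewrite uv mul1r psD shE // /T psB.
  rewrite -addrA [X in _ + X]addrC.
  have -> : (\sum_(i < n) transp F (bump 0 i) * U (n - bump 0 i)%N) = \sum_(i < n) transp F i.+1 * U (n - i.+1)%N by [].
  rewrite subrr addr0; case: eqP => //= _.
  by rewrite psXn.
pose W0 := \poly_(j < r.+1) transp (transp F * U) j.
have FU : F * transp U = transp (transp F * U) by rewrite [RHS]transpM.
have W0r : W0`_r = 1.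
  rewrite coef_poly ltnSn; apply: psP => n.
  by rewrite -[LHS]/((transp F * U) n r) HFU // eqxx andbT ps1.
have sW : size W0 = r.+1.
  by apply: size_poly_eq; move: W0r; rewrite coef_poly ltnSn /= => ->; exact: oner_neq0.
exists (transp U), W0; split=> //.
- rewrite /transp HU psM0 /T /= big_ord0 subr0 /sh psXn eqxx mulr1 => v0.
  have := congr1 (fun c : ps K => c 0%N) uv; rewrite psM0 v0 mulr0 ps1 => /esym/eqP.
  by rewrite oner_eq0.
- by rewrite monicE lead_coefE sW W0r.
- move=> j jr; rewrite coef_poly (leq_trans jr) // -[LHS]/((transp F * U) 0%N j) psM0 TF.
  by rewrite (mul_low (k := r) (l := 0)) ?addn0 // => i ir; rewrite psXnM ir.
- rewrite FU; apply: psP => j; rewrite /poly2ps coef_poly; case: ltnP => // rj.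
  apply: psP => n; rewrite -[LHS]/((transp F * U) n j) HFU ?(ltnW rj) //.
  by rewrite (gtn_eqF rj) andbF.
Qed.

Lemma coef_XsubC_exp (A : nzRingType) (c : A) r : (0 < r)%N ->
  ((('X - c%:P) ^+ r)`_r.-1 = - (c *+ r)).
Proof.
elim: r => // -[|r] IH _.
  by rewrite expr1 coefB coefX coefC sub0r mulr1n.
rewrite exprS mulrBl coefB coefXM coefCM /= IH //.
have -> : (('X - c%:P) ^+ r.+1)`_r.+1 = 1.
  have := monic_exp r.+1 (monicXsubC c); rewrite monicE lead_coefE size_exp_XsubC.
  by move/eqP.
by rewrite mulr1 -opprD -mulrSr.
Qed.

Lemma tschirnhaus (A : comNzRingType) (d : A) (W : {poly A}) r : (0 < r)%N ->
  W \is monic -> size W = r.+1 -> W`_r.-1 = d *+ r ->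
  [/\ W \Po ('X - d%:P) \is monic, size (W \Po ('X - d%:P)) = r.+1 &
      (W \Po ('X - d%:P))`_r.-1 = 0].
Proof.
move=> r0 Wm sW Wd; set q := 'X - d%:P.
have sq n : size (q ^+ n) = n.+1 by rewrite size_exp_XsubC.
have WE : W \Po q = q ^+ r + (d *+ r) *: q ^+ r.-1 + \sum_(i < r.-1) W`_i *: q ^+ i.
  have Wr : W`_r = 1 by move: Wm; rewrite monicE lead_coefE sW => /eqP.
  rewrite comp_polyE sW -(prednK r0) !big_ord_recr /= prednK // Wd Wr scale1r.
  by rewrite addrC [X in _ + X]addrC addrA.
have sR : (size (\sum_(i < r.-1) W`_i *: q ^+ i)%R <= r.-1)%N.
  apply: (leq_trans (size_sum _ _ _)); apply/bigmax_leqP => i _.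
  by apply: leq_trans (size_scale_leq _ _) _; rewrite sq.
have sR2 : (size ((d *+ r) *: q ^+ r.-1 + \sum_(i < r.-1) W`_i *: q ^+ i)%R < r.+1)%N.
  rewrite ltnS; apply: (leq_trans (size_polyD _ _)); rewrite geq_max.
  rewrite (leq_trans (size_scale_leq _ _)) ?sq ?prednK //=.
  by apply: (leq_trans sR); rewrite leq_pred.
have sz : size (W \Po q) = r.+1 by rewrite WE -addrA size_polyDl sq.
split=> //.
  by rewrite monicE WE -addrA lead_coefDl ?sq // -monicE monic_exp // monicXsubC.
rewrite WE !coefD coefZ coef_XsubC_exp // [X in _ + X]nth_default ?addr0 //.
have -> : (q ^+ r.-1)`_r.-1 = 1.
  have := monic_exp r.-1 (monicXsubC d); rewrite monicE lead_coefE sq.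
  by move/eqP.
by rewrite mulr1 addNr.
Qed.

(** The least slope n / (r - j) of a Newton polygon, where [o j] is the order of the coefficient of
    degree j. The slopes are compared as integers, over the common denominator r!. *)
Lemma min_slope (r : nat) (o : nat -> option nat) :
  (exists2 j, (j < r)%N & o j <> None) ->
  exists2 j0, (j0 < r)%N & exists2 p, o j0 = Some p &
    forall j n, (j < r)%N -> o j = Some n -> (p * (r - j) <= n * (r - j0))%N.
Proof.
move=> [j1 j1r oj1].
pose w j := if o j is Some n then (n * (r`! %/ (r - j)))%N else 0%N.
pose P (j : 'I_r) := o j != None.
have P1 : P (Ordinal j1r) by apply/eqP.
case: (@arg_minnP _ (Ordinal j1r) P w P1) => j0 Pj0 min.
move: (Pj0); rewrite /P; case E: (o j0) => [p|] // _.
exists j0 => //; exists p => // j n jr oj.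
have := min (Ordinal jr); rewrite /P /w /= oj E => /(_ isT) H.
have d i : (i < r)%N -> (r`! %/ (r - i) * (r - i))%N = r`!.
  by move=> ir; rewrite divnK // dvdn_fact // subn_gt0 ir leq_subr.
have := leq_mul H (leqnn ((r - j0) * (r - j)))%N.
have := d _ jr; have := d _ (ltn_ord j0); have := fact_gt0 r.
move: (r`!) (r - j)%N (r - j0)%N (r`! %/ (r - j))%N (r`! %/ (r - j0))%N.
move=> f a b y x f0 e1 e2.
have -> : (p * x * (b * a) = p * a * f)%N by rewrite -e1; nia.
have -> : (n * y * (b * a) = n * b * f)%N by rewrite -e2; nia.
by rewrite leq_pmul2r.
Qed.

Lemma low_ord (a : ps K) p : (forall l, leading a l -> (p <= l)%N) ->
  forall i, (i < p)%N -> a i = 0.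
Proof.
move=> H i ip; have [->//|/leading_exists[l al]] := EM (a = 0).
by case: (al) => al1 _; apply: al1; apply: leq_trans (H _ al).
Qed.

(** Let p / q be the least slope of the Newton polygon. After s := s^q and y := s^p y a factor s^(p
    r) splits off, and the quotient [W'] keeps a nonzero coefficient of degree less than r at s = 0.
    The extra [N] leaves room for the ramification of the next steps. *)
Lemma reduction_step (W : {poly ps K}) r : (0 < r)%N ->
  W \is monic -> size W = r.+1 -> W`_r.-1 = 0 ->
  (forall j, (j < r)%N -> W`_j 0%N = 0) -> (exists2 j, (j < r)%N & W`_j <> 0) ->
  exists p q, [/\ (0 < p)%N, (0 < q)%N & exists2 W' : {poly ps K},
    [/\ W' \is monic, size W' = r.+1, W'`_r.-1 = 0 &
      exists2 j, (j < r)%N & W'`_j 0%N <> 0] &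
    forall N z, (0 < N)%N -> (map_poly (comp (psX ^+ (q * N))) W).[psX ^+ (p * N) * z] =
      psX ^+ (p * N * r) * (map_poly (comp (psX ^+ N)) W').[z]].
Proof.
move=> r0 Wm sW Wr1 W00 [j1 j1r Wj1].
pose o j := if pselect (exists l, leading W`_j l) is left H then Some (projT1 (cid H)) else None.
have oP j l : leading W`_j l -> o j = Some l.
  rewrite /o; case: pselect => [H al|nH al]; last by case: nH; exists l.
  by congr Some; apply: (leading_uniq (projT2 (cid H))).
have oP' j l : o j = Some l -> leading W`_j l.
  by rewrite /o; case: pselect => // H [<-]; exact: (projT2 (cid H)).
have [|j0 j0r [p op minp]] := @min_slope r o.
  by exists j1 => //; have /leading_exists[l /oP ->] := Wj1.
have W1 : W`_r = 1 by move: Wm; rewrite monicE lead_coefE sW => /eqP.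
set q := (r - j0)%N; have q0 : (0 < q)%N by rewrite subn_gt0.
have p0 : (0 < p)%N.
  by case: p op {minp} => // /oP'[_]; rewrite W00.
have low j : (j < r)%N -> forall i, (i < p * (r - j))%N -> comp (psX ^+ q) W`_j i = 0.
  move=> jr; apply: low_ord => l; have [->|/leading_exists[n jn]] := EM (W`_j = 0).
    by rewrite raddf0 => /leading_neq0.
  have := leading_comp (leading_Xn q (u := 1) _) q0 jn; rewrite mulr1 ps1 => H al.
  have -> := leading_uniq al (H _); last by apply/eqP; rewrite oner_eq0.
  by rewrite [leqRHS]mulnC; apply: minp => //; exact: oP.
pose b j : ps K := fun n => comp (psX ^+ q) W`_j (n + p * (r - j))%N.
have bE j : (j <= r)%N -> comp (psX ^+ q) W`_j = psX ^+ (p * (r - j)) * b j.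
  rewrite leq_eqVlt => /orP[/eqP->|jr]; last by apply: low_fact; exact: low.
  by rewrite subnn muln0 expr0 mul1r; apply: psP => n; rewrite /b subnn muln0 addn0.
have br : b r = 1.
  by apply: psP => n; rewrite /b subnn muln0 addn0 W1 rmorph1.
have W'c j : (\poly_(i < r.+1) b i)`_j = if (j < r.+1)%N then b j else 0 by rewrite coef_poly.
have sW' : size (\poly_(i < r.+1) b i) = r.+1.
  by apply: size_poly_eq; rewrite br oner_neq0.
exists p, q; split=> //; exists (\poly_(i < r.+1) b i).
  split=> //; first by rewrite monicE lead_coefE sW' W'c ltnSn br.
  - rewrite W'c prednK // leqnSn.
    by apply: psP => n; rewrite /b Wr1 raddf0.
  - exists j0 => //; rewrite W'c (leq_trans j0r) //.
    rewrite /b add0n.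
    have := leading_comp (leading_Xn q (u := 1) _) q0 (oP' _ _ op); rewrite mulr1 ps1.
    have K1 : (0 == 0)%N%:R <> 0 :> K by apply/eqP; rewrite oner_eq0.
    by move=> /(_ K1)[_]; rewrite -/q mulnC.
move=> N z N0; rewrite !(horner_coef_wide (n := r.+1)) ?(leq_trans (size_poly _ _)) ?sW ?sW' //.
rewrite mulr_sumr; apply: eq_bigr => j _; rewrite !coef_map /= W'c ltn_ord.
rewrite -comp_Xn_Xn // bE -1?ltnS // rmorphM rmorphXn /= compX z0_id; last first.
  by rewrite psXn; case: N N0.
have -> : (p * N * r = N * (p * (r - j)) + p * N * j)%N by have := ltn_ord j; nia.
rewrite exprMn -!exprM exprD; ring.
Qed.

(* By Weierstrass preparation and a translation, F is a monic polynomial of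
   degree r without term of degree r - 1.  After rescaling along its first
   slope, its reduction is not an r-th power, so that a root of the reduction
   has multiplicity less than r. *)
Lemma puiseux_root r (F : ps (ps K)) : (0 < r)%N -> leading (red F) r ->
  exists N e, [/\ (0 < N)%N, e 0%N = 0 & evy e (ram N F) = 0].
Proof.
elim/ltn_ind: r F => r IH F r0 /weierstrass[U [W [U00 Wm sW W00 FU]]].
suff [N [e [N0 e0 We]]] : exists N (e : ps K),
    [/\ (0 < N)%N, e 0%N = 0 & (map_poly (comp (psX ^+ N)) W).[e] = 0].
  exists N, e; split=> //.
  have : evy e (ram N F) * evy e (ram N U) = 0.
    by rewrite -!rmorphM /= FU /ram map_ps_poly evy_poly.
  case/psK_dom => // eU; have := congr1 (fun c : ps K => c 0%N) eU.
  by rewrite evy0 /ram /map_ps /= comp0.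
pose d := psC (r%:R^-1) * W`_r.-1.
have dr : W`_r.-1 = d *+ r.
  rewrite /d -mulrnAl -rmorphMn /= -mulr_natr mulVf ?rmorph1 ?mul1r //.
  by case: r r0 {IH sW W00 d}.
have d0 : d 0%N = 0 by rewrite /d psCM W00 ?mulr0 // prednK.
have [W2m sW2 W2r] := tschirnhaus r0 Wm sW dr.
set W2 := W \Po _ in W2m sW2 W2r.
have W2E N z : (map_poly (comp (psX ^+ N)) W2).[z] =
    (map_poly (comp (psX ^+ N)) W).[z - comp (psX ^+ N) d].
  by rewrite map_comp_poly rmorphB /= map_polyX map_polyC /= horner_comp hornerXsubC.
have W200 j : (j < r)%N -> W2`_j 0%N = 0.
  move=> jr; rewrite -[LHS]/(ps0c W2`_j) -coef_map /= map_comp_poly.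
  rewrite rmorphB /= map_polyX map_polyC /= [ps0c d]d0 subr0 comp_polyXr.
  by rewrite coef_map /= /ps0c W00.
have [W20|] := EM (forall j, (j < r)%N -> W2`_j = 0).
  exists 1%N, (- d); split=> //; first by rewrite psN d0 oppr0.
  have := W2E 1%N 0; rewrite sub0r expr1 comp_id => <-.
  by rewrite horner_coef0 coef_map W20 ?raddf0.
move=> /existsNP[j /not_implyP[jr W2j]].
have [|p [q [p0 q0 [W' [W'm sW' W'r [j0 j0r W'j0]] W'E]]]] :=
  reduction_step r0 W2m sW2 W2r W200; first by exists j.
pose w := map_poly (@ps0c K) W'.
have wc i : w`_i = W'`_i 0%N by rewrite coef_map.
have w1 : w`_r = 1.
  rewrite wc; move: W'm; rewrite monicE lead_coefE sW' => /eqP /= ->; by rewrite ps1.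
have sw : size w = r.+1.
  apply/eqP; rewrite eqn_leq -{1}sW' size_poly /=.
  rewrite ltnNge; apply/negP => /leq_sizeP/(_ r (leqnn r)) /eqP.
  by rewrite w1 oner_eq0.
have /closed_rootP[z0 /rootP wz] : size w != 1 by rewrite sw; case: (r) r0.
have wn0 : w != 0 by rewrite -size_poly_eq0 sw.
have [m [h + wE]] := multiplicity_XsubC w z0; rewrite wn0 /= => hz.
have hn0 : h != 0 by apply: contraNneq wn0 => h0; rewrite wE h0 mul0r.
have m0 : (0 < m)%N.
  case: m wE => // wE; move: hz; rewrite /root -[h]mulr1 -[1](expr0 ('X - z0%:P)) -wE.
  by rewrite wz eqxx.
(* Otherwise w = (y - z0)^r. Its coefficient of degree r - 1 is - r z0 and vanishes, so z0 = 0 and w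
   = y^r, contrary to the nonzero lower coefficient of [W'] at s = 0. *)
have mr : (m < r)%N.
  have sE : r.+1 = (size h + m)%N.
    by rewrite -sw wE size_Mmonic ?monic_exp ?monicXsubC // size_exp_XsubC addnS.
  have h0 : (0 < size h)%N by rewrite size_poly_gt0.
  rewrite ltn_neqAle; apply/andP; split; last by lia.
  apply/eqP => mr; have /size1_polyC hc : (size h <= 1)%N by lia.
  have h1 : h`_0 = 1.
    move: w1; rewrite wE hc coefCM -mr.
    have := monic_exp m (monicXsubC z0); rewrite monicE lead_coefE size_exp_XsubC.
    by move=> /eqP /= ->; rewrite mulr1 coefC.
  have := coef_XsubC_exp z0 r0; rewrite -mr.
  have -> : ('X - z0%:P) ^+ m = w by rewrite wE hc h1 mul1r.
  rewrite wc mr W'r ps0 => /esym/eqP; rewrite oppr_eq0 -mulr_natr mulf_eq0.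
  case: (r) r0 => // r' _; rewrite (negbTE (char0 r')) orbF => /eqP z00.
  case: W'j0; rewrite -wc wE hc h1 mul1r z00 subr0 coefXn mr.
  by rewrite ltn_eqF.
pose G := poly2ps (W' \Po ('X + (psC z0)%:P)).
have lG : leading (red G) m.
  rewrite /red map_ps_poly map_comp_poly rmorphD /= map_polyX map_polyC /= -/w.
  rewrite wE comp_polyM rmorphXn /= comp_polyB comp_polyX comp_polyC.
  rewrite [ps0c _](_ : _ = z0) // addrK rmorphM rmorphXn /= poly2psX mulrC.
  apply: leading_Xn; rewrite /poly2ps -horner_coef0 horner_comp hornerD hornerX hornerC.
  by rewrite add0r; exact/eqP.
have [N [e [N0 e0 Ge]]] := IH _ mr G m0 lG.
exists (q * N)%N, (psX ^+ (p * N) * (e + psC z0) - comp (psX ^+ (q * N)) d); split.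
- by rewrite muln_gt0 q0.
- by rewrite psB psM0 psXn comp0 d0 subr0 [_ == _]ltn_eqF ?mul0r // muln_gt0 p0.
- rewrite -W2E W'E //.
  move: Ge; rewrite /ram map_ps_poly evy_poly // map_comp_poly rmorphD /= map_polyX map_polyC /=.
  by rewrite horner_comp hornerD hornerX hornerC compC => ->; rewrite mulr0.
Qed.

Lemma puiseux_split r (F : ps (ps K)) : leading (red F) r ->
  exists N (es : seq (ps K)) (U : ps (ps K)),
    [/\ (0 < N)%N, size es = r, forall e, e \in es -> e 0%N = 0, U 0%N 0%N <> 0 &
        ram N F = U * \prod_(e <- es) (psX - psC e)].
Proof.
elim: r F => [|r IH] F Fr.
  exists 1%N, [::], F; split=> //; first by case: Fr.
  rewrite big_nil mulr1; apply: psP => n; rewrite /ram /map_ps /=.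
  by rewrite expr1 comp_id.
have [//|N [e [N0 e0 Fe]]] := puiseux_root _ Fr.
have [Q FQ] := evy_root Fe; rewrite z0_id // in FQ.
have Qr : leading (red Q) r.
  move: Fr; rewrite -(red_ram N) FQ rmorphM rmorphB /= redX redC e0 rmorph0 subr0.
  move=> [H1 H2]; split=> [i ir|].
    by have := H1 i.+1; rewrite psXM; exact.
  by move: H2; rewrite psXM.
have [M [es [U [M0 ses es0 U0 QU]]]] := IH Q Qr.
exists (N * M)%N, (comp (psX ^+ M) e :: es), U; split=> //.
- by rewrite muln_gt0 N0.
- by rewrite /= ses.
- by move=> f; rewrite inE => /orP[/eqP->|/es0//]; rewrite comp0.
- rewrite -ram_ram // FQ rmorphM rmorphB /= QU ramX ramC big_cons; ring.
Qed.

End Puiseux.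

(** * Codimension of ideals of K[[x, y]] *)

Section Codimension.
Variable K : fieldType.
Local Notation R2 := (ps (ps K)).
Implicit Types (J : R2 -> Prop) (f g h p U F G H : R2) (e : ps K).

Definition cst (c : K) : R2 := psC (psC c).
HB.instance Definition _ := GRing.RMorphism.copy cst (@psC (ps K) \o @psC K).

Lemma cstE c f i j : (cst c * f) i j = c * f i j.
Proof. by rewrite /cst psCM psCM. Qed.

Definition lin n (b : 'I_n -> R2) (c : 'rV[K]_n) : R2 := \sum_l cst (c 0 l) * b l.

Definition qdim J n := exists b : 'I_n -> R2,
  forall h, exists! c : 'rV[K]_n, J (h - lin b c).

Definition subsp J := [/\ J 0, forall x y, J x -> J y -> J (x - y) &
  forall c x, J x -> J (cst c * x)].

Lemma subspD J x y : subsp J -> J x -> J y -> J (x + y).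
Proof.
move=> [J0 JB _] Jx Jy; rewrite -[y]opprK -[- y]sub0r.
by apply: (JB) => //; exact: JB.
Qed.

Lemma subsp_sum J I (r : seq I) (F : I -> R2) :
  subsp J -> (forall i, J (F i)) -> J (\sum_(i <- r) F i).
Proof.
move=> SJ JF; elim/big_rec: _ => [|i x _]; first by case: SJ.
exact: subspD.
Qed.

Lemma linB n (b : 'I_n -> R2) c d : lin b (c - d) = lin b c - lin b d.
Proof.
rewrite /lin -sumrB; apply: eq_bigr => i _.
by rewrite !mxE rmorphB mulrBl.
Qed.

Lemma lin_mul m n (b : 'I_n -> R2) (c : 'rV_m) (D : 'M_(m, n)) :
  lin b (c *m D) = lin (fun i => lin b (row i D)) c.
Proof.
rewrite /lin; under [RHS]eq_bigr => i _ do rewrite mulr_sumr.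
rewrite exchange_big; apply: eq_bigr => j _ /=.
rewrite mxE rmorph_sum mulr_suml; apply: eq_bigr => i _.
by rewrite mxE rmorphM /= mulrA.
Qed.

Lemma lin_delta n (b : 'I_n -> R2) i : lin b (delta_mx 0 i) = b i.
Proof.
rewrite /lin (bigD1 i) //= mxE !eqxx rmorph1 mul1r big1 ?addr0 // => j ji.
by rewrite mxE (negbTE ji) andbF rmorph0 mul0r.
Qed.

Lemma lin_congr J n (b b' : 'I_n -> R2) c : subsp J -> (forall i, J (b i - b' i)) ->
  J (lin b c - lin b' c).
Proof.
move=> SJ bb; rewrite /lin -sumrB; apply: subsp_sum => // i.
by rewrite -mulrBr; case: SJ => _ _; apply.
Qed.

(** The coordinates of each family in the other form matrices D and E, and uniqueness of coordinates
    gives D E = 1. *)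
Lemma qdim_le J m n : subsp J -> qdim J m -> qdim J n -> (m <= n)%N.
Proof.
move=> SJ [a Ha] [b Hb].
have coords (s q : nat) (u : 'I_s -> R2) (v : 'I_q -> R2) :
    (forall h, exists! c : 'rV[K]_q, J (h - lin v c)) ->
    exists D : 'M[K]_(s, q), forall i, J (u i - lin v (row i D)).
  move=> Hv; have /choice[D HD] : forall i, exists c : 'rV_q, J (u i - lin v c).
    by move=> i; have [c [Jc _]] := Hv (u i); exists c.
  exists (\matrix_i D i) => i; by rewrite rowK.
have [D HD] := coords _ _ a b Hb; have [E HE] := coords _ _ b a Ha.
apply: (@mulmx1_min _ _ _ D E); apply/row_matrixP => i.
have [c [_ cu]] := Ha (a i); rewrite -(cu (row i (D *m E))); last first.
  have -> : a i - lin a (row i (D *m E)) =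
     (a i - lin b (row i D)) + (lin b (row i D) - lin a (row i (D *m E))) by ring.
  apply: subspD => //; rewrite row_mul lin_mul; exact: lin_congr.
rewrite -(cu (row i 1%:M)) // row1 lin_delta subrr; by case: SJ.
Qed.

Lemma qdim_uniq J m n : subsp J -> qdim J m -> qdim J n -> m = n.
Proof. by move=> SJ Jm Jn; apply/eqP; rewrite eqn_leq !(qdim_le SJ). Qed.

(** A family whose images under [phi] have the largest possible rank spans the image of [phi]; a row
    base of these images lifts to a basis modulo J. *)
Lemma qdim_embed J M (phi : R2 -> 'rV[K]_M) : subsp J ->
  (forall x y, phi (x - y) = phi x - phi y) ->
  (forall c x, phi (cst c * x) = c *: phi x) ->
  (forall x, J x <-> phi x = 0) -> exists d, qdim J d.
Proof.
move=> SJ phiB phiZ phiJ.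
have phi0 : phi 0 = 0 by rewrite -(subrr (0 : R2)) phiB subrr.
have phiD x y : phi (x + y) = phi x + phi y.
  by rewrite -{1}[y]opprK phiB -[- y]sub0r phiB phi0 sub0r opprK.
have phil n (b : 'I_n -> R2) c : phi (lin b c) = c *m (\matrix_i phi (b i)).
  rewrite mulmx_sum_row /lin (big_morph phi phiD phi0); apply: eq_bigr => i _.
  by rewrite phiZ rowK.
pose P r := `[< exists n (b : 'I_n -> R2), \rank (\matrix_i phi (b i)) = r >].
have exP : exists r, P r.
  by exists (\rank (\matrix_(i < 0) phi 0)); rewrite /P; apply/asboolP; exists 0%N, (fun=> 0).
have PM r : P r -> (r <= M)%N by move=> /asboolP[n [b <-]]; exact: rank_leq_col.
case: (ex_maxnP exP PM) => r /asboolP[n [b rb]] rmax.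
set B := \matrix_i phi (b i) in rb.
have inB h : (phi h <= B)%MS.
  pose b1 (i : 'I_(n + 1)) := match fintype.split i with inl i => b i | inr _ => h end.
  have E : \matrix_i phi (b1 i) = col_mx B (phi h).
    apply/row_matrixP => i; rewrite rowK /b1; case: split_ordP => j ->.
      by rewrite rowKu rowK.
    by rewrite rowKd (ord1 j) row_id.
  have : P (\rank (col_mx B (phi h))) by apply/asboolP; exists (n + 1)%N, b1; rewrite E.
  move=> /rmax; rewrite -rb -addsmxE.
  rewrite (geq_leqif (mxrank_leqif_sup (addsmxSl B (phi h)))).
  by move=> H; apply: submx_trans (addsmxSr _ _) H.
have [D BD] : exists D, row_base B = D *m B.
  by apply/submxP; rewrite eq_row_base.
exists (\rank B), (fun i => lin b (row i D)) => h.
have phil2 c : phi (lin (fun i => lin b (row i D)) c) = c *m row_base B.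
  rewrite phil BD; congr (_ *m _); apply/row_matrixP => i.
  by rewrite rowK phil row_mul.
have /submxP[c hc] : (phi h <= row_base B)%MS by rewrite eq_row_base.
exists c; split=> [|c']; first by apply/phiJ; rewrite phiB phil2 hc subrr.
move=> /phiJ; rewrite phiB phil2 hc => /eqP; rewrite subr_eq0 => /eqP.
by apply: row_free_inj; exact: row_base_free.
Qed.

Definition idl f g : R2 -> Prop := fun h => exists u v, h = u * f + v * g.

Lemma idl_subsp f g : subsp (idl f g).
Proof.
split=> [|x y [u [v ->]] [u' [v' ->]]|c x [u [v ->]]].
- by exists 0, 0; rewrite !mul0r addr0.
- by exists (u - u'), (v - v'); ring.
- by exists (cst c * u), (cst c * v); ring.
Qed.

(** Additivity along 0 -> R/J' -> R/J -> R/J'' -> 0, where the first map is multiplication by p. *)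
Lemma qdim_ext (J J' J'' : R2 -> Prop) p n' n'' : subsp J ->
  (forall a, J' a <-> J (p * a)) ->
  (forall x, J'' x <-> exists a, J (x - p * a)) ->
  qdim J' n' -> qdim J'' n'' -> qdim J (n' + n'').
Proof.
move=> SJ HJ' HJ'' [b' Hb'] [b'' Hb''].
pose b (i : 'I_(n' + n'')) := match fintype.split i with inl i => p * b' i | inr i => b'' i end.
have linE c : lin b c = p * lin b' (lsubmx c) + lin b'' (rsubmx c).
  rewrite /lin big_split_ord mulr_sumr; congr (_ + _); apply: eq_bigr => i _.
    rewrite /b; case: split_ordP => j; last by move/eqP; rewrite eq_lrshift.
    by move/lshift_inj <-; rewrite mxE; ring.
  rewrite /b; case: split_ordP => j; first by move/eqP; rewrite eq_rlshift.
  by move/rshift_inj <-; rewrite mxE.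
exists b => h; have [c'' [/HJ''[a Ja] u'']] := Hb'' h.
have [c' [/HJ' Jc' u']] := Hb' a.
exists (row_mx c' c''); split.
  rewrite linE row_mxKl row_mxKr.
  have -> : h - (p * lin b' c' + lin b'' c'') =
    (h - lin b'' c'' - p * a) + p * (a - lin b' c') by ring.
  exact: subspD.
move=> d; rewrite linE => Jd; rewrite -[d]hsubmxK; congr row_mx; last first.
  symmetry; rewrite -(u'' (rsubmx d)) //; apply/HJ''.
  by exists (lin b' (lsubmx d)); rewrite (_ : _ - _ = h - (p * lin b' (lsubmx d) + lin b'' (rsubmx d))) //; ring.
have e'' : c'' = rsubmx d.
  apply: u''; apply/HJ''; exists (lin b' (lsubmx d)).
  by rewrite (_ : _ - _ = h - (p * lin b' (lsubmx d) + lin b'' (rsubmx d))) //; ring.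
apply: u'; apply/HJ'.
have -> : p * (a - lin b' (lsubmx d)) = (h - (p * lin b' (lsubmx d) + lin b'' (rsubmx d)))
   - (h - lin b'' c'' - p * a) by rewrite e''; ring.
by case: SJ => _ JB _; exact: JB.
Qed.

Lemma qdim_unit U g : U 0%N 0%N <> 0 -> qdim (idl U g) 0.
Proof.
move=> /psKK_inv[V UV]; exists (fun=> 0) => h; exists 0; split.
  by exists ((h - lin (fun _ : 'I_0 => 0) 0) * V), 0; rewrite -mulrA [V * U]mulrC UV mulr1 mul0r addr0.
by move=> c _; rewrite [c]thinmx0.
Qed.

(** Evaluation at e identifies the quotient with K[[s]] / (g(e)), which has the basis 1, s, ...,
    s^(o-1). *)
Lemma qdim_eval e g o : e 0%N = 0 -> leading (evy e g) o ->
  qdim (idl (psX - psC e) g) o.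
Proof.
move=> e0 lg; have [u gu u0] := leading_fact lg; have [v uv] := psK_inv u0.
have memJ h : idl (psX - psC e) g h <-> forall i, (i < o)%N -> evy e h i = 0.
  split=> [[a [b ->]] i io|h0].
    rewrite rmorphD !rmorphM rmorphB /= evyX evyC z0_id // subrr mulr0 add0r.
    by rewrite gu mulrCA psXnM io.
  have [q hq] : exists q, evy e h = psX ^+ o * q by eexists; exact: low_fact.
  have /evy_root[Q hQ] : evy e (h - psC (q * v) * g) = 0.
    rewrite rmorphB rmorphM /= evyC gu hq.
    rewrite (_ : _ - _ = psX ^+ o * q * (1 - u * v)); last by ring.
    by rewrite uv subrr mulr0.
  exists Q, (psC (q * v)).
  by rewrite z0_id // in hQ; rewrite [Q * _]mulrC -hQ subrK.
pose b (l : 'I_o) : R2 := psC (psX ^+ l).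
have ev_lin c (i : 'I_o) : evy e (lin b c) i = c 0 i.
  rewrite /lin rmorph_sum ps_sum (bigD1 i) //= big1 ?addr0 => [|l li].
    by rewrite rmorphM /= !evyC psCM psXn eqxx mulr1.
  rewrite rmorphM /= !evyC psCM psXn [_ == _](negbTE _) ?mulr0 //.
  by apply: contraNneq li => il; apply/eqP/val_inj.
exists b => h; exists (\row_i evy e h i); split.
  apply/memJ => i io; rewrite rmorphB psB.
  by have := ev_lin (\row_i evy e h i) (Ordinal io); rewrite mxE /= => ->; rewrite subrr.
move=> c /memJ H; apply/rowP => i; rewrite mxE -ev_lin.
by apply/eqP; rewrite -subr_eq0; have := H i (ltn_ord i); rewrite rmorphB psB => ->.
Qed.

(** Additivity of intersection numbers. For p = y - e the ideal (p P, g) : p is (P, g), because p a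
    in (p P, g) forces a multiplier of g that vanishes at e, g(e) being nonzero. *)
Lemma qdim_split U (es : seq (ps K)) (o : ps K -> nat) g : U 0%N 0%N <> 0 ->
  (forall e, e \in es -> e 0%N = 0 /\ leading (evy e g) (o e)) ->
  qdim (idl (U * \prod_(e <- es) (psX - psC e)) g) (\sum_(e <- es) o e).
Proof.
move=> U0; elim: es => [|e es IH] H; first by rewrite !big_nil mulr1; exact: qdim_unit.
have [e0 eg] := H e (mem_head _ _).
rewrite !big_cons addnC; set P := \prod_(j <- es) _; set p := psX - psC e.
have := IH (fun a aes => H a (mem_behead (s := e :: es) aes)); rewrite -/P => IH'.
apply: (qdim_ext (p := p) _ _ _ IH' (qdim_eval e0 eg)); first exact: idl_subsp.
  move=> a; split=> [[u [v ->]]|[u [v E]]].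
    by exists u, (p * v); ring.
  have : evy e (p * (a - u * (U * P))) = evy e (v * g).
    by congr evy; rewrite mulrBr E; ring.
  rewrite !rmorphM rmorphB /= evyX evyC z0_id // subrr mul0r => /esym/psK_dom[|g0]; last first.
    by case/leading_neq0: eg.
  move=> /evy_root[w]; rewrite z0_id // -/p => vw.
  exists u, w; apply: (@domI _ p); first exact: psKK_dom.
    move=> p0; have := congr1 (fun F : R2 => F 1%N) p0.
    by rewrite /p psB /psX /psC /= subr0 => /eqP; rewrite oner_eq0.
  by rewrite E vw; ring.
move=> x; split=> [[u [v ->]]|[a [u [v E]]]].
  by exists u, 0, v; rewrite -/p; ring.
exists (a + u * (U * P)), v; have -> : x = (x - p * a) + p * a by ring.
by rewrite E; rewrite -/p; ring.
Qed.

(** * Codimension under the ramification s := s^N *)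

Section Ram.
Variables (N : nat) (N0 : (0 < N)%N).

(** The coefficient of s^i when H is written in the basis 1, s, ..., s^(N-1) over the series in
    s^N. *)
Definition rcomp i (H : R2) : R2 := fun j n => H j (N * n + i)%N.

Lemma rcompD i F G : rcomp i (F + G) = rcomp i F + rcomp i G. Proof. by []. Qed.
Lemma rcompB i F G : rcomp i (F - G) = rcomp i F - rcomp i G. Proof. by []. Qed.
Lemma rcomp_sum i I (r : seq I) (F : I -> R2) :
  rcomp i (\sum_(j <- r) F j) = \sum_(j <- r) rcomp i (F j).
Proof. by elim/big_rec2: _ => // j x y _ <-. Qed.

Lemma ramE F j n : ram N F j n = if (N %| n)%N then F j (n %/ N)%N else 0.
Proof. by rewrite /ram /map_ps /= comp_Xn. Qed.

Lemma rcomp_ramM i F H : (i < N)%N -> rcomp i (ram N F * H) = F * rcomp i H.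
Proof.
move=> iN; apply: psP => j; apply: psP => n.
rewrite /rcomp !psM !ps_sum; apply: eq_bigr => l _; rewrite !psM.
rewrite (bigID (fun a : 'I__ => N %| a)%N) /= [X in _ + X]big1 ?addr0; last first.
  by move=> a /negbTE Na; rewrite ramE Na mul0r.
have lt (a : 'I_n.+1) : (N * a < (N * n + i).+1)%N.
  by rewrite ltnS (leq_trans _ (leq_addr _ _)) // leq_mul2l -ltnS ltn_ord orbT.
rewrite (reindex (fun a : 'I_n.+1 => Ordinal (lt a))) /=; last first.
  have ge (a : 'I_(N * n + i).+1) : (a %/ N < n.+1)%N.
    by rewrite ltn_divLR //; apply: leq_trans (ltn_ord a) _; nia.
  exists (fun a => Ordinal (ge a)) => a; rewrite inE => Na; apply: val_inj => /=.
    by rewrite mulKn.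
  by rewrite mulnC divnK.
apply: eq_big => [a|a _]; first by rewrite dvdn_mulr.
rewrite ramE dvdn_mulr // mulKn // /rcomp; congr (_ * H _ _).
by have := ltn_ord a; rewrite ltnS; nia.
Qed.

Lemma rcomp_mon i l F : (i < N)%N -> (l < N)%N ->
  rcomp i (psC (psX ^+ l) * ram N F) = if i == l then F else 0.
Proof.
move=> iN lN; rewrite mulrC rcomp_ramM //; set c := rcomp _ _.
have -> : c = if i == l then 1 else 0.
  apply: psP => -[|j]; apply: psP => n; rewrite /c /rcomp /psC /=.
    rewrite psXn; case: n => [|n]; first by rewrite muln0 add0n; case: eqP.
    rewrite gtn_eqF; first by case: eqP.
    by apply: leq_trans lN _; rewrite mulnS -addnA leq_addr.
  by case: eqP.
by case: eqP; rewrite ?mulr1 ?mulr0.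
Qed.

Lemma rcomp_expand H : H = \sum_(i < N) psC (psX ^+ i) * ram N (rcomp i H).
Proof.
apply: psP => j; apply: psP => n.
rewrite !ps_sum; under eq_bigr do rewrite psCM psXnM ramE.
rewrite (bigD1 (Ordinal (ltn_pmod n N0))) //= big1 ?addr0 => [|i /eqP ni].
  rewrite ltnNge leq_mod /= {2}(divn_eq n N) addnK dvdn_mull // /rcomp.
  by rewrite {1}(divn_eq n N) {3}(divn_eq n N) addnK mulnK // mulnC.
case: ltnP => // le; case: ifP => // /dvdnP[q nq]; case: ni; apply: val_inj => /=.
by rewrite -(subnK le) nq modnMDl modn_small.
Qed.

Lemma idl_ram f g H : idl (ram N f) (ram N g) H <->
  forall i, (i < N)%N -> idl f g (rcomp i H).
Proof.
split=> [[u [v ->]] i iN|H1].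
  exists (rcomp i u), (rcomp i v); rewrite rcompD [u * _]mulrC [v * _]mulrC.
  by rewrite !rcomp_ramM // [rcomp i u * _]mulrC [rcomp i v * _]mulrC.
rewrite [H]rcomp_expand; apply: subsp_sum; first exact: idl_subsp.
move=> i; have [u [v ->]] := H1 i (ltn_ord i).
by exists (psC (psX ^+ i) * ram N u), (psC (psX ^+ i) * ram N v); rewrite rmorphD !rmorphM; ring.
Qed.

Lemma rcomp0_ram F i : (i < N)%N -> rcomp i (ram N F) = if i == 0%N then F else 0.
Proof. by move=> iN; rewrite -(rcomp_mon _ iN N0) expr0 rmorph1 mul1r. Qed.

Lemma ram_cst c : ram N (cst c) = cst c.
Proof. by rewrite /cst ramC compC. Qed.

(* The series in s are the free module of rank N over the series in s^N, which
   decomposes the ideal into N copies. *)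
Lemma qdim_ram f g M : qdim (idl (ram N f) (ram N g)) M ->
  exists2 d, qdim (idl f g) d & M = (N * d)%N.
Proof.
set J := idl f g; set JN := idl _ _ => qM.
have SJ : subsp J := idl_subsp _ _; have SJN : subsp JN := idl_subsp _ _.
have ramJ h : J h <-> JN (ram N h).
  rewrite /JN idl_ram; split=> [Jh i iN|/(_ 0%N N0)]; rewrite rcomp0_ram //.
  by case: eqP => // _; case: SJ.
suff [d Jd] : exists d, qdim J d.
  exists d => //; apply: (qdim_uniq SJN qM); have [b Hb] := Jd.
  pose b' (l : 'I_(N * d)) : R2 := \sum_(i < N) \sum_(j < d)
     (if mxvec_index i j == l then psC (psX ^+ i) * ram N (b j) else 0).
  have linE (c : 'M_(N, d)) : lin b' (mxvec c) = \sum_(i < N) psC (psX ^+ i) * ram N (lin b (row i c)).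
    rewrite /lin /b'; under eq_bigr => l _ do rewrite mulr_sumr.
    rewrite exchange_big; apply: eq_bigr => i _ /=.
    under eq_bigr => l _ do rewrite mulr_sumr.
    rewrite exchange_big rmorph_sum mulr_sumr; apply: eq_bigr => j _ /=.
    rewrite (bigD1 (mxvec_index i j)) //= eqxx big1 ?addr0 => [|l /negbTE li].
      by rewrite mxvecE rmorphM /= ram_cst mxE; ring.
    by rewrite eq_sym li mulr0.
  have rlin c i : rcomp i (lin b' (mxvec c)) = if insub i is Some i' then lin b (row i' c) else rcomp i (lin b' (mxvec c)).
    case: insubP => // i' iN <-; rewrite linE rcomp_sum (bigD1 i') //= big1 ?addr0.
      by rewrite rcomp_mon // eqxx.
    by move=> l li; rewrite rcomp_mon // [_ == _](negbTE _) // eq_sym.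
  exists b' => h; have /choice[c Hc] : forall i : 'I_N, exists c : 'rV[K]_d,
      J (rcomp i h - lin b c) /\ (forall c', J (rcomp i h - lin b c') -> c = c').
    by move=> i; have [c Hc] := Hb (rcomp i h); exists c.
  exists (mxvec (\matrix_i c i)); split.
    apply/idl_ram => i iN; rewrite rcompB rlin insubT /= rowK.
    by have [H _] := Hc (Ordinal iN).
  move=> c'; rewrite -[c']vec_mxK => /idl_ram H; congr mxvec; apply/row_matrixP => i.
  rewrite rowK; have [_] := Hc i; apply; have := H i (ltn_ord i).
  by rewrite rcompB rlin; case: insubP => [i' _ /val_inj ->|/negP[]].
(* Finiteness of the codimension of J: h -> [ram N h] embeds R/J in R/JN, whose coordinates [phi]
   are given. *)
have [b Hb] := qM.
have /choice[phi Hphi] : forall h, exists c, JN (h - lin b c) /\ forall c', JN (h - lin b c') -> c = c'.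
  by move=> h; have [c Hc] := Hb h; exists c.
apply: (@qdim_embed _ _ (fun h => phi (ram N h))) => //.
- move=> x y; have [_] := Hphi (ram N (x - y)); apply.
  have -> : ram N (x - y) - lin b (phi (ram N x) - phi (ram N y)) =
     (ram N x - lin b (phi (ram N x))) - (ram N y - lin b (phi (ram N y))).
    by rewrite linB rmorphB /=; ring.
  by case: SJN => _ JB _; apply: JB; [have [] := Hphi (ram N x)|have [] := Hphi (ram N y)].
- move=> c x; have [_] := Hphi (ram N (cst c * x)); apply.
  have -> : ram N (cst c * x) - lin b (c *: phi (ram N x)) = cst c * (ram N x - lin b (phi (ram N x))).
    rewrite rmorphM /= ram_cst mulrBr; congr (_ - _); rewrite /lin mulr_sumr.
    by apply: eq_bigr => i _; rewrite mxE rmorphM /= mulrA.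
  by case: SJN => _ _; apply; have [] := Hphi (ram N x).
- have lin0 : lin b 0 = 0 by rewrite -(subrr (0 : 'rV_M)) linB subrr.
  move=> x; rewrite ramJ; have [H1 H2] := Hphi (ram N x); split=> [H|E].
    by apply: H2; rewrite lin0 subr0.
  by move: H1; rewrite E lin0 subr0.
Qed.

End Ram.
End Codimension.

(** * Milnor number of a branch *)

(* [egcd_seq k Y i] is the gcd of k and of the exponents up to i of Y; the
   indices where it drops are the characteristic exponents. *)
Fixpoint egcd_seq (K : nzRingType) (k : nat) (Y : ps K) i : nat :=
  if i is i'.+1 then
    if Y i == 0 then egcd_seq k Y i' else gcdn (egcd_seq k Y i') i
  else k.

Section CountMultiples.

Lemma count_multiples q e : (0 < q)%N -> (\sum_(c < e * q) (q %| c) = e)%N.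
Proof.
move=> q0; elim: e => [|e IH]; first by rewrite mul0n big_ord0.
rewrite mulSnr big_split_ord /= IH; case: q q0 {IH} => // q _.
rewrite big_ord_recl /= addn0 dvdn_mull // big1 ?addn1 // => i _.
by rewrite /bump leq0n add1n dvdn_addr ?dvdn_mull // gtnNdvd ?ltnS.
Qed.

Lemma count_dvd_mul k e : (0 < k)%N -> (e %| k)%N ->
  (\sum_(c < k) (k %| c * e)%N = e)%N.
Proof.
move=> k0 /dvdnP[q kE]; have q0 : (0 < q)%N by move: k0; rewrite kE muln_gt0 => /andP[].
have e0 : (0 < e)%N by move: k0; rewrite kE muln_gt0 => /andP[].
rewrite -[RHS](count_multiples e q0) mulnC -kE; apply: eq_bigr => c _.
by rewrite {1}kE dvdn_pmul2r.
Qed.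

End CountMultiples.

Section EgcdSeq.
Variables (K : nzRingType) (k : nat) (Y : ps K).
Local Notation ee := (egcd_seq k Y).

Lemma egcd_seq_dvd i : (ee i %| k)%N.
Proof.
elim: i => //= i IH; case: eqP => // _.
by rewrite (dvdn_trans _ IH) // dvdn_gcdl.
Qed.

Lemma egcd_seqS_dvd i : (ee i.+1 %| ee i)%N.
Proof. by rewrite /=; case: eqP => // _; exact: dvdn_gcdl. Qed.

Lemma egcd_seq_mono i j : (i <= j)%N -> (ee j %| ee i)%N.
Proof.
move=> /subnKC <-; elim: (j - i)%N => [|n IH]; first by rewrite addn0.
by rewrite addnS; apply: dvdn_trans IH; exact: egcd_seqS_dvd.
Qed.

(** For a primitive k-th root of unity z, both sides say that s -> z^c s fixes the terms of Y up to
    degree i; the gcd merges the conditions on the single exponents. *)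
Lemma egcd_seq_dvdP c i : Y 0%N = 0 -> (k %| c * ee i)%N <->
  forall j, (j <= i)%N -> Y j <> 0 -> (k %| c * j)%N.
Proof.
move=> Y0; elim: i => [|i IH].
  by split=> [_ [|] //|_]; rewrite ?dvdn_mull.
split=> [H j|H].
  rewrite leq_eqVlt => /orP[/eqP->|]; last first.
    rewrite ltnS => ji Yj; apply: (IH.1 _) ji Yj.
    by apply: dvdn_trans H _; apply: dvdn_mul => //; exact: egcd_seqS_dvd.
  move=> Yi; apply: dvdn_trans H _; apply: dvdn_mul => //=.
  by case: eqP => // _; exact: dvdn_gcdr.
have Hi : (k %| c * ee i)%N by apply/IH => j ji; apply: H; exact: leqW.
rewrite /=; case: eqP => // Yi; rewrite muln_gcdr dvdn_gcd Hi.
exact: H.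
Qed.

Lemma egcd_seq_gt0 i : (0 < k)%N -> (0 < ee i)%N.
Proof. by move=> k0; exact: dvdn_gt0 k0 (egcd_seq_dvd i). Qed.

End EgcdSeq.

(** The order, with the value 0 for the zero series. *)
Definition ordps (K : nzRingType) (a : ps K) : nat :=
  if pselect (exists l, (forall i, (i < l)%N -> a i = 0) /\ a l <> 0) is left H
  then projT1 (cid H) else 0%N.

Arguments ordps {K} a%_ring_scope.

Section Ordps.
Variable K : fieldType.
Implicit Types a b : ps K.

Lemma ordpsP a : a <> 0 -> leading a (ordps a).
Proof.
move=> /leading_exists la; rewrite /ordps; case: pselect => // H.
exact: (projT2 (cid H)).
Qed.

Lemma ordps_eq a l : leading a l -> ordps a = l.
Proof. by move=> al; apply: leading_uniq (al); apply: ordpsP; exact: leading_neq0 al. Qed.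

Lemma ordpsM a b : a <> 0 -> b <> 0 -> ordps (a * b) = (ordps a + ordps b)%N.
Proof.
move=> a0 b0; apply: ordps_eq; apply: leadingM; [exact: field_dom|exact: ordpsP..].
Qed.

Lemma psKM_neq0 a b : a <> 0 -> b <> 0 -> a * b <> 0.
Proof. by move=> a0 b0 /psK_dom[]. Qed.

Lemma ordps_prod I (r : seq I) (P : pred I) (F : I -> ps K) : (forall i, P i -> F i <> 0) ->
  \prod_(i <- r | P i) F i <> 0 /\
  ordps (\prod_(i <- r | P i) F i) = (\sum_(i <- r | P i) ordps (F i))%N.
Proof.
move=> F0; elim/big_rec2: _ => [|i x y Pi [y0 yx]].
  split; first by apply/eqP; exact: oner_neq0.
  by apply: ordps_eq; split=> //; apply/eqP; rewrite ps1 oner_eq0.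
by split; [apply: psKM_neq0 => //; exact: F0|rewrite ordpsM ?yx //; exact: F0].
Qed.

Lemma ordps_unit a : a 0%N <> 0 -> ordps a = 0%N.
Proof. by move=> a0; exact: ordps_eq. Qed.

Lemma ordps_comp phi a k : leading phi k -> (0 < k)%N -> a <> 0 ->
  ordps (comp phi a) = (k * ordps a)%N /\ comp phi a <> 0.
Proof.
move=> pk k0 /ordpsP /(leading_comp pk k0) H.
by split; [exact: ordps_eq|exact: leading_neq0 H].
Qed.

Lemma ordpsN a : ordps (- a) = ordps a.
Proof.
have [->|a0] := EM (a = 0); first by rewrite oppr0.
have [H1 H2] := ordpsP a0; apply: ordps_eq; split=> [i /H1|].
  by rewrite psN => ->; rewrite oppr0.
by rewrite psN => /eqP; rewrite oppr_eq0 => /eqP.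
Qed.

End Ordps.

(** * The conjugates Y(z^c s) and the orders of their differences *)

Section Conjugates.
Variable K : fieldType.
Variables (k : nat) (z : K) (Y : ps K).
Hypotheses (k0 : (0 < k)%N) (zk : k.-primitive_root z) (Y0 : Y 0%N = 0).
Local Notation ee := (egcd_seq k Y).

Definition rot c : ps K -> ps K := comp (psC (z ^+ c) * psX).
HB.instance Definition _ c := GRing.RMorphism.on (rot c).

Lemma rotE c a n : rot c a n = z ^+ (c * n) * a n.
Proof. by rewrite /rot comp_scale exprM. Qed.

Lemma rot_rot c d a : rot c (rot d a) = rot (c + d) a.
Proof. by apply: psP => n; rewrite !rotE mulrA -exprD mulnDl. Qed.

Lemma rot_mod c d a : c = d %[mod k] -> rot c a = rot d a.
Proof.
move=> cd; apply: psP => n; rewrite !rotE; congr (_ * _).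
by rewrite -(prim_expr_mod zk) -modnMml cd modnMml prim_expr_mod.
Qed.

Lemma z_neq0 : z != 0.
Proof.
apply/eqP => z0'; have := prim_expr_order zk; rewrite z0' expr0n.
by case: (k) k0 => // n _ /esym/eqP; rewrite oner_eq0.
Qed.

Lemma rot_lead c : leading (psC (z ^+ c) * psX : ps K) 1.
Proof.
split=> [[|] //|]; first by rewrite psCM mulr0.
by rewrite psCM /psX eqxx mulr1; apply/eqP; rewrite expf_neq0 // z_neq0.
Qed.

Lemma diff_low c i : (forall j, (j <= i)%N -> (Y - rot c Y) j = 0) <-> (k %| c * ee i)%N.
Proof.
rewrite egcd_seq_dvdP //; split=> H j ji.
  move=> Yj; have := H j ji; rewrite psB rotE -{1}[Y j]mul1r -mulrBl => /eqP.
  rewrite mulf_eq0 (introF eqP Yj) orbF subr_eq0 (prim_order_dvd zk).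
  by rewrite eq_sym.
rewrite psB rotE; have [->|Yj] := EM (Y j = 0); first by rewrite mulr0 subrr.
by have := H j ji Yj; rewrite (prim_order_dvd zk) => /eqP ->; rewrite mul1r subrr.
Qed.

Variables (M : nat).
Hypothesis eM : ee M = 1%N.

Lemma diff_neq0 c : ~~ (k %| c)%N -> Y - rot c Y <> 0.
Proof.
move=> kc E; have : (k %| c * ee M)%N by apply/diff_low => j _; rewrite E.
by rewrite eM muln1 (negbTE kc).
Qed.

Lemma diff_ord_le c : ~~ (k %| c)%N -> (ordps (Y - rot c Y) <= M)%N.
Proof.
move=> kc; rewrite leqNgt; apply/negP => oM.
have [H _] := ordpsP (diff_neq0 kc).
have : (k %| c * ee M)%N by apply/diff_low => j jM; apply: H; exact: leq_ltn_trans oM.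
by rewrite eM muln1 (negbTE kc).
Qed.

Lemma ltn_diff_ord c i : ~~ (k %| c)%N -> (i < ordps (Y - rot c Y))%N = (k %| c * ee i)%N.
Proof.
move=> kc; have [H1 H2] := ordpsP (diff_neq0 kc).
apply/idP/idP => [io|/diff_low H]; first by apply/diff_low => j ji; apply: H1; exact: leq_ltn_trans io.
by rewrite ltnNge; apply/negP => /H.
Qed.

(** Double counting of the pairs (c, i) for which Y and Y(z^c s) agree up to degree i, that is, for
    which k divides c e_i. For fixed i there are e_i such c, and c = 0 is left out. *)
Lemma sum_diff_ord : (\sum_(c < k | c != 0 :> nat) ordps (Y - rot c Y) =
  \sum_(i < M) (ee i).-1)%N.
Proof.
have kc (c : 'I_k) : (c != 0 :> nat) -> ~~ (k %| c)%N.
  by move=> c0; rewrite gtnNdvd // lt0n.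
transitivity (\sum_(c < k | c != 0 :> nat) \sum_(i < M) (k %| c * ee i)%N)%N.
  apply: eq_bigr => c /kc c0.
  have -> : (\sum_(i < M) (k %| c * ee i)%N = \sum_(i < M) (i < ordps (Y - rot c Y)))%N.
    by apply: eq_bigr => i _; rewrite ltn_diff_ord.
  have := diff_ord_le c0; move: (ordps _) => o oM.
  by rewrite -big_mkcond /= -(big_ord_widen _ (fun=> 1%N)) // sum1_card card_ord.
rewrite exchange_big; apply: eq_bigr => i _.
have := count_dvd_mul k0 (egcd_seq_dvd k Y i).
rewrite (bigD1 (Ordinal k0)) //= mul0n dvdn0 add1n => H.
apply: succn_inj; rewrite prednK ?egcd_seq_gt0 // -[RHS]H; congr (_.+1).
Qed.

End Conjugates.

Lemma prim_root_exists (K : closedFieldType) k : (forall n, n.+1%:R != 0 :> K) ->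
  (0 < k)%N -> exists z : K, k.-primitive_root z.
Proof.
move=> char0 k0; have [r Er] := closed_field_poly_normal ('X^k - 1 : {poly K}).
have m1 : ('X^k - 1 : {poly K}) \is monic by rewrite monicXnsubC.
rewrite (monicP m1) scale1r in Er.
have ur : uniq r.
  rewrite -separable_prod_XsubC -Er separable_Xn_sub_1 //.
  by case: k k0 {m1 Er}.
have sr : size r = k.
  by apply: succn_inj; rewrite -(size_prod_XsubC r id) -Er size_XnsubC.
have /hasP[z _ zk] : has k.-primitive_root r.
  apply: has_prim_root => //; last by rewrite sr.
  apply/allP => x xr; rewrite /= unity_rootE.
  have : root ('X^k - 1) x by rewrite Er root_prod_XsubC.
  by rewrite /root !hornerE subr_eq0.
by exists z.
Qed.

(** The derivative in the inner variable; [psder] is the derivative in y. *)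
Definition idr (A : comNzRingType) (F : ps (ps A)) : ps (ps A) := fun j => psder (F j).

Lemma idr_ram (A : comNzRingType) N (F : ps (ps A)) :
  idr (ram N F) = psC (psder (psX ^+ N)) * ram N (idr F).
Proof.
apply: psP => j; rewrite psCM /idr /ram /map_ps /= der_comp mulrC.
by [].
Qed.

Lemma psder_ram (A : comNzRingType) N (F : ps (ps A)) :
  psder (ram N F) = ram N (psder F).
Proof. by rewrite /ram map_psder. Qed.

Lemma psder_mul_root (A : comNzRingType) (e : ps A) (F : ps (ps A)) : e 0%N = 0 ->
  evy e (psder ((psX - psC e) * F)) = evy e F.
Proof.
move=> e0; rewrite psderM psderB psderX psderC subr0 mul1r rmorphD rmorphM rmorphB /=.
by rewrite evyX evyC z0_id // subrr mul0r addr0.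
Qed.

Section LeadingDer.
Variable K : fieldType.
Hypothesis char0 : forall n, n.+1%:R != 0 :> K.

Lemma leading_der (a : ps K) o : leading a o.+1 -> leading (psder a) o.
Proof.
move=> [H1 H2]; split=> [i io|]; first by rewrite /psder H1 ?mul0rn.
rewrite /psder -mulr_natr => /eqP; rewrite mulf_eq0 (negbTE (char0 _)) orbF.
by move/eqP.
Qed.

Lemma distinct_roots (es : seq (ps K)) (H : ps (ps K)) : uniq es ->
  (forall e, e \in es -> e 0%N = 0 /\ evy e H = 0) ->
  exists U, H = U * \prod_(e <- es) (psX - psC e).
Proof.
elim: es H => [|e es IH] H; first by exists H; rewrite big_nil mulr1.
move=> /= /andP[ees ues] Hes; have [e0 He] := Hes e (mem_head _ _).
have [Q HQ] := evy_root He; rewrite z0_id // in HQ.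
have [|U QU] := IH Q ues.
  move=> a aes; have [a0 Ha] := Hes a (mem_behead (s := e :: es) aes); split=> //.
  move: Ha; rewrite HQ rmorphM rmorphB /= evyX evyC z0_id // => /psK_dom[] // /eqP.
  by rewrite subr_eq0 => /eqP ae; rewrite -ae aes in ees.
by exists U; rewrite big_cons HQ QU; ring.
Qed.

End LeadingDer.

(** * Equation and Milnor number of the branch x = s^k, y = Y(s) *)

Section Branch.
Variable K : closedFieldType.
Hypothesis char0 : forall n, n.+1%:R != 0 :> K.
Local Notation R2 := (ps (ps K)).
Variables (k : nat) (z : K) (Y : ps K) (M : nat).
Hypotheses (k0 : (0 < k)%N) (zk : k.-primitive_root z) (Y0 : Y 0%N = 0).
Local Notation ee := (egcd_seq k Y).
Hypothesis eM : ee M = 1%N.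
Local Notation rot := (rot z).

Definition pull (h : R2) : ps K := evy Y (ram k h).
Definition conj_prod : R2 := \prod_(c < k) (psX - psC (rot c Y)).
Definition vanishing_generator (f : R2) := forall h, pull h = 0 <-> exists u, h = u * f.

Lemma rot_ram c h : map_ps (rot c) (ram k h) = ram k h.
Proof.
apply: psP => j; apply: psP => n; rewrite -[LHS]/(rot c (ram k h j) n) rotE ramE //.
case: ifP => [/dvdnP[q ->]|_]; last by rewrite mulr0.
by rewrite mulnA [(_ * k)%N]mulnC exprM (prim_expr_order zk) expr1n mul1r.
Qed.

Lemma rot0 c (a : ps K) : a 0%N = 0 -> rot c a 0%N = 0.
Proof. by move=> a0; rewrite rotE a0 mulr0. Qed.

Lemma evy_rot c h : evy (rot c Y) (ram k h) = rot c (pull h).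
Proof.
have E := comp_evy (psC (z ^+ c) * psX) Y (ram k h); rewrite (z0_id Y0) in E.
apply: (etrans _ (esym E)); congr evy; exact: esym (rot_ram c h).
Qed.

(** Invariance under s -> z s leaves only exponents divisible by k. *)
Lemma descend H : map_ps (rot 1) H = H -> exists H0, ram k H0 = H.
Proof.
move=> HH; exists (rcomp k 0 H); apply: psP => j; apply: psP => n.
rewrite ramE // /rcomp; case: ifP => [kn|/negbT kn]; first by rewrite addn0 mulnC divnK.
have : rot 1 (H j) n = H j n := congr1 (fun F : R2 => F j n) HH.
rewrite rotE mul1n => E.
apply/eqP/contraT; rewrite eq_sym => Hn; case/negP: kn.
rewrite (prim_order_dvd zk); apply/eqP; apply: (mulIf Hn).
by rewrite mul1r.
Qed.

Lemma conj_prod_inv : map_ps (rot 1) conj_prod = conj_prod.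
Proof.
rewrite /conj_prod rmorph_prod [RHS](reindex_inj (@ordS_inj k)) /=; apply: eq_bigr => c _.
rewrite rmorphB /= map_psX map_psC /= rot_rot add1n; congr (_ - psC _).
by apply: (rot_mod zk); rewrite /= modn_mod.
Qed.

Lemma monic_prod_neq0 (F : R2) I (r : seq I) (g : I -> ps K) :
  F <> 0 -> F * \prod_(i <- r) (psX - psC (g i)) <> 0.
Proof.
move=> F0; elim: r => [|i r IH]; first by rewrite big_nil mulr1.
rewrite big_cons mulrCA => /psKK_dom[|//] /(congr1 (fun F : R2 => F 1%N)).
by rewrite psB /psX /psC /= subr0 => /eqP; rewrite oner_eq0.
Qed.

Lemma ram_inj N : (0 < N)%N -> injective (@ram K N).
Proof.
move=> N0 F G FG; apply: psP => j; apply: (@comp_inj K (psX ^+ N) N) => //.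
  by rewrite -[_ ^+ N]mulr1; apply: leading_Xn; apply/eqP; rewrite ps1 oner_eq0.
exact: (congr1 (fun F : R2 => F j) FG).
Qed.

Lemma rot_diff_neq0 (c d : 'I_k) : c != d -> rot c Y - rot d Y <> 0.
Proof.
wlog cd : c d / (c < d)%N.
  move=> W; case: (ltngtP c d) => [|dc cd|/val_inj ->]; first exact: W.
  - rewrite -opprB => /eqP; rewrite oppr_eq0 => /eqP; apply: W => //.
    by rewrite eq_sym.
  - by rewrite eqxx.
move=> _; have -> : rot d Y = rot c (rot (d - c) Y) by rewrite rot_rot subnKC // ltnW.
have kdc : ~~ (k %| d - c)%N.
  by rewrite gtnNdvd ?subn_gt0 // (leq_ltn_trans (leq_subr _ _)).
have [_] := ordps_comp (rot_lead k0 zk c) isT (diff_neq0 zk Y0 eM kdc).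
by rewrite rmorphB.
Qed.

(** The product over the conjugates is invariant under s -> z s and descends to F0(x, y). A germ
    that vanishes at Y vanishes at all conjugates, which are distinct, so it is divisible by the
    product; the quotient is invariant as well and descends. *)
Lemma branch_equation : exists2 F0 : R2, ram k F0 = conj_prod & vanishing_generator F0.
Proof.
have [F0 F0E] := descend conj_prod_inv; exists F0 => // h; split=> [h0|[u ->]]; last first.
  rewrite /pull rmorphM /= F0E /conj_prod (bigD1 (Ordinal k0)) //= !rmorphM rmorphB /=.
  have -> : rot 0 Y = Y by apply: psP => n; rewrite rotE mul1r.
  by rewrite evyX evyC z0_id // subrr mul0r mulr0.
have conjE : conj_prod = \prod_(e <- [seq rot (nat_of_ord c) Y | c <- enum 'I_k]) (psX - psC e).
  by rewrite big_map big_enum.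
have [|e|U HU] := @distinct_roots K [seq rot (nat_of_ord c) Y | c <- enum 'I_k] (ram k h).
- rewrite map_inj_uniq ?enum_uniq // => c d cd; apply/eqP; apply: contraT => /rot_diff_neq0.
  by rewrite cd subrr.
- by move=> /mapP[c _ ->]; rewrite rot0 // evy_rot h0 rmorph0.
rewrite -conjE in HU; have [U0 U0E] : exists U0, ram k U0 = U.
  apply: descend; have cn0 : conj_prod <> 0.
    have := @monic_prod_neq0 1 _ (enum 'I_k) (fun c => rot c Y); rewrite mul1r big_enum.
    by apply; apply/eqP; exact: oner_neq0.
  apply: (domI (@psKK_dom K) cn0); rewrite [RHS]mulrC -HU.
  by rewrite -{1}conj_prod_inv -rmorphM /= mulrC -HU rot_ram.
by exists U0; apply: (ram_inj k0); rewrite rmorphM /= F0E U0E.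
Qed.

Lemma generator_split f : vanishing_generator f -> exists2 U : R2, U 0%N 0%N <> 0 &
  ram k f = U * conj_prod.
Proof.
have [F0 F0E HF0] := branch_equation => Hf.
have [u fu] : exists u, f = u * F0 by apply/HF0/Hf; exists 1; rewrite mul1r.
have [v fv] : exists v, F0 = v * f by apply/Hf/HF0; exists 1; rewrite mul1r.
have F0n0 : F0 <> 0.
  move=> E; move: F0E; rewrite E raddf0 => /esym.
  have := @monic_prod_neq0 1 _ (enum 'I_k) (fun c => rot c Y); rewrite mul1r big_enum.
  by apply; apply/eqP; exact: oner_neq0.
have uv : u * v = 1.
  by apply: (domI (@psKK_dom K) F0n0); rewrite mulr1 [RHS]fv fu; ring.
exists (ram k u); last by rewrite fu rmorphM /= F0E.
rewrite /ram /map_ps /= comp0 => u0.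
have := congr1 (fun F : R2 => F 0%N 0%N) uv; rewrite !psM0 u0 mul0r => /esym/eqP.
by rewrite oner_eq0.
Qed.

Lemma leading_X : leading (psX : ps K) 1.
Proof. by split=> [[]|] //; apply/eqP; rewrite oner_neq0. Qed.

Lemma leading_XN N : leading (psX ^+ N : ps K) N.
Proof. by rewrite -[N in leading _ N]mul1n; apply: leadingX; exact: leading_X. Qed.

(** The difference of the conjugates c and c + d is a rotation of the difference of the conjugates 0
    and d, and rotations preserve orders. *)
Lemma conj_sum (c : 'I_k) : (\sum_(d < k | d != c) ordps (rot c Y - rot d Y) =
  \sum_(i < M) (ee i).-1)%N.
Proof.
rewrite -(sum_diff_ord k0 zk Y0 eM); case: k c k0 zk Y0 eM => // k' c k'0 z' Y0' eM'.
rewrite (reindex_inj (addrI c)); apply: eq_big => [d|d _].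
  by rewrite -{2}[c]addr0 (inj_eq (addrI c)) -val_eqE.
have -> : rot (c + d)%R Y = rot c (rot d Y).
  by rewrite rot_rot; apply: (rot_mod z'); rewrite /= modn_mod.
rewrite -rmorphB; have [->|Yd] := EM (Y - rot d Y = 0); first by rewrite raddf0.
by have [-> _] := ordps_comp (rot_lead k'0 z' c) isT Yd; rewrite mul1n.
Qed.

(* After s := s^N the derivative f_y splits into factors y - e, so that the
   dimension is the sum of the ord f_x(e) = ord f(e) - N.  The sum of the
   ord f(e) is the sum over the conjugates Y_c of Y of the ord f_y(Y_c). *)
Theorem milnor_qdim f : vanishing_generator f ->
  qdim (idl (psder f) (idr f)) (\sum_(i < M) (ee i).-1 - k.-1)%N.
Proof.
move=> /generator_split[U U0 fU]; set S := (\sum_(i < M) _)%N.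
have red_f : leading (red f) k.
  rewrite -(red_ram k) fU rmorphM rmorph_prod mulrC /=.
  rewrite (eq_bigr (fun=> psX)) => [|c _].
    by rewrite prodr_const card_ord; apply: leading_Xn.
  by rewrite rmorphB /= redX redC rot0 // rmorph0 subr0.
have f00 : f 0%N 0%N = 0 by case: red_f => /(_ 0%N k0).
have red_fy : leading (red (psder f)) k.-1.
  rewrite -(prednK k0) in red_f; have := leading_der char0 red_f.
  by rewrite /red -map_psder.
have [N0 [es [V [N00 ses es0 V0 fyV]]]] := puiseux_split char0 red_fy.
(* The derivative f_y splits after x := s^N0 and f after x := s^k, so both split after x := s^N. *)
pose N := (N0 * k)%N; have Npos : (0 < N)%N by rewrite muln_gt0 N00.
pose es' := [seq comp (psX ^+ k) e | e <- es].
have fyN : ram N (psder f) = ram k V * \prod_(e <- es') (psX - psC e).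
  rewrite /N -ram_ram // fyV rmorphM rmorph_prod big_map; congr (_ * _).
  by apply: eq_bigr => e _; rewrite rmorphB /= ramX ramC.
pose y (c : 'I_k) : ps K := comp (psX ^+ N0) (rot c Y).
have y0 c : y c 0%N = 0 by rewrite /y comp0 rot0.
have es'0 e : e \in es' -> e 0%N = 0.
  by move=> /mapP[a aes ->]; rewrite comp0 es0.
have fN : ram N f = ram N0 U * \prod_c (psX - psC (y c)).
  rewrite /N mulnC -ram_ram // fU rmorphM rmorph_prod; congr (_ * _).
  by apply: eq_bigr => c _; rewrite rmorphB /= ramX ramC.
have evU e (W : R2) P : W 0%N 0%N <> 0 -> evy e (ram P W) 0%N <> 0.
  by move=> W0; rewrite evy0 /ram /map_ps /= comp0.
have lin_ev (a b : ps K) : a 0%N = 0 -> evy a (psX - psC b) = a - b.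
  by move=> a0; rewrite rmorphB /= evyX evyC z0_id.
have fyk c : evy (rot c Y) (ram k (psder f)) <> 0 /\
    ordps (evy (rot c Y) (ram k (psder f))) = S.
  have [c' c'k cc'] : exists2 c' : 'I_k, True & rot c Y = rot c' Y.
    exists (Ordinal (ltn_pmod c k0)) => //; apply: (rot_mod zk).
    by rewrite /= modn_mod.
  rewrite {}cc' {c}; move: c' {c'k} => c.
  rewrite -psder_ram fU /conj_prod (bigD1 c) //= mulrCA psder_mul_root ?rot0 //.
  rewrite rmorphM rmorph_prod /=.
  have [H1 H2] : \prod_(d < k | d != c) evy (rot c Y) (psX - psC (rot d Y)) <> 0 /\
      ordps (\prod_(d < k | d != c) evy (rot c Y) (psX - psC (rot d Y))) = S.
    rewrite /S -(conj_sum c) (eq_bigr (fun d : 'I_k => rot c Y - rot d Y)); last first.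
      by move=> d _; rewrite lin_ev // rot0.
    by apply: ordps_prod => d dc; apply: rot_diff_neq0; rewrite eq_sym.
  have Uc : evy (rot c Y) U 0%N <> 0 by rewrite evy0.
  have Uc0 : evy (rot c Y) U <> 0 by move=> E; apply: Uc; rewrite E.
  by split; [exact: psKM_neq0|rewrite ordpsM // ordps_unit // H2].
have fyy c : evy (y c) (ram N (psder f)) <> 0 /\
    ordps (evy (y c) (ram N (psder f))) = (N0 * S)%N.
  have [H1 H2] := fyk c.
  have -> : evy (y c) (ram N (psder f)) = comp (psX ^+ N0) (evy (rot c Y) (ram k (psder f))).
    by rewrite comp_evy z0_id ?rot0 // -/(ram N0 _) ram_ram // mulnC.
  by have [-> ?] := ordps_comp (leading_XN N0) N00 H1; rewrite H2.
have ey e c : e \in es' -> e - y c <> 0.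
  move=> ees /eqP; rewrite subr_eq0 => /eqP ec; have [H _] := fyy c; apply: H.
  rewrite fyN (big_rem e) //= -ec rmorphM /= rmorphM /= lin_ev ?es'0 //.
  by rewrite subrr mul0r mulr0.
have fe e : e \in es' -> evy e (ram N f) <> 0 /\
    ordps (evy e (ram N f)) = (\sum_c ordps (e - y c))%N.
  move=> ees; rewrite fN rmorphM rmorph_prod /=.
  rewrite (eq_bigr (fun c => e - y c)) => [|c _]; last by rewrite lin_ev ?es'0.
  have [H1 H2] := @ordps_prod K _ (index_enum 'I_k) xpredT (fun c => e - y c) (fun c _ => @ey e c ees).
  have Ue := evU e U N0 U0; have Ue0 : evy e (ram N0 U) <> 0 by move=> E; apply: Ue; rewrite E.
  by split; [exact: psKM_neq0|rewrite ordpsM // ordps_unit].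
(* At a root e of f_y the chain rule reduces to d/ds f(e) = N s^(N-1) f_x(e), whence ord f(e) = N +
   ord f_x(e). *)
have fxN e : e \in es' -> exists2 o, leading (evy e (ram N (idr f))) o &
    (ordps (evy e (ram N f)) = N + o)%N.
  move=> ees; have [E0 _] := fe e ees; have lE := ordpsP E0.
  have E00 : evy e (ram N f) 0%N = 0 by rewrite evy0 /ram /map_ps /= comp0.
  have [o oE] : exists o, ordps (evy e (ram N f)) = o.+1.
    by case: (ordps _) lE => [[]|o] //; exists o.
  rewrite oE in lE *; have := leading_der char0 lE.
  have fy0 : evy e (ram N (psder f)) = 0.
    rewrite fyN (big_rem e) //= rmorphM /= rmorphM /= lin_ev ?es'0 //.
    by rewrite subrr mul0r mulr0.
  rewrite der_evy -/(idr _) psder_ram fy0 mul0r addr0 idr_ram rmorphM /= evyC => lo.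
  have lX : leading (psder (psX ^+ N) : ps K) N.-1.
    by apply: (leading_der char0); rewrite prednK //; exact: leading_XN.
  have n0 : evy e (ram N (idr f)) <> 0.
    by move=> E; move/leading_neq0: lo; rewrite E mulr0.
  have := leading_uniq lo (leadingM (field_dom (K := K)) lX (ordpsP n0)).
  move=> oE'; exists (ordps (evy e (ram N (idr f)))); first exact: ordpsP.
  by rewrite oE' -addSn prednK.
have feN e : e \in es' -> (N <= ordps (evy e (ram N f)))%N.
  by move=> /fxN[o _ ->]; exact: leq_addr.
have fx e : e \in es' -> leading (evy e (ram N (idr f))) (ordps (evy e (ram N f)) - N).
  by move=> /fxN[o lo ->]; rewrite addKn.
have kV : ram k V 0%N 0%N <> 0 by rewrite /ram /map_ps /= comp0.
have := @qdim_split K (ram k V) es' (fun e => (ordps (evy e (ram N f)) - N)%N)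
   (ram N (idr f)) kV (fun e ees => conj (es'0 e ees) (fx e ees)).
rewrite -fyN => /(qdim_ram Npos)[d qd dE].
suff -> : (S - k.-1)%N = d by [].
(* The orders of all differences e - y_c are summed in two ways: over c they give ord f(e), over e
   they give ord f_y(y_c) = N0 S. *)
have total : (\sum_(e <- es') ordps (evy e (ram N f)) = N * S)%N.
  transitivity (\sum_(e <- es') \sum_c ordps (e - y c))%N.
    by rewrite big_seq [RHS]big_seq; apply: eq_bigr => e /fe[].
  rewrite exchange_big /=.
  rewrite (eq_bigr (fun=> (N0 * S)%N)) => [|c _].
    by rewrite sum_nat_const card_ord /N; lia.
  have [_ <-] := fyy c; rewrite fyN rmorphM rmorph_prod /=.
  have pE e : e \in es' -> evy (y c) (psX - psC e) <> 0.
    move=> ees; rewrite lin_ev // => E; apply: (ey e c ees).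
    by apply/eqP; rewrite -oppr_eq0 opprB E.
  rewrite big_seq [X in _ = ordps (_ * X)]big_seq.
  have [H1 H2] := ordps_prod es' pE.
  have Ue := evU (y c) V k V0; have Ue0 : evy (y c) (ram k V) <> 0 by move=> E; apply: Ue; rewrite E.
  rewrite ordpsM // H2 ordps_unit // add0n; apply: eq_bigr => e _.
  by rewrite lin_ev // -opprB ordpsN.
have : (\sum_(e <- es') (ordps (evy e (ram N f)) - N) + N * k.-1 = N * S)%N.
  have -> : (N * k.-1 = \sum_(e <- es') N)%N.
    by rewrite big_const_seq count_predT iter_addn_0 size_map ses.
  rewrite -total -big_split big_seq [RHS]big_seq; apply: eq_bigr => e ees /=.
  by rewrite subnK // feN.
rewrite dE -mulnDr => /eqP; rewrite eqn_pmul2l // => /eqP <-.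
by rewrite addnK.
Qed.

End Branch.

(** * Arcs written as x = phi^k, y = Y(phi), and their Milnor numbers *)

Section Bridge.
Variable K : closedFieldType.
Local Notation R2 := (ps (ps K)).

Lemma smulE (a b : ps K) : smul a b = a * b.
Proof. by apply: psP => n; rewrite psM. Qed.

Lemma spowE (a : ps K) j : spow a j = a ^+ j.
Proof.
elim: j => [|j IH]; first by rewrite expr0; apply: psP => n; rewrite ps1.
by rewrite exprS -IH -smulE.
Qed.

Lemma scompE (a phi : ps K) : phi 0%N = 0 -> scomp a phi = comp phi a.
Proof.
move=> p0; apply: psP => n; rewrite compE z0_id //.
by apply: eq_bigr => i _; rewrite spowE.
Qed.

Lemma smul2E (u f : R2) : transp (smul2 u f) = transp u * transp f.
Proof.
apply: psP => j; apply: psP => i; rewrite psM ps_sum /transp /smul2 exchange_big.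
by apply: eq_bigr => q _; rewrite psM.
Qed.

Lemma transpK (f : R2) : transp (transp f) = f. Proof. by []. Qed.

Lemma pullbackE (g : arc K) (f : R2) :
  pullback g f = evy (arcy g) (map_ps (comp (arcx g)) (transp f)).
Proof.
apply: psP => n; rewrite evyE /pullback exchange_big; apply: eq_bigr => j _ /=.
rewrite psM z0_id; last exact: arcy0.
under [RHS]eq_bigr => l _.
  rewrite /map_ps /comp /= (evy_ext _ _ (M := n)); last by rewrite -ltnS.
  rewrite mulr_suml; over.
rewrite exchange_big; apply: eq_bigr => i _ /=.
rewrite smulE !spowE psM mulr_sumr; apply: eq_bigr => l _.
by rewrite psCM z0_id ?mulrA //; exact: arcx0.
Qed.

Section Normalized.
Hypothesis char0 : forall n, n.+1%:R != 0 :> K.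
Variables (g : arc K) (k : nat) (phi Y : ps K).
Hypotheses (k0 : (0 < k)%N) (lphi : leading phi 1).
Hypotheses (xE : arcx g = phi ^+ k) (yE : arcy g = comp phi Y).

Lemma phi0 : phi 0%N = 0. Proof. by rewrite (leading0 lphi). Qed.

Lemma Y0 : Y 0%N = 0.
Proof. by rewrite -(comp0 phi) -yE; exact: arcy0. Qed.

Lemma comp_ram N (F : R2) : (0 < N)%N ->
  map_ps (comp phi) (ram N F) = map_ps (comp (phi ^+ N)) F.
Proof.
move=> N0; apply: psP => j; rewrite /ram /map_ps /= comp_comp; congr (comp _ _).
rewrite z0_id ?rmorphXn /= ?compX ?z0_id ?phi0 //.
by rewrite psXn; case: N N0.
Qed.

Lemma pullback_pull (f : R2) : pullback g f = comp phi (pull k Y (transp f)).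
Proof. by rewrite pullbackE /pull comp_evy z0_id ?Y0 // comp_ram // -xE -yE. Qed.

Lemma reduced_equationP (f : R2) : reduced_equation g f <-> vanishing_generator k Y (transp f).
Proof.
have pb0 (h : R2) : (forall n, pullback g h n = 0) <-> pull k Y (transp h) = 0.
  rewrite pullback_pull; split=> [H|->]; last by move=> n; rewrite raddf0.
  by apply: (comp_inj lphi) => //; rewrite raddf0; apply: psP.
have eqP (h : R2) : (exists u, h = smul2 u f) <-> (exists u, transp h = u * transp f).
  split=> [[u ->]|[u H]]; first by exists (transp u); rewrite smul2E.
  exists (transp u); rewrite -[LHS]transpK H -[u in LHS]transpK -smul2E.
  by rewrite transpK.
by split=> H h; [rewrite -[h]transpK -pb0 -eqP|rewrite pb0 eqP].
Qed.

Lemma jacobianP (f h : R2) : jacobian_ideal f h <->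
  idl (psder (transp f)) (idr (transp f)) (transp h).
Proof.
have dxE : transp (dx f) = idr (transp f) by [].
have dyE : transp (dy f) = psder (transp f).
  by apply: psP => j; apply: psP => i; rewrite /psder psMn.
rewrite -dxE -dyE; split=> [[u [v H]]|[u [v H]]].
  exists (transp v), (transp u); rewrite -!smul2E; apply: psP => j; apply: psP => i.
  by rewrite !psD addrC /transp H.
exists (transp v), (transp u) => i j.
have := congr1 (fun F : R2 => F j i) H; rewrite !psD.
by rewrite -[u]transpK -[v]transpK -!smul2E addrC.
Qed.

Lemma quotient_dimP (f : R2) n : quotient_dim (jacobian_ideal f) n <->
  qdim (idl (psder (transp f)) (idr (transp f))) n.
Proof.
have E (b : 'I_n -> R2) (h : R2) (c : 'rV[K]_n) :
    transp (fun i j => h i j - \sum_(l < n) c 0 l * b l i j) =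
    transp h - lin (fun l => transp (b l)) c.
  apply: psP => j; apply: psP => i; rewrite !psB /transp; congr (_ - _).
  by rewrite /lin !ps_sum; apply: eq_bigr => l _; rewrite cstE.
split=> [[b Hb]|[b Hb]].
  exists (fun l => transp (b l)) => h; have [c [Hc uc]] := Hb (transp h).
  exists c; split=> [|c' Hc']; first by move/jacobianP: Hc; rewrite E.
  by apply: uc; apply/jacobianP; rewrite E.
exists (fun l => transp (b l)) => h; have [c [Hc uc]] := Hb (transp h).
exists c; split=> [|c' /jacobianP Hc']; first by apply/jacobianP; rewrite E.
by apply: uc; rewrite E in Hc'.
Qed.

Lemma has_milnorP M n : egcd_seq k Y M = 1%N ->
  has_milnor g n <-> n = (\sum_(i < M) (egcd_seq k Y i).-1 - k.-1)%N.
Proof.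
move=> eM; have [z zk] := prim_root_exists char0 k0.
split=> [[f /reduced_equationP Hf /quotient_dimP qn]|->].
  apply: (qdim_uniq _ qn (milnor_qdim char0 k0 zk Y0 eM Hf)); exact: idl_subsp.
have [F0 _ HF0] := branch_equation k0 zk Y0 eM.
exists (transp F0); first exact/reduced_equationP.
by apply/quotient_dimP; apply: (milnor_qdim char0 k0 zk Y0 eM).
Qed.

(** The least value d of the decreasing gcds is attained, and an exponent of Y not divisible by d
    would lower it further. *)
Lemma egcd_seq_stable : (forall M, egcd_seq k Y M <> 1%N) ->
  exists2 d, (1 < d)%N & (d %| k)%N /\ forall i, ~~ (d %| i)%N -> Y i = 0.
Proof.
move=> H; pose P e := `[< exists M, egcd_seq k Y M = e >].
have exP : exists e, P e by exists k; apply/asboolP; exists 0%N.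
case: (ex_minnP exP) => e /asboolP[M eM] emin.
have e0 : (0 < e)%N by rewrite -eM egcd_seq_gt0.
exists e; first by rewrite ltn_neqAle e0 andbT eq_sym; apply/eqP => e1; apply: (H M); rewrite eM.
split; first by rewrite -eM egcd_seq_dvd.
move=> i ei; apply/eqP; apply: contraNT ei => Yi.
pose j := maxn i M; have ej : egcd_seq k Y j = e.
  apply/eqP; rewrite eqn_leq (emin _ (_ : P _)) ?andbT; last by apply/asboolP; exists j.
  by rewrite dvdn_leq // -eM egcd_seq_mono // leq_maxr.
rewrite -ej; case: i Yi @j ej => [|i] Yi j ej; first by rewrite dvdn0.
apply: dvdn_trans (egcd_seq_mono k Y (leq_maxl i.+1 M)) _.
by rewrite /= (negbTE Yi) dvdn_gcdr.
Qed.

(** If the gcds stop at d > 1, both coordinates are series in phi^d, a substitution of order d >=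
    2. *)
Lemma primitive_egcd : primitive g -> exists M, egcd_seq k Y M = 1%N.
Proof.
move=> pg; apply: contrapT => /forallNP H; case: pg.
have [d d1 [dk dY]] := egcd_seq_stable H.
have d0 : (0 < d)%N by exact: ltnW.
pose X : ps K := psX ^+ (k %/ d); pose Z : ps K := fun n => Y (d * n)%N.
have X0 : X 0%N = 0.
  by rewrite /X psXn ltn_eqF // divn_gt0 // dvdn_leq.
have Z0 : Z 0%N = 0 by rewrite /Z muln0 Y0.
exists (Arc X0 Z0), (phi ^+ d); split=> /=.
- by rewrite psX0 phi0 expr0n gtn_eqF.
- by apply: powlow => //; exact: phi0.
- rewrite scompE ?psX0 ?phi0 ?expr0n ?gtn_eqF // /X rmorphXn /= compX z0_id.
    by rewrite -exprM mulnC divnK.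
  by rewrite psX0 phi0 expr0n gtn_eqF.
- rewrite scompE ?psX0 ?phi0 ?expr0n ?gtn_eqF // yE.
  have -> : Y = comp (psX ^+ d) Z.
    apply: psP => n; rewrite comp_Xn // /Z; case: ifPn => [dn|/dY//].
    by rewrite mulnC divnK.
  rewrite comp_comp z0_id ?psXn ?ltn_eqF // rmorphXn /= compX z0_id //; exact: phi0.
Qed.

(** The quotient q of a and b satisfies q^n = 1, so q' = 0 and q is constant in characteristic 0. *)
Lemma root_of_power (a b : ps K) n l : (0 < n)%N -> leading a l -> leading b l ->
  a ^+ n = b ^+ n -> exists2 w : K, w ^+ n = 1 & a = psC w * b.
Proof.
move=> n0 la lb; have [u -> u0] := leading_fact la; have [v -> v0] := leading_fact lb.
have [v' vv] := psK_inv v0 => E; pose q := u * v'.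
have uq : u = q * v by rewrite /q -mulrA [v' * v]mulrC vv mulr1.
have qn : q ^+ n = 1.
  have vn : v ^+ n <> 0.
    by move=> /(congr1 (fun c : ps K => c 0%N)) /eqP; rewrite psX0 expf_eq0 n0 => /eqP.
  apply: (domI (@psK_dom K) vn); rewrite mulr1 -exprMn mulrC -uq.
  by apply: (@psXnK _ (l * n)); rewrite !exprM -!exprMn.
have dq : psder q = 0.
  have := congr1 (@psder K) qn; rewrite psder1 -(prednK n0) psderXn prednK //.
  rewrite -mulr_natr => /psK_dom[/psK_dom[q0|//]|].
    move: qn; rewrite -(prednK n0) exprSr q0 mul0r => /(congr1 (fun c : ps K => c 0%N)) /eqP.
    by rewrite ps1 eq_sym oner_eq0.
  rewrite -(rmorph_nat (@psC K)) => /(congr1 (fun c : ps K => c 0%N)) /eqP.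
  by rewrite /psC /= -(prednK n0) (negbTE (char0 _)).
have qC : q = psC (q 0%N).
  apply: psP => -[|i] //=; have := congr1 (fun c : ps K => c i) dq.
  by rewrite /psder -mulr_natr => /eqP; rewrite mulf_eq0 (negbTE (char0 i)) orbF => /eqP.
exists (q 0%N); last by rewrite {1}uq qC; ring.
by rewrite -psX0 qn ps1.
Qed.

Lemma series_root (a : ps K) n l : (0 < n)%N -> leading a (l * n) ->
  exists2 b : ps K, b ^+ n = a & leading b l.
Proof.
move=> n0 /leading_fact[u -> u0].
have [b0 b0n] : exists b0, b0 ^+ n = u 0%N.
  have /closed_rootP[b0] : size ('X^n - (u 0%N)%:P) != 1%N by rewrite size_XnsubC // eqSS -lt0n.
  by rewrite /root !hornerE subr_eq0 => /eqP; exists b0.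
have [b [bn b00 _]] := ps_root char0 n0 (introN eqP u0) b0n.
exists (psX ^+ l * b); first by rewrite exprMn -exprM bn.
by apply: leading_Xn => E; apply: u0; rewrite -b0n -b00 E expr0n gtn_eqF.
Qed.

(** If g factors through a substitution psi of order p > 1, then in terms of phi, up to a root of
    unity w, the series Y contains only exponents divisible by p. As p also divides k, it divides
    every gcd, including the final value 1. *)
Lemma egcd_primitive M : egcd_seq k Y M = 1%N -> primitive g.
Proof.
move=> eM [d [psi [p0 p1 xd yd]]].
rewrite scompE // in xd; rewrite scompE // in yd.
have lx : leading (arcx g) k by rewrite xE -[X in leading _ X]mul1n; exact: leadingX.
have X0 : arcx d <> 0 by move=> E; move/leading_neq0: lx; rewrite xd E raddf0.
have psi0 : psi <> 0.
  move=> E; have := lx; rewrite xd => -[_]; case: (k) k0 => // k' _; apply.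
  rewrite compE big1 // => i _; rewrite E.
  have -> : z0 (0 : ps K) = 0 by rewrite z0_id.
  case: i => -[|i] /= _; last by rewrite exprS mul0r mulr0.
  by rewrite arcx0 mul0r.
have [p lp] := leading_exists psi0; have [l lX] := leading_exists X0.
have pgt1 : (1 < p)%N by case: p lp => [|[|]] // [_] //; rewrite ?p0 ?p1.
have ppos : (0 < p)%N by exact: ltnW.
have kpl : k = (p * l)%N by apply: (leading_uniq lx); rewrite xd; exact: leading_comp.
have l0 : (0 < l)%N by move: k0; rewrite kpl muln_gt0 => /andP[].
have [rho rhoE lrho] := @series_root psi p 1 ppos ltac:(by rewrite mul1n).
have [th thE lth] := @series_root (arcx d) l 1 l0 ltac:(by rewrite mul1n).
have th0 : th 0%N = 0 by rewrite (leading0 lth).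
have rho0 : rho 0%N = 0 by rewrite (leading0 lrho).
(* With psi = rho^p and x = th^l on the arc [d], the series kap with kap^p = th(s^p) satisfies
   kap(rho)^k = x on g. Hence kap(rho) and phi differ by a k-th root of unity. *)
have [kap kapE lkap] := @series_root (comp (psX ^+ p) th) p 1 ppos
  ltac:(by rewrite mul1n -[X in leading _ X]muln1; apply: leading_comp => //; rewrite -[X in leading _ X]mul1n; apply: leadingX; exact: leading_X).
have kap0 : kap 0%N = 0 by rewrite (leading0 lkap).
have zp : z0 (psX ^+ p : ps K) = psX ^+ p by rewrite z0_id // psXn ltn_eqF.
have compp (a : ps K) : comp psi a = comp rho (comp (psX ^+ p) a).
  by rewrite comp_comp zp rmorphXn /= compX z0_id // rhoE.
have xk : comp rho kap ^+ k = phi ^+ k.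
  by rewrite -xE xd -thE compp !rmorphXn /= -kapE !rmorphXn /= -exprM -kpl.
have lrk : leading (comp rho kap) 1 by rewrite -[1%N]muln1; exact: leading_comp.
have [w wk wE] := root_of_power k0 lrk lphi xk.
have w0 : w != 0 by apply: contraTneq isT => w0; move: wk; rewrite w0 expr0n gtn_eqF // => /esym/eqP; rewrite oner_eq0.
have [y2 y2E] := comp_surj (arcy d) lth.
pose y3 := comp (psX ^+ p) y2.
have y3E : comp (comp rho kap) y3 = arcy g.
  rewrite yd compp -y2E.
  have -> : comp (psX ^+ p) (comp th y2) = comp (kap ^+ p) y2 by rewrite comp_comp (z0_id th0) kapE.
  have -> : comp (kap ^+ p) y2 = comp kap y3.
    by rewrite /y3 comp_comp zp rmorphXn /= compX z0_id.
  by rewrite comp_comp z0_id.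
have YE : Y = comp (psC w * psX) y3.
  apply: (comp_inj lphi) => //; rewrite -yE -y3E wE.
  rewrite [RHS](comp_comp phi (psC w * psX)) z0_id ?psCM ?mulr0 //.
  by rewrite rmorphM /= compC compX z0_id // phi0.
have pY i : Y i <> 0 -> (p %| i)%N.
  rewrite YE comp_scale /y3 comp_Xn //; case: ifP => // _.
  by rewrite mulr0.
have pe i : (p %| egcd_seq k Y i)%N.
  elim: i => [|i IH] /=; first by rewrite kpl dvdn_mulr.
  by case: eqP => // Yi; rewrite dvdn_gcd IH pY.
by have := pe M; rewrite eM dvdn1 gtn_eqF.
Qed.

Lemma milnorP n : milnor g = Some n <->
  exists2 M, egcd_seq k Y M = 1%N & n = (\sum_(i < M) (egcd_seq k Y i).-1 - k.-1)%N.
Proof.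
rewrite /milnor; case: pselect => [H|H]; last first.
  split=> // -[M eM nE]; case: H; split; first exact: egcd_primitive eM.
  by exists n; apply/(has_milnorP _ eM).
have [M eM] := primitive_egcd H.1.
have /(has_milnorP _ eM) := projT2 (cid H.2); move: (projT1 _) => q qE.
split=> [[<-]|[M' eM' ->]]; first by exists M.
congr Some; rewrite qE.
have st N : (forall i, (N <= i)%N -> egcd_seq k Y i = 1%N) -> forall N', (N <= N')%N ->
   (\sum_(i < N') (egcd_seq k Y i).-1 = \sum_(i < N) (egcd_seq k Y i).-1)%N.
  move=> HN N' NN'; rewrite -!(big_mkord xpredT (fun i => (egcd_seq k Y i).-1)).
  rewrite (big_cat_nat (leq0n _) NN') /=.
  have -> : (\sum_(N <= i < N') (egcd_seq k Y i).-1 = 0)%N.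
    by rewrite big_nat big1 // => i /andP[/HN ->].
  by rewrite addn0.
have one N : egcd_seq k Y N = 1%N -> forall i, (N <= i)%N -> egcd_seq k Y i = 1%N.
  by move=> eN i Ni; have := egcd_seq_mono k Y Ni; rewrite eN dvdn1 => /eqP.
by case: (leqP M M') => [|/ltnW] MM; rewrite (st _ (one _ _) _ MM).
Qed.

End Normalized.
Lemma egcd_seq_eq k (Y Y' : ps K) N : (forall i, (i <= N)%N -> (Y i == 0) = (Y' i == 0)) ->
  forall i, (i <= N)%N -> egcd_seq k Y i = egcd_seq k Y' i.
Proof.
move=> YY; elim=> //= i IH iN; rewrite IH ?(ltnW iN) //.
by have := YY _ iN => /= ->.
Qed.

(** The criterion is uniform: the sum stops at any N > n, whatever the arc, and x = c tau^k avoids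
    choosing a k-th root of the leading coefficient. Rescaling tau by such a root does not change
    the support of Y. The shifted index absorbs the term k - 1 subtracted in [milnorP]. *)
Lemma milnor_level (char0 : forall n, n.+1%:R != 0 :> K) (g : arc K) k (c : K)
    (tau Y : ps K) n N : (0 < k)%N -> c != 0 -> leading tau 1 ->
  arcx g = psC c * tau ^+ k -> arcy g = comp tau Y -> (n < N)%N ->
  milnor g = Some n <-> (\sum_(i < N) (egcd_seq k Y i.+1).-1)%N = n.
Proof.
move=> k0 c0 lt xE yE nN.
have [w wk] : exists w, w ^+ k = c.
  have /closed_rootP[w] : size ('X^k - c%:P) != 1%N by rewrite size_XnsubC // eqSS -lt0n.
  by rewrite /root !hornerE subr_eq0 => /eqP; exists w.
have w0 : w != 0 by apply: contraNneq c0 => w0; rewrite -wk w0 expr0n gtn_eqF.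
have t0 : tau 0%N = 0 by rewrite (leading0 lt).
have lphi : leading (psC w * tau) 1.
  split=> [[|] //|]; first by rewrite psCM t0 mulr0.
  by rewrite psCM => /eqP; rewrite mulf_eq0 (negbTE w0) /=; case: lt => _ H /eqP.
pose Y' : ps K := comp (psC w^-1 * psX) Y.
have xE' : arcx g = (psC w * tau) ^+ k by rewrite exprMn -rmorphXn wk.
have yE' : arcy g = comp (psC w * tau) Y'.
  rewrite /Y' comp_comp z0_id ?psCM ?mulr0 // rmorphM /= compC compX z0_id; last first.
    by rewrite psCM t0 mulr0.
  by rewrite mulrA -rmorphM /= mulVf // rmorph1 mul1r.
have eY i : egcd_seq k Y' i = egcd_seq k Y i.
  apply: (@egcd_seq_eq _ _ _ i) => // j _; rewrite /Y' comp_scale mulf_eq0.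
  by rewrite expf_eq0 invr_eq0 (negbTE w0) andbF.
rewrite (milnorP char0 k0 lphi xE' yE').
have mE M : (\sum_(i < M.+1) (egcd_seq k Y' i).-1 - k.-1)%N = (\sum_(i < M) (egcd_seq k Y i.+1).-1)%N.
  by rewrite big_ord_recl [egcd_seq k Y' _](_ : _ = k) // addKn; apply: eq_bigr => i _; rewrite eY.
pose mu P := (\sum_(i < P) (egcd_seq k Y i.+1).-1)%N.
have muS P : mu P.+1 = (mu P + (egcd_seq k Y P.+1).-1)%N by rewrite /mu big_ord_recr.
have one P Q : egcd_seq k Y P = 1%N -> (P <= Q)%N -> egcd_seq k Y Q = 1%N.
  by move=> eP PQ; have := egcd_seq_mono k Y PQ; rewrite eP dvdn1 => /eqP.
have mu_st P Q : egcd_seq k Y P = 1%N -> (P <= Q)%N -> mu Q = mu P.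
  move=> eP /subnKC <-; elim: (Q - P)%N => [|d IH]; first by rewrite addn0.
  by rewrite addnS muS IH (one P) // ?addn0 // -addnS leq_addr.
have mu_mono P Q : (P <= Q)%N -> (mu P <= mu Q)%N.
  move=> /subnKC <-; elim: (Q - P)%N => [|d IH]; first by rewrite addn0.
  by rewrite addnS muS (leq_trans IH) // leq_addr.
(* As long as the gcd exceeds 1 each index adds at least 1, so a sum smaller than its number of
   terms forces the gcd to have reached 1. *)
have big P : egcd_seq k Y P <> 1%N -> (P <= mu P)%N.
  elim: P => // P IH eP; rewrite muS -[X in (X <= _)%N]addn1.
  apply: leq_add; first by apply: IH => eP'; apply: eP; exact: (one P P.+1 eP' (leqnSn P)).
  by have := egcd_seq_gt0 Y P.+1 k0; case: (egcd_seq k Y P.+1) eP => [|[|]].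
have MM M : egcd_seq k Y M = 1%N ->
    (\sum_(i < M) (egcd_seq k Y' i).-1 - k.-1)%N = mu M.
  by move=> eM; rewrite -[RHS]mE big_ord_recr /= eY eM addn0.
have eN n' : mu N = n' -> (n' <= n)%N -> egcd_seq k Y N = 1%N.
  move=> <- muN; apply: contrapT => /big; lia.
split=> [[M + nE]|muN]; rewrite ?eY.
  move=> eM; rewrite (MM _ eM) in nE; rewrite nE.
  case: (leqP M N) => [|/ltnW NM]; first exact: mu_st.
  by symmetry; apply: (mu_st _ _ _ NM); apply: (eN (mu N)) => //; rewrite nE mu_mono.
have eN1 := eN n muN (leqnn n).
by exists N; rewrite ?eY ?MM.
Qed.

End Bridge.

(** * The substitution of inverses in rational functions *)

Section InverseSubstitution.

Local Notation P2 := {poly {poly int}}.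
Local Notation ratfun := {fraction P2}.
Local Notation t := tvar.
Local Notation L := Lvar.

Lemma tvar_neq0 : t != 0.
Proof. by rewrite tofrac_eq0 polyX_eq0. Qed.

Lemma Lvar_neq0 : L != 0.
Proof. by rewrite tofrac_eq0 polyC_eq0 polyX_eq0. Qed.

Lemma frac_repr (A : idomainType) (R : {fraction A}) : R * tofrac \d_(repr R) = tofrac \n_(repr R).
Proof.
move: (repr R) (reprK R) => x <-; unlock tofrac; rewrite -[LHS]FracField.pi_mul.
apply/eqmodP; rewrite /= FracField.equivfE /FracField.mulf /=.
by rewrite !numden_Ratio ?oner_neq0 ?mulr1 ?mulf_neq0 ?denom_ratioP // mulrC.
Qed.

Definition inv_coef : {poly int} -> ratfun :=
  horner_morph (fun a => mulrC L^-1 (intr a)).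
HB.instance Definition _ := GRing.RMorphism.on inv_coef.
Definition inv_poly : P2 -> ratfun :=
  horner_morph (fun a : {poly int} => mulrC t^-1 (inv_coef a)).
HB.instance Definition _ := GRing.RMorphism.on inv_poly.

Lemma eval2_inv (p : P2) : eval2 p t^-1 L^-1 = inv_poly p.
Proof. by []. Qed.

Lemma inv_polyX : inv_poly 'X = t^-1.
Proof. by rewrite /inv_poly horner_morphX. Qed.

Lemma inv_polyC c : inv_poly c%:P = inv_coef c.
Proof. by rewrite /inv_poly horner_morphC. Qed.

Lemma inv_coefX : inv_coef 'X = L^-1.
Proof. by rewrite /inv_coef horner_morphX. Qed.

Lemma expVn_mul (F : fieldType) (x : F) j M : x != 0 -> (j <= M)%N ->
  x^-1 ^+ j * x ^+ M = x ^+ (M - j).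
Proof.
move=> x0 /subnK {1}<-; rewrite exprD mulrCA -exprMn mulVf //.
by rewrite expr1n mulr1.
Qed.

Lemma inv_coefE (c : {poly int}) M : (size c <= M)%N ->
  inv_coef c * L ^+ M = tofrac (\sum_(j < M) (c`_j *: 'X^(M - j))%:P).
Proof.
move=> cM; rewrite /inv_coef /horner_morph (horner_coef_wide _ (n := M)); last first.
  exact: leq_trans (size_poly _ _) cM.
rewrite mulr_suml rmorph_sum; apply: eq_bigr => j _.
rewrite coef_map_id0 ?rmorph0 // -mul_polyC !rmorphM /= -mulrA; congr (_ * _).
  by rewrite -[c`_j]intz !rmorph_int.
by rewrite !rmorphXn /= -/L expVn_mul ?Lvar_neq0 // ltnW.
Qed.

(** Multiplied by t^n L^M, the image becomes the polynomial with the coefficients of p in reversed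
    order. *)
Lemma inv_poly_inj (p : P2) : inv_poly p = 0 -> p = 0.
Proof.
move=> p0; pose n := size p; pose M := (\max_(i < n) size (p`_i)%R)%N.
have sM i : (size (p`_i)%R <= M)%N.
  case: (ltnP i n) => [ni|ni]; last by rewrite nth_default // size_poly0.
  exact: (leq_bigmax_cond (F := fun i : 'I_n => size (p`_i)%R) (Ordinal ni)).
pose q : P2 := \sum_(i < n) (\sum_(j < M) p`_i`_j *: 'X^(M - j))%:P * 'X^(n - i).
have qE : inv_poly p * t ^+ n * L ^+ M = tofrac q.
  rewrite /inv_poly /horner_morph (horner_coef_wide _ (n := n)) ?size_poly //.
  rewrite !mulr_suml rmorph_sum; apply: eq_bigr => i _.
  rewrite coef_map_id0 ?rmorph0 //.
  have -> : inv_coef p`_i * t^-1 ^+ i * t ^+ n * L ^+ M =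
     (inv_coef p`_i * L ^+ M) * (t^-1 ^+ i * t ^+ n).
    by rewrite -[inv_coef _ * _ * _]mulrA mulrAC.
  rewrite (inv_coefE (sM i)) [in RHS]rmorphM /= !rmorph_sum; congr (_ * _).
  by rewrite rmorphXn /= -/t expVn_mul ?tvar_neq0 // ltnW.
have q0 : q = 0 by apply/eqP; rewrite -tofrac_eq0 -qE p0 !mul0r.
apply/polyP => i; apply/polyP => j; rewrite !coef0.
case: (ltnP i n) => [ni|ni]; last by rewrite [p`_i]nth_default ?coef0.
case: (ltnP j M) => [jM|jM]; last by rewrite nth_default // (leq_trans (sM i)).
have qi : q`_(n - i) = \sum_(j < M) p`_i`_j *: 'X^(M - j).
  rewrite coef_sum (bigD1 (Ordinal ni)) //= coefCM coefXn eqxx mulr1.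
  rewrite [X in _ + X]big1 ?addr0 // => l li.
  rewrite coefCM coefXn; case: eqP => [e|]; last by rewrite mulr0.
  by move/eqP: li; case; apply: val_inj => /=; have := ltn_ord l; lia.
have := congr1 (fun c : {poly int} => c`_(M - j)) qi; rewrite q0 !coef0.
rewrite coef_sum (bigD1 (Ordinal jM)) //= coefZ coefXn eqxx mulr1.
rewrite [X in _ + X]big1 ?addr0 => [/esym //|l lj].
rewrite coefZ coefXn; case: eqP => [e|]; last by rewrite mulr0.
by move/eqP: lj; case; apply: val_inj => /=; have := ltn_ord l; lia.
Qed.

Lemma subst_invE (p q : P2) : q != 0 -> subst_inv (tofrac p / tofrac q) = inv_poly p / inv_poly q.
Proof.
move=> q0; rewrite /subst_inv !eval2_inv.
have := frac_repr (tofrac p / tofrac q); move: (repr _) => x.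
have ntz (r : P2) : r != 0 -> inv_poly r != 0.
  by apply: contraNneq => /inv_poly_inj ->.
have x0 : \d_x != 0 by exact: denom_ratioP.
move=> E; have {}E : p * \d_x = \n_x * q.
  apply/eqP; rewrite -(tofrac_eq) !rmorphM /= -E; apply/eqP.
  by rewrite mulrAC divfK // tofrac_eq0.
apply/eqP; rewrite eqr_div ?ntz // -!rmorphM /= -E mulrC //.
Qed.

Lemma sub_frac (F : fieldType) (p q a b : F) : q != 0 -> b != 0 ->
  p / q - a / b = (p * b - a * q) / (q * b).
Proof. by move=> q0 b0; field; rewrite q0 b0. Qed.

Section FracExtension.
Variables (A : idomainType) (F : fieldType) (f : {rmorphism A -> F}).
Variable s : {fraction A} -> F.
Hypothesis f_inj : forall a, f a = 0 -> a = 0.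
Hypothesis sE : forall p q, q != 0 -> s (tofrac p / tofrac q) = f p / f q.

Lemma frac_exists (R : {fraction A}) : exists p q : A, q != 0 /\ R = tofrac p / tofrac q.
Proof.
exists \n_(repr R), \d_(repr R); have d0 : \d_(repr R) != 0 by exact: denom_ratioP.
split=> //; rewrite -frac_repr.
by rewrite mulfK // tofrac_eq0.
Qed.

Lemma frac_ext_neq0 q : q != 0 -> f q != 0.
Proof. by apply: contraNneq => /f_inj ->. Qed.

(** For [subst_inv], which is defined through a chosen representative, the formula on all quotients
    and the injectivity of f make it a ring morphism; it can then be applied termwise to the
    recursion for [phi]. *)
Fact frac_ext_zmod : zmod_morphism s.
Proof.
move=> x y; have [p [q [q0 ->]]] := frac_exists x; have [a [b [b0 ->]]] := frac_exists y.
rewrite sub_frac ?tofrac_eq0 // -!rmorphM -rmorphB /= !sE ?mulf_neq0 //.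
by rewrite rmorphB !rmorphM sub_frac ?frac_ext_neq0.
Qed.

Lemma frac_ext_tofrac p : s (tofrac p) = f p.
Proof. by have := sE p (oner_neq0 A); rewrite !rmorph1 !divr1. Qed.

Fact frac_ext_mul : monoid_morphism s.
Proof.
split=> [|x y]; first by rewrite -(rmorph1 (@FracField.tofrac A)) frac_ext_tofrac rmorph1.
have [p [q [q0 ->]]] := frac_exists x; have [a [b [b0 ->]]] := frac_exists y.
by rewrite mulf_div -!rmorphM !sE ?mulf_neq0 // !rmorphM mulf_div.
Qed.

End FracExtension.

HB.instance Definition _ := GRing.isZmodMorphism.Build ratfun ratfun subst_inv
  (frac_ext_zmod (f := inv_poly) inv_poly_inj subst_invE).
HB.instance Definition _ := GRing.isMonoidMorphism.Build ratfun ratfun subst_inv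
  (frac_ext_mul (f := inv_poly) subst_invE).

Lemma subst_inv_t : subst_inv t = t^-1.
Proof. exact: etrans (frac_ext_tofrac subst_invE _) inv_polyX. Qed.

Lemma subst_inv_L : subst_inv L = L^-1.
Proof. exact: etrans (frac_ext_tofrac subst_invE _) (etrans (inv_polyC _) inv_coefX). Qed.

End InverseSubstitution.

(** * The rational generating function *)

Section Phi.
Variables (F : fieldType) (t L : F).
Hypotheses (t0 : t != 0) (L0 : L != 0).

(** For s + j + 1 < e: the weight of the continuations from an index of residue s modulo e in which
    j normalised coefficients vanish and the next does not, so that the gcd drops. Each coefficient
    is divided by L, so a forced zero counts L^-1 and a nonzero value 1 - L^-1. *)
Definition step_weight (phi : nat -> F) e s j : F :=
  L^-1 ^+ j * (1 - L^-1) * t ^+ (j * e.-1 + (gcdn e (s + j).+1).-1) * phi (gcdn e (s + j).+1).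

Definition period_factor e : F := 1 - L^-1 ^+ e.-1 * t ^+ (e * e.-1).

(* [phi e] is the sum of the weights of all the continuations of a series from
   an index divisible by the current gcd e, divided by L for each coefficient.  The
   recursion sums over the first index where the gcd drops; a period of length
   e without drop has weight 1 - period_factor e. *)
Lemma phi_exists : exists phi : nat -> F,
  phi 1%N = 1 /\ forall e, (1 < e)%N ->
    phi e = (period_factor e)^-1 * \sum_(r < e.-1) step_weight phi e 0 r.
Proof.
have [|phi Hphi] := @strong_rec F 0 (fun phi e => if (e <= 1)%N then 1 else
   (period_factor e)^-1 * \sum_(r < e.-1) step_weight phi e 0 r).
  move=> u v e uv; case: ltnP => // e1; congr (_ * _); apply: eq_bigr => r _.
  rewrite /step_weight uv //; apply: leq_ltn_trans (dvdn_leq _ (dvdn_gcdr _ _)) _ => //.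
  by have := ltn_ord r; rewrite add0n; lia.
exists phi; split=> [|e e1]; first by rewrite Hphi.
by rewrite {1}Hphi leqNgt e1.
Qed.

Variable phi : nat -> F.
Hypothesis phi1 : phi 1%N = 1.
Hypothesis phiE : forall e, (1 < e)%N ->
    phi e = (period_factor e)^-1 * \sum_(r < e.-1) step_weight phi e 0 r.
Hypothesis period0 : forall e, (1 < e)%N -> period_factor e != 0.

Lemma phi_eq e : (1 < e)%N -> period_factor e * phi e = \sum_(r < e.-1) step_weight phi e 0 r.
Proof. by move=> e1; rewrite (phiE e1) mulrA divff ?mul1r // period0. Qed.

(** The analogue of [phi e] at residue s: either the gcd drops before the next multiple of e, or e -
    1 - s zeros and one free coefficient lead back to residue 0. *)
Definition future e s : F := \sum_(j < e.-1 - s) step_weight phi e s j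
  + L^-1 ^+ (e.-1 - s) * t ^+ ((e - s) * e.-1) * phi e.

Lemma future0 e : (0 < e)%N -> future e 0 = phi e.
Proof.
case: e => // -[_|e _]; first by rewrite /future big_ord0 add0r muln0 !expr0 !mul1r.
rewrite /future !subn0 -phi_eq // /period_factor mulrBl mul1r.
by rewrite subrK.
Qed.

Lemma future_last e : (0 < e)%N -> future e e.-1 = t ^+ e.-1 * phi e.
Proof.
move=> e0; rewrite /future subnn big_ord0 add0r expr0 mul1r.
have -> : (e - e.-1 = 1)%N by lia.
by rewrite mul1n.
Qed.

Lemma futureS e s : (s.+1 < e)%N -> future e s =
  L^-1 * t ^+ e.-1 * future e s.+1
  + (1 - L^-1) * t ^+ (gcdn e s.+1).-1 * phi (gcdn e s.+1).
Proof.
move=> se; rewrite /future.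
have -> : (e.-1 - s = (e.-1 - s.+1).+1)%N by lia.
rewrite big_ord_recl mulrDr [RHS]addrC [in RHS]addrA; congr (_ + _ + _).
- by rewrite /step_weight /= expr0 mul1r mul0n add0n addn0.
- rewrite mulr_sumr; apply: eq_bigr => j _; rewrite /step_weight lift0 exprS mulSn addnS addSn.
  by rewrite -addnA exprD; ring.
- have -> : ((e - s) = (e - s.+1).+1)%N by lia.
  by rewrite exprS mulSn exprD; ring.
Qed.

Definition Future e i : F := future e (i %% e).

Lemma Future_dvd e i : (0 < e)%N -> (e %| i)%N -> Future e i = phi e.
Proof. by move=> e0 /eqP ei; rewrite /Future ei future0. Qed.

(** The recursion of [wt] with each step divided by L, prepared for the comparison in
    [wt_future]. *)
Lemma FutureS e i : (0 < e)%N -> Future e i =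
  if (e %| i.+1)%N then t ^+ e.-1 * Future e i.+1
  else L^-1 * t ^+ e.-1 * Future e i.+1
       + (1 - L^-1) * t ^+ (gcdn e i.+1).-1 * Future (gcdn e i.+1) i.+1.
Proof.
move=> e0; case: ifPn => [ei|ei].
  rewrite (Future_dvd e0 ei) -future_last // /Future; congr future.
  have := divn_eq i e; have := ltn_pmod i e0; move/dvdnP: ei => [q].
  set r := (i %% e)%N; set p := (i %/ e)%N => iq re ie.
  have qp : (q = p.+1)%N by nia.
  by move: iq; rewrite ie qp; nia.
have d0 : (0 < gcdn e i.+1)%N by rewrite gcdn_gt0 e0.
have si : ((i %% e).+1 < e)%N.
  rewrite ltn_neqAle ltn_pmod // andbT; apply: contraNneq ei => H.
  by rewrite (divn_eq i e) -addnS H dvdn_addl // dvdn_mull.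
have im : (i.+1 %% e = (i %% e).+1)%N.
  by rewrite -addn1 -modnDml addn1 modn_small.
rewrite [Future (gcdn _ _) _]Future_dvd ?dvdn_gcdr // /Future im futureS //.
by rewrite -im gcdn_modr.
Qed.

Lemma future1 i : Future 1 i = 1.
Proof. by rewrite Future_dvd ?dvd1n. Qed.

Variable theta : {rmorphism F -> F}.
Hypotheses (thetat : theta t = t^-1) (thetaL : theta L = L^-1).

(* The terms r and e - r of the recursion are exchanged, as gcd e r = gcd e (e - r). *)
Lemma theta_phi e : (0 < e)%N -> theta (phi e) = t ^+ (2 * e.-1) * phi e.
Proof.
elim/ltn_ind: e => e IH e0; have [->|e1] : (e = 1 \/ 1 < e)%N.
- by case: e e0 {IH} => [|[|]] //; [left|right].
- by rewrite phi1 rmorph1 mulr1.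
have A0 := period0 e1; set n := e.-1.
have n0 : (0 < n)%N by rewrite /n; lia.
have eE : e = n.+1 by rewrite /n; lia.
have thA : theta (period_factor e) * t ^+ (e * n) = - L ^+ n * period_factor e.
  rewrite /period_factor -/n rmorphB rmorph1 rmorphM !rmorphXn fmorphV thetaL thetat invrK.
  rewrite mulrBl mul1r -mulrA -exprMn mulVf // expr1n mulr1.
  rewrite mulNr mulrBr mulr1 mulrA -exprMn mulfV // expr1n mul1r.
  by rewrite opprB.
have thS (r : 'I_n) : theta (step_weight phi e 0 r) * t ^+ (n.-1 * n) =
    - L ^+ n * step_weight phi e 0 (rev_ord r).
  have rn := ltn_ord r.
  rewrite /step_weight !add0n -/n; have -> : gcdn e (rev_ord r).+1 = gcdn e r.+1.
    have e2 : ((rev_ord r).+1 + r.+1 = e)%N by rewrite /= eE; lia.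
    by rewrite -[in LHS]e2 -[in RHS]e2 gcdnC gcdnDl [RHS]gcdnC gcdnDr gcdnC.
  set d := gcdn e r.+1.
  have d0 : (0 < d)%N by rewrite gcdn_gt0 e0.
  have de : (d < e)%N.
    by apply: leq_ltn_trans (dvdn_leq _ (dvdn_gcdr _ _)) _ => //; rewrite eE.
  rewrite !rmorphM !rmorphXn rmorphB rmorph1 !fmorphV thetaL thetat invrK IH //.
  have eL : L ^+ r * (1 - L) = - (L ^+ n * (L^-1 ^+ (rev_ord r) * (1 - L^-1))).
    have -> : L ^+ n = L ^+ r * L * L ^+ (rev_ord r).
      by rewrite -exprSr -exprD; congr (_ ^+ _); rewrite /=; lia.
    have bc : L ^+ rev_ord r * L^-1 ^+ rev_ord r = 1 by rewrite -exprMn mulfV // expr1n.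
    transitivity (- (L ^+ r * (L ^+ rev_ord r * L^-1 ^+ rev_ord r) * (L - L * L^-1))).
      by rewrite bc mulfV //; ring.
    by ring.
  have et : t^-1 ^+ (r * n + d.-1) * (t ^+ (2 * d.-1) * t ^+ (n.-1 * n)) =
     t ^+ (rev_ord r * n + d.-1).
    rewrite -exprD expVn_mul //; last by nia.
    by congr (_ ^+ _); rewrite /=; nia.
  rewrite -!mulrA [_ ^+ (2 * _) * (_ * _)]mulrCA [phi d * _]mulrC.
  rewrite mulrA eL -/d.
  rewrite [_ * (t ^+ _ * phi d)]mulrA -et; ring.
have L1 : - L ^+ n != 0 by rewrite oppr_eq0 expf_neq0.
apply: (mulfI (mulf_neq0 L1 A0)).
transitivity (theta (period_factor e * phi e) * t ^+ (e * n)).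
  by rewrite rmorphM -thA; ring.
rewrite phi_eq // -/n rmorph_sum.
(* Both sides of the recursion have acquired the factor - L^n; the exponents of t used to restore
   them differ by 2 n = 2 (e - 1), the exponent in the statement. *)
have -> : (e * n = n.-1 * n + 2 * n)%N by rewrite eE; nia.
rewrite exprD mulrA mulr_suml (eq_bigr (fun r : 'I_n => - L ^+ n * step_weight phi e 0 (rev_ord r))) //.
rewrite -mulr_sumr.
have -> : \sum_(r < n) step_weight phi e 0 (rev_ord r) = \sum_(r < n) step_weight phi e 0 r.
  by rewrite [RHS](reindex_inj rev_ord_inj).
by rewrite -phi_eq // -/n; ring.
Qed.

End Phi.

(** * Comparison of the polynomials counting jets with the rational function *)

Section GeneratingFunction.

Local Notation P2 := {poly {poly int}}.
Local Notation ratfun := {fraction P2}.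
Local Notation t := tvar.
Local Notation L := Lvar.
Local Notation T := (@FracField.tofrac P2).
Local Notation Lp := ('X%:P : P2).

(* [wt j i e] is the sum, over all choices of the coefficients of degrees
   i+1, ..., i+j of a series whose coefficients of degree at most i have gcd e
   (with k), of L^(free) (L-1)^(nonzero) t^(\sum (e_l - 1)). *)
Fixpoint wt (j i e : nat) : P2 :=
  if j is j'.+1 then
    if (e %| i.+1)%N then Lp * 'X^(e.-1) * wt j' i.+1 e
    else 'X^(e.-1) * wt j' i.+1 e
         + (Lp - 1) * 'X^((gcdn e i.+1).-1) * wt j' i.+1 (gcdn e i.+1)
  else 1.

Lemma tofracX : T 'X = t. Proof. by []. Qed.
Lemma tofracL : T Lp = L. Proof. by []. Qed.

Lemma period_neq0 e : (1 < e)%N -> period_factor t L e != 0.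
Proof.
move=> e1; rewrite /period_factor subr_eq0 eq_sym; apply/eqP => H.
have : L ^+ e.-1 = t ^+ (e * e.-1).
  by rewrite -[LHS]mulr1 -H mulrA -exprMn mulfV ?Lvar_neq0 // expr1n mul1r.
rewrite -tofracX -tofracL -!tofracXn => /eqP; rewrite tofrac_eq => /eqP.
move=> /(congr1 (fun p : P2 => p`_0)).
rewrite -rmorphXn coefC eqxx coefXn.
have -> : (0 == e * e.-1)%N = false by apply/eqP; nia.
move/(congr1 (fun p : {poly int} => p`_e.-1)); rewrite coefXn eqxx coef0.
by move/eqP; rewrite oner_eq0.
Qed.

Definition clears (Q : P2) (x : ratfun) := exists P, T Q * x = T P.

(** The denominators are those that [is_expansion] allows. *)
Definition admissible (x : ratfun) := exists2 Q : P2, Q`_0 \is monic & clears Q x.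

Lemma clears_mul Q Q' x : clears Q x -> clears (Q' * Q) x.
Proof. by move=> [P E]; exists (Q' * P); rewrite !rmorphM /= -mulrA E. Qed.

Lemma monic0M (Q Q' : P2) : Q`_0 \is monic -> Q'`_0 \is monic -> (Q * Q')`_0 \is monic.
Proof. by move=> m m'; rewrite coef0M; exact: rpredM. Qed.

Lemma common_denominator (s : seq ratfun) : (forall x, x \in s -> admissible x) ->
  exists2 Q : P2, Q`_0 \is monic & forall x, x \in s -> clears Q x.
Proof.
elim: s => [|x s IH] H; first by exists 1; rewrite ?coef1 ?rpred1.
have [|Q mQ HQ] := IH; first by move=> y ys; apply: H; rewrite inE ys orbT.
have [Q' mQ' HQ'] := H x (mem_head _ _).
exists (Q * Q'); first exact: monic0M.
move=> y; rewrite inE => /orP[/eqP->|/HQ yQ]; first exact: clears_mul.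
by rewrite mulrC; exact: clears_mul.
Qed.

Lemma admissibleD x y : admissible x -> admissible y -> admissible (x + y).
Proof.
move=> [Q mQ [P E]] [Q' mQ' [P' E']]; exists (Q * Q'); first exact: monic0M.
exists (P * Q' + P' * Q); rewrite rmorphD !rmorphM /= -E -E'; ring.
Qed.

Lemma admissibleM x y : admissible x -> admissible y -> admissible (x * y).
Proof.
move=> [Q mQ [P E]] [Q' mQ' [P' E']]; exists (Q * Q'); first exact: monic0M.
exists (P * P'); rewrite !rmorphM /= -E -E'; ring.
Qed.

Lemma admissible_poly p : admissible (T p).
Proof. by exists 1; [rewrite coef1 rpred1|exists p; rewrite rmorph1 mul1r]. Qed.

Lemma admissible_sum I (r : seq I) (P : pred I) (f : I -> ratfun) :
  (forall i, P i -> admissible (f i)) -> admissible (\sum_(i <- r | P i) f i).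
Proof.
move=> H; apply: (big_ind admissible) => //; last exact: admissibleD.
by rewrite -(rmorph0 T); exact: admissible_poly.
Qed.

Lemma admissibleX x n : admissible x -> admissible (x ^+ n).
Proof.
move=> ax; elim: n => [|n IH]; first by rewrite expr0 -(rmorph1 T); exact: admissible_poly.
by rewrite exprS; exact: admissibleM.
Qed.

Lemma admissible_LV : admissible L^-1.
Proof.
exists Lp; first by rewrite coefC eqxx monicX.
by exists 1; rewrite tofracL mulfV ?Lvar_neq0 // rmorph1.
Qed.

Lemma admissible_t : admissible t. Proof. exact: admissible_poly. Qed.

Lemma admissible_1LV : admissible (1 - L^-1).
Proof.
have -> : 1 - L^-1 = T 1 + T (- 1) * L^-1 by rewrite tofracN tofrac1 mulN1r.
by apply: admissibleD; [|apply: admissibleM; last exact: admissible_LV]; exact: admissible_poly.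
Qed.

Lemma admissible_period e : (1 < e)%N -> admissible (period_factor t L e)^-1.
Proof.
move=> e1; exists (Lp ^+ e.-1 - 'X^(e * e.-1)).
  rewrite coefB -rmorphXn coefC eqxx coefXn.
  have -> : (0 == e * e.-1)%N = false by apply/eqP; nia.
  by rewrite subr0 monicXn.
exists (Lp ^+ e.-1); rewrite rmorphB !rmorphXn /= tofracX tofracL.
have -> : L ^+ e.-1 - t ^+ (e * e.-1) = L ^+ e.-1 * period_factor t L e.
  by rewrite /period_factor mulrBr mulr1 mulrA -exprMn mulfV ?Lvar_neq0 // expr1n mul1r.
by rewrite mulfK // period_neq0.
Qed.

Section Expansion.
Variable phi : nat -> ratfun.
Hypothesis phi1 : phi 1%N = 1.
Hypothesis phiE : forall e, (1 < e)%N ->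
    phi e = (period_factor t L e)^-1 * \sum_(r < e.-1) step_weight t L phi e 0 r.
Local Notation Fut := (Future t L phi).

Lemma admissible_step e s j : (forall d, (0 < d)%N -> (d <= (s + j).+1)%N -> admissible (phi d)) ->
  admissible (step_weight t L phi e s j).
Proof.
move=> H; apply: admissibleM; last first.
  by apply: H; [rewrite gcdn_gt0 orbT|rewrite dvdn_leq // dvdn_gcdr].
apply: admissibleM; last exact/admissibleX/admissible_t.
by apply: admissibleM; [exact/admissibleX/admissible_LV|exact: admissible_1LV].
Qed.

Lemma admissible_phi e : (0 < e)%N -> admissible (phi e).
Proof.
elim/ltn_ind: e => e IH e0; have [->|e1] : (e = 1 \/ 1 < e)%N.
- by case: e e0 {IH} => [|[|]] //; [left|right].
- by rewrite phi1 -(rmorph1 T); exact: admissible_poly.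
rewrite phiE //; apply: admissibleM; first exact: admissible_period.
apply: admissible_sum => r _; apply: admissible_step => d d0 dr; apply: IH => //.
by apply: leq_ltn_trans dr _; have := ltn_ord r; rewrite add0n; lia.
Qed.

Lemma admissible_future e s : (0 < e)%N -> admissible (future t L phi e s).
Proof.
move=> e0; apply: admissibleD.
  by apply: admissible_sum => j _; apply: admissible_step => d d0 _; exact: admissible_phi.
apply: admissibleM; last exact: admissible_phi.
by apply: admissibleM; [exact/admissibleX/admissible_LV|exact/admissibleX/admissible_t].
Qed.

(** [Future] depends on i only modulo e, so finitely many functions occur for e <= k. *)
Lemma future_denominator k : exists2 Q : P2, Q`_0 \is monic &
  forall e i, (0 < e)%N -> (e <= k)%N -> clears Q (Fut e i).
Proof.
pose s := [seq future t L phi p.1 p.2 | p <- [seq (e, i) | e <- iota 1 k, i <- iota 0 k]].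
have [|Q mQ HQ] := @common_denominator s.
  move=> x /mapP[p /allpairsP[[e i] /= [ek ik ->]] ->]; apply: admissible_future.
  by move: ek; rewrite mem_iota => /andP[].
exists Q => // e i e0 ek; apply: HQ; apply/mapP; exists (e, (i %% e)%N) => //.
apply/allpairsP; exists (e, (i %% e)%N); rewrite /= !mem_iota e0 add1n ltnS ek add0n.
by split=> //; apply: leq_trans ek; exact: ltn_pmod.
Qed.

Lemma wt_one j i : wt j i 1 = Lp ^+ j.
Proof.
by elim: j i => [|j IH] i //; rewrite /= dvd1n expr0 mulr1 IH exprS.
Qed.

(** For e = 1 the two terms are equal, and a step that arrives at a gcd above 1 carries a factor t;
    so after j steps they agree modulo t^j. The denominator [Q] turns this into divisibility of
    polynomials. *)
Lemma wt_future (Q : P2) k : (forall e i, (0 < e)%N -> (e <= k)%N -> clears Q (Fut e i)) ->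
  forall j i e, (0 < e)%N -> (e <= k)%N ->
  exists P : P2, T Q * (T (wt j i e) - L ^+ j * Fut e i) = T ('X^j * P).
Proof.
move=> HQ; have one j i : T (wt j i 1) - L ^+ j * Fut 1 i = 0.
  rewrite wt_one (future1 phi1 phiE period_neq0) mulr1 tofracXn; exact: subrr.
elim=> [|j IH] i e e0 ek.
  have [P E] := HQ e i e0 ek; exists (Q - P).
  have -> : T (wt 0 i e) - L ^+ 0 * Fut e i = 1 - Fut e i by rewrite tofrac1 expr0 mul1r.
  by rewrite expr0 mul1r mulrBr mulr1 E tofracB.
have [->|e1] : (e = 1 \/ 1 < e)%N.
  by case: e e0 {ek} => [|[|]] //; [left|right].
  exists 0; rewrite one; exact: etrans (mulr0 (T Q)) (esym (etrans (congr1 T (mulr0 _)) (tofrac0 _))).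
have eE : e.-1 = e.-2.+1 by lia.
have [P E] := IH i.+1 e e0 ek.
rewrite (FutureS tvar_neq0 Lvar_neq0 phiE period_neq0 i e0) /=; case: ifP => _.
  exists (Lp * 'X^(e.-2) * P); rewrite eE.
  have -> : T (Lp * 'X^(e.-2.+1) * wt j i.+1 e) - L ^+ j.+1 * (t ^+ e.-2.+1 * Fut e i.+1) =
     (L * t ^+ e.-2.+1) * (T (wt j i.+1 e) - L ^+ j * Fut e i.+1).
    by rewrite !tofracM tofracXn tofracX tofracL [L ^+ j.+1]exprS; ring.
  rewrite mulrCA E -tofracX -tofracL -tofracXn -!tofracM; congr T.
  by rewrite !exprS; ring.
set d := gcdn e i.+1.
have d0 : (0 < d)%N by rewrite gcdn_gt0 e0.
have dk : (d <= k)%N by apply: leq_trans ek; rewrite dvdn_leq // dvdn_gcdl.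
have Li : L * L^-1 = 1 by rewrite mulfV // Lvar_neq0.
have -> : T ('X^(e.-1) * wt j i.+1 e + (Lp - 1) * 'X^(d.-1) * wt j i.+1 d)
  - L ^+ j.+1 * (L^-1 * t ^+ e.-1 * Fut e i.+1 + (1 - L^-1) * t ^+ d.-1 * Fut d i.+1) =
  t ^+ e.-1 * (T (wt j i.+1 e) - L ^+ j * Fut e i.+1) +
  (L - 1) * t ^+ d.-1 * (T (wt j i.+1 d) - L ^+ j * Fut d i.+1).
  rewrite tofracD !tofracM tofracB tofrac1 !tofracXn tofracX tofracL [L ^+ j.+1]exprS.
  move: (T (wt j i.+1 e)) (T (wt j i.+1 d)) (Fut e i.+1) (Fut d i.+1) => a b c f.
  move: (t ^+ e.-1) (t ^+ d.-1) (L ^+ j) => x y z.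
  have -> : L * z * (L^-1 * x * c + (1 - L^-1) * y * f) =
    (L * L^-1) * z * x * c + (L - L * L^-1) * z * y * f by ring.
  by rewrite Li; ring.
have [P' E'] : exists P' : P2, T Q * ((L - 1) * t ^+ d.-1 * (T (wt j i.+1 d) - L ^+ j * Fut d i.+1))
    = T ('X^(j.+1) * P').
  have [->|d1] : (d = 1 \/ 1 < d)%N.
  - by case: (d) d0 => [|[|]] //; [left|right].
  - exists 0; rewrite one; apply: etrans (congr1 _ (mulr0 _)) _.
    exact: etrans (mulr0 (T Q)) (esym (etrans (congr1 T (mulr0 _)) (tofrac0 _))).
  have [P' E'] := IH i.+1 d d0 dk; exists ((Lp - 1) * 'X^(d.-2) * P').
  have dE : d.-1 = d.-2.+1 by lia.
  rewrite dE mulrCA E' -tofracX -tofracL -tofrac1 -tofracB -tofracXn -!tofracM.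
  by congr T; rewrite !exprS; ring.
exists ('X^(e.-2) * P + P'); rewrite mulrDr E' mulrCA E eE.
rewrite -tofracX -tofracXn -tofracM -tofracD; congr T.
by rewrite !exprS; ring.
Qed.

End Expansion.

(** The generating polynomial of the N-jets: (L - 1)^2 for x_k and y_m, L^(N-k) for the higher
    coefficients of x, the power of t for the degrees 1, ..., m of y, and [wt] for the degrees above
    m. *)
Definition level_poly k m N : P2 :=
  (Lp - 1) ^+ 2 * Lp ^+ (N - k) * 'X^((m - 1) * (k - 1) + (gcdn k m).-1)
  * wt (N - m) m (gcdn k m).

Lemma normalizing_factor (F : fieldType) (l q x p : F) c : l != 0 ->
  (1 - l^-1) ^+ 2 * l^-1 ^+ c * x * p * (q * l ^+ (2 + c)) = (l - 1) ^+ 2 * x * (q * p).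
Proof.
move=> l0; rewrite exprVn exprD; have lc : l ^+ c != 0 by rewrite expf_neq0.
by move: (l ^+ c) lc => w w0; field; rewrite l0 w0.
Qed.

Lemma symmetry_factor (F : fieldType) (theta : {rmorphism F -> F}) (x l p : F) a b c :
  x != 0 -> l != 0 -> theta x = x^-1 -> theta l = l^-1 -> theta p = x ^+ (2 * b) * p ->
  theta ((1 - l^-1) ^+ 2 * l^-1 ^+ c * x ^+ (a + b) * p) =
  x ^- (2 * a) * l ^+ (2 * c + 2) * ((1 - l^-1) ^+ 2 * l^-1 ^+ c * x ^+ (a + b) * p).
Proof.
move=> x0 l0 tx tl tp; rewrite !rmorphM !rmorphXn rmorphB rmorph1 !fmorphV tx tl tp invrK.
rewrite !exprVn !mul2n -!addnn !exprD.
have xa : x ^+ a != 0 by rewrite expf_neq0. have xb : x ^+ b != 0 by rewrite expf_neq0.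
have lc : l ^+ c != 0 by rewrite expf_neq0.
move: (x ^+ a) (x ^+ b) (l ^+ c) xa xb lc => u v w u0 v0 w0.
by field; rewrite l0 w0 v0 u0.
Qed.

(** The last clause is Q G = P at order n in t, multiplied by L^(2N): [level_poly] gives classes of
    sets of N-jets, and their measure carries the factor L^(-2N). *)
Theorem rational_generating_function k m : (1 <= k)%N -> (1 <= m)%N ->
  exists G : ratfun, exists P Q : P2,
  [/\ Q`_0 \is monic, G = T P / T Q,
      subst_inv G = t ^- (2 * (k - 1) * (m - 1)) * L ^+ (2 * k + 2 * m - 2) * G &
      forall n N, (n + m < N)%N -> (k <= N)%N ->
        \sum_(i < n.+1) Q`_i * (level_poly k m N)`_(n - i) = 'X^(2 * N) * P`_n].
Proof.
move=> k1 m1; have [phi [phi1 phiE]] := phi_exists tvar_neq0 Lvar_neq0.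
set e0 := gcdn k m; have e0gt : (0 < e0)%N by rewrite gcdn_gt0 k1.
have ek : (e0 <= k)%N by rewrite dvdn_leq // dvdn_gcdl.
have [Q mQ HQ] := future_denominator phi1 phiE k.
have Fe : Future t L phi e0 m = phi e0.
  by exact: (Future_dvd phiE period_neq0 e0gt (dvdn_gcdr k m)).
have [P PE] := HQ e0 m e0gt ek; rewrite Fe in PE.
set M0 := ((m - 1) * (k - 1) + e0.-1)%N.
pose G := (1 - L^-1) ^+ 2 * L^-1 ^+ (k - 1 + (m - 1)) * t ^+ M0 * phi e0.
have Q0 : Q != 0.
  by apply: contraTneq mQ => ->; rewrite coef0 monicE lead_coef0 eq_sym oner_neq0.
exists G, ((Lp - 1) ^+ 2 * 'X^M0 * P), (Q * Lp ^+ (k + m)); split.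
- rewrite coef0M -rmorphXn coefC eqxx; apply: rpredM => //; exact: monicXn.
- have QL : T (Q * Lp ^+ (k + m)) != 0.
    by rewrite tofrac_eq0 mulf_neq0 // expf_neq0 // polyC_eq0 polyX_eq0.
  apply: (mulIf QL); rewrite divfK // !tofracM -PE !tofracXn tofracB tofrac1 tofracX tofracL /G.
  have -> : (k + m = 2 + (k - 1 + (m - 1)))%N by lia.
  move: (k - 1 + (m - 1))%N (T Q) (t ^+ M0) (phi e0) => c q x p.
  exact: normalizing_factor Lvar_neq0.
- have M0E : M0 = ((k - 1) * (m - 1) + e0.-1)%N by rewrite /M0 mulnC.
  have tp := theta_phi tvar_neq0 Lvar_neq0 phi1 phiE period_neq0 subst_inv_t subst_inv_L e0gt.
  have := symmetry_factor ((k - 1) * (m - 1)) (k - 1 + (m - 1)) tvar_neq0 Lvar_neq0 subst_inv_t subst_inv_L tp.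
  rewrite -M0E -/G mulnA => ->.
  by congr (_ * L ^+ _ * _); lia.
- move=> n N nN kN.
  have [P' PE'] := wt_future phi1 phiE HQ (N - m) m e0gt ek; rewrite Fe in PE'.
  have E1 : Q * wt (N - m) m e0 = Lp ^+ (N - m) * P + 'X^(N - m) * P'.
    apply/eqP; rewrite -tofrac_eq tofracD -PE' !tofracM -PE tofracXn tofracL.
    by apply/eqP; rewrite mulrBr mulrCA [X in _ = X]addrC subrK.
  have E2 : Q * Lp ^+ (k + m) * level_poly k m N =
      ('X^(2 * N))%:P * ((Lp - 1) ^+ 2 * 'X^M0 * P)
      + 'X^(N - m) * ((Lp - 1) ^+ 2 * 'X^M0 * Lp ^+ (N + m) * P').
    rewrite /level_poly -/e0 -/M0 rmorphXn /=.
    have -> : (2 * N = N + m + (N - m))%N by lia.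
    transitivity ((Lp - 1) ^+ 2 * 'X^M0 * Lp ^+ (N + m) * (Q * wt (N - m) m e0)).
      have -> : (N + m = (k + m) + (N - k))%N by lia.
      by rewrite [_ ^+ (k + m + (N - k))]exprD; ring.
    rewrite E1 [_ ^+ (N + m + (N - m))]exprD.
    by ring.
  rewrite -coefM E2 coefD coefCM coefXnM.
  (* The error term is a multiple of t^(N-m) and does not reach degree n. *)
  have nNm : (n < N - m)%N by lia.
  by rewrite nNm addr0.
Qed.

End GeneratingFunction.

Local Open Scope classical_set_scope.
Local Open Scope ring_scope.
Local Open Scope quotient_scope.

(** * Classes of quasi-projective varieties *)

Section PolyFun.
Variable K : closedFieldType.

(** Polynomials enter only through the functions they define, so loci and maps are handled by
    closure properties of functions. *)
Definition pf n (f : 'rV[K]_n -> K) := exists p : {mpoly K[n]}, forall v, ev p v = f v.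
Definition hf n d (f : 'rV[K]_n -> K) :=
  exists2 p : {mpoly K[n]}, p \is d.-homog & forall v, ev p v = f v.

Lemma hf_pf n d f : @hf n d f -> pf f.
Proof. by move=> [p _ H]; exists p. Qed.

Lemma hf_ext n d f g : f =1 g -> @hf n d f -> hf d g.
Proof. by move=> fg [p hp H]; exists p => // v; rewrite H. Qed.

Lemma pf_ext n f g : f =1 g -> @pf n f -> pf g.
Proof. by move=> fg [p H]; exists p => v; rewrite H. Qed.

Lemma hf_coord n i : @hf n 1 (fun v => v 0 i).
Proof.
exists 'X_i; first by rewrite dhomogX /= mdeg1.
by move=> v; rewrite /ev mevalXU.
Qed.

Lemma hf_cst n c : @hf n 0 (fun=> c).
Proof.
exists (c *: 1); first exact/dhomogZ/dhomog1.
by move=> v; rewrite /ev mevalZ meval1 mulr1.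
Qed.

Lemma hf0 n d : @hf n d (fun=> 0).
Proof. by exists 0; [exact: dhomog0|move=> v; rewrite /ev meval0]. Qed.

Lemma hfD n d f g : @hf n d f -> hf d g -> hf d (fun v => f v + g v).
Proof.
move=> [p hp Hp] [q hq Hq]; exists (p + q); first exact: dhomogD.
by move=> v; rewrite /ev mevalD -!/(ev _ _) Hp Hq.
Qed.

Lemma hfM n d e f g : @hf n d f -> hf e g -> hf (d + e) (fun v => f v * g v).
Proof.
move=> [p hp Hp] [q hq Hq]; exists (p * q); first exact: dhomogM.
by move=> v; rewrite /ev mevalM -!/(ev _ _) Hp Hq.
Qed.

Lemma hfZ n d f c : @hf n d f -> hf d (fun v => c * f v).
Proof. by move=> Hf; rewrite -[d]add0n; apply: hfM => //; exact: hf_cst. Qed.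

Lemma hfX n d f k : @hf n d f -> hf (d * k) (fun v => f v ^+ k).
Proof.
move=> Hf; elim: k => [|k IH]; first by rewrite muln0; exact: hf_cst.
by rewrite mulnS; apply: hf_ext (hfM Hf IH) => v; rewrite exprS.
Qed.

Lemma hf_sum n d I (r : seq I) (P : pred I) (f : I -> 'rV[K]_n -> K) :
  (forall i, P i -> hf d (f i)) -> hf d (fun v => \sum_(i <- r | P i) f i v).
Proof.
move=> H; elim: r => [|i r IH].
  by apply: hf_ext (hf0 n d) => v; rewrite big_nil.
case Pi : (P i); last by apply: hf_ext IH => v; rewrite big_cons Pi.
by apply: hf_ext (hfD (H i Pi) IH) => v; rewrite big_cons Pi.
Qed.

Lemma hf_prod n I (r : seq I) (d : I -> nat) (f : I -> 'rV[K]_n -> K) :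
  (forall i, hf (d i) (f i)) -> hf (\sum_(i <- r) d i) (fun v => \prod_(i <- r) f i v).
Proof.
move=> H; elim: r => [|i r IH].
  by rewrite big_nil; apply: hf_ext (hf_cst n 1) => v; rewrite big_nil.
by rewrite big_cons; apply: hf_ext (hfM (H i) IH) => v; rewrite big_cons.
Qed.

Lemma hf_scale n d f (v : 'rV_n) c : hf d f -> f (c *: v) = c ^+ d * f v.
Proof.
move=> [p hp Hp]; rewrite -!Hp /ev !mevalE big_distrr /= big_seq [RHS]big_seq.
apply: eq_bigr => m mp; rewrite mulrCA; congr (_ * _).
rewrite -(dhomogP _ _ _ hp _ mp) /= mdegE expr_sum -big_split /=.
by apply: eq_bigr => i _; rewrite mxE exprMn.
Qed.

Lemma pfD n f g : @pf n f -> pf g -> pf (fun v => f v + g v).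
Proof. by move=> [p Hp] [q Hq]; exists (p + q) => v; rewrite /ev mevalD -!/(ev _ _) Hp Hq. Qed.

Lemma pfM n f g : @pf n f -> pf g -> pf (fun v => f v * g v).
Proof. by move=> [p Hp] [q Hq]; exists (p * q) => v; rewrite /ev mevalM -!/(ev _ _) Hp Hq. Qed.

Lemma pf_coord n i : @pf n (fun v => v 0 i).
Proof. exact: hf_pf (hf_coord i). Qed.

Lemma pf_cst n c : @pf n (fun=> c).
Proof. exact: hf_pf (hf_cst n c). Qed.

Lemma pfN n f : @pf n f -> pf (fun v => - f v).
Proof. by move=> Hf; apply: pf_ext (pfM (pf_cst _ (-1)) Hf) => v; rewrite mulN1r. Qed.

Lemma pfX n f k : @pf n f -> pf (fun v => f v ^+ k).
Proof.
move=> Hf; elim: k => [|k IH]; first exact: pf_cst.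
by apply: pf_ext (pfM Hf IH) => v; rewrite exprS.
Qed.

Lemma pf_sum n I (r : seq I) (f : I -> 'rV[K]_n -> K) :
  (forall i, pf (f i)) -> pf (fun v => \sum_(i <- r) f i v).
Proof.
move=> H; elim: r => [|i r IH].
  by apply: pf_ext (pf_cst n 0) => v; rewrite big_nil.
by apply: pf_ext (pfD (H i) IH) => v; rewrite big_cons.
Qed.

Lemma pf_prod n I (r : seq I) (f : I -> 'rV[K]_n -> K) :
  (forall i, pf (f i)) -> pf (fun v => \prod_(i <- r) f i v).
Proof.
move=> H; elim: r => [|i r IH].
  by apply: pf_ext (pf_cst n 1) => v; rewrite big_nil.
by apply: pf_ext (pfM (H i) IH) => v; rewrite big_cons.
Qed.

Lemma pf_comp a b f (g : 'rV[K]_a -> 'rV[K]_b) : pf f ->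
  (forall i, pf (fun v => g v 0 i)) -> pf (f \o g).
Proof.
move=> [p Hp] Hg.
apply: (@pf_ext _ (fun v => \sum_(m <- msupp p) p@_m * \prod_i g v 0 i ^+ m i)).
  by move=> v; rewrite /= -Hp /ev mevalE.
by apply: pf_sum => m; apply: pfM; [exact: pf_cst|apply: pf_prod => i; exact: pfX].
Qed.

Lemma hf_comp a b d e f (g : 'rV[K]_a -> 'rV[K]_b) : hf d f ->
  (forall i, hf e (fun v => g v 0 i)) -> hf (d * e) (f \o g).
Proof.
move=> [p hp Hp] Hg.
apply: (@hf_ext _ _ (fun v => \sum_(m <- msupp p | m \in msupp p) p@_m * \prod_i g v 0 i ^+ m i)).
  by move=> v; rewrite /= -Hp /ev mevalE [RHS]big_seq.
apply: hf_sum => m mp; apply: hfZ.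
have -> : (d * e = \sum_(i <- index_enum 'I_b) e * m i)%N.
  by rewrite -big_distrr /= -mdegE (dhomogP _ _ _ hp _ mp) mulnC.
by apply: hf_prod => i; exact: hfX.
Qed.

(** All large degrees D are allowed, so that the components of a map can be homogenised in one
    common degree. *)
Lemma homogenize N (f : 'rV[K]_N -> K) : pf f -> exists D0, forall D, (D0 <= D)%N ->
  exists2 F : 'rV[K]_(1 + N) -> K, hf D F & forall w, lsubmx w 0 0 != 0 ->
    F w = lsubmx w 0 0 ^+ D * f ((lsubmx w 0 0)^-1 *: rsubmx w).
Proof.
move=> [p Hp]; exists (msize p) => D pD.
exists (fun w => \sum_(m <- msupp p | m \in msupp p) p@_m *
   (w 0 (lshift N 0) ^+ (D - mdeg m) * \prod_i w 0 (rshift 1 i) ^+ m i)).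
  apply: hf_sum => m mp; apply: hfZ.
  have mD : (mdeg m <= D)%N by apply: leq_trans (ltnW (msize_mdeg_lt mp)) pD.
  rewrite -{1}(subnK mD); apply: hfM.
    by have := hfX (D - mdeg m) (@hf_coord (1 + N) (lshift N 0)); rewrite mul1n.
  have -> : mdeg m = (\sum_(i <- index_enum 'I_N) 1 * m i)%N.
    by rewrite mdegE; apply: eq_bigr => i _; rewrite mul1n.
  by apply: hf_prod => i; apply: hfX; exact: hf_coord.
move=> w; have -> : lsubmx w 0 0 = w 0 (lshift N 0) by rewrite mxE.
move=> w0; rewrite -Hp /ev mevalE big_distrr /= -big_seq; apply: eq_big_seq => m mp.
rewrite [RHS]mulrCA; congr (_ * _).
have mD : (mdeg m <= D)%N by apply: leq_trans (ltnW (msize_mdeg_lt mp)) pD.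
rewrite -[in RHS](subnK mD) exprD -mulrA; congr (_ * _).
rewrite mdegE expr_sum -big_split /=; apply: eq_bigr => i _.
by rewrite !mxE -exprMn mulrA mulfV // mul1r.
Qed.

(* Index families rather than sequences, since functions have no decidable
   equality here. *)
Lemma proj_closedP n (Z : set 'rV[K]_n) : proj_closed Z <->
  exists (l : nat) (f : 'I_l -> 'rV[K]_n -> K), (forall i, exists d, hf d (f i)) /\
    Z = [set v | v != 0 /\ forall i, f i v = 0].
Proof.
split=> [[F hF ->]|[l [f [hf_ ->]]]].
  exists (size F), (fun i => ev (F`_i)); split=> [i|].
    by have [d hd] := hF _ (mem_nth 0 (ltn_ord i)); exists d, F`_i.
  apply/seteqP; split=> v [v0 H]; split=> //.
    by move=> i; exact/H/mem_nth.
  by move=> q /(nthP 0)[i iF <-]; exact: (H (Ordinal iF)).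
have /choice[d /choice[q Hq]] : forall i, exists d, exists q : {mpoly K[n]},
    q \is d.-homog /\ forall v, ev q v = f i v.
  by move=> i; have [d [q ? ?]] := hf_ i; exists d, q.
exists [seq q i | i <- enum 'I_l].
  by move=> r /mapP[i _ ->]; exists (d i); exact: (Hq i).1.
apply/seteqP; split=> v [v0 H]; split=> //.
  by move=> r /mapP[i _ ->]; rewrite (Hq i).2.
by move=> i; rewrite -(Hq i).2; apply: H; apply/mapP; exists i; rewrite ?mem_enum.
Qed.

Lemma proj_closed_fam n (I : finType) (f : I -> 'rV[K]_n -> K) :
  (forall i, exists d, hf d (f i)) -> proj_closed [set v | v != 0 /\ forall i, f i v = 0].
Proof.
move=> H; apply/proj_closedP; exists #|I|, (fun i => f (enum_val i)); split=> [i|]; first exact: H.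
apply/seteqP; split=> v [v0 Hv]; split=> // i.
by rewrite -(enum_rankK i); exact: Hv.
Qed.

Lemma proj_closedI n (Z W : set 'rV[K]_n) : proj_closed Z -> proj_closed W -> proj_closed (Z `&` W).
Proof.
move=> /proj_closedP[l [f [Hf ->]]] /proj_closedP[l' [g [Hg ->]]].
have := @proj_closed_fam n ('I_l + 'I_l')%type (fun i => match i with inl i => f i | inr i => g i end).
have -> : [set v | v != 0 /\ forall i : 'I_l + 'I_l', match i with inl i => f i | inr i => g i end v = 0]
   = [set v | v != 0 /\ forall i, f i v = 0] `&` [set v | v != 0 /\ forall i, g i v = 0].
  apply/seteqP; split=> v /=.
    by move=> [v0 H]; split; split=> // i; [exact: (H (inl i))|exact: (H (inr i))].
  by move=> [[v0 H] [_ H']]; split=> // -[i|i].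
by apply=> -[i|i].
Qed.

Lemma proj_closedU n (Z W : set 'rV[K]_n) : proj_closed Z -> proj_closed W -> proj_closed (Z `|` W).
Proof.
move=> /proj_closedP[l [f [Hf ->]]] /proj_closedP[l' [g [Hg ->]]].
have := @proj_closed_fam n ('I_l * 'I_l')%type (fun i v => f i.1 v * g i.2 v).
have -> : [set v | v != 0 /\ forall i : 'I_l * 'I_l', f i.1 v * g i.2 v = 0]
   = [set v | v != 0 /\ forall i, f i v = 0] `|` [set v | v != 0 /\ forall i, g i v = 0].
  apply/seteqP; split=> v /=.
    move=> [v0 H]; have [Hf0|/existsNP[i /eqP fi]] := EM (forall i, f i v = 0); first by left.
    right; split=> // j; have /eqP := H (i, j).
    by rewrite mulf_eq0 (negbTE fi) => /eqP.
  by move=> [] [v0 H]; split=> // i; rewrite H ?mul0r ?mulr0.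
by apply=> -[i j]; have [d Hd] := Hf i; have [e He] := Hg j; exists (d + e)%N; exact: hfM.
Qed.

Lemma qp_I n (X Y : set 'rV[K]_n) : quasi_projective X -> quasi_projective Y ->
  quasi_projective (X `&` Y).
Proof.
move=> [Z [W [cZ cW ->]]] [Z' [W' [cZ' cW' ->]]]; exists (Z `&` Z'), (W `|` W').
split; [exact: proj_closedI|exact: proj_closedU|].
apply/seteqP; split=> v; first by move=> [[? ?] [? ?]]; split=> // -[].
by move=> [[? ?] H]; split; split=> // ?; apply: H; [left|right].
Qed.

Lemma qp_closed n (Z : set 'rV[K]_n) : proj_closed Z -> quasi_projective Z.
Proof.
move=> cZ; exists Z, set0; split=> //; last by rewrite setD0.
apply/proj_closedP; exists 1%N, (fun _ _ => 1); split=> [i|].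
  by exists 0%N; exact: hf_cst.
by apply/seteqP; split=> // v [_ /(_ ord0)/eqP]; rewrite oner_eq0.
Qed.

Lemma qp_open n (W : set 'rV[K]_n) : proj_closed W -> quasi_projective ([set v | v != 0] `\` W).
Proof. by move=> cW; exists [set v | v != 0], W; split=> //; exact: proj_closed_all. Qed.

Lemma qp_nonzero n (X : set 'rV[K]_n) v : quasi_projective X -> X v -> v != 0.
Proof. by move=> [Z [W [[F _ ->] _ ->]]] [[]]. Qed.

Lemma qp_scale n (X : set 'rV[K]_n) v c : quasi_projective X -> c != 0 -> X v -> X (c *: v).
Proof.
have cl (Z : set 'rV[K]_n) w e : proj_closed Z -> e != 0 -> Z w -> Z (e *: w).
  move=> /proj_closedP[l [f [Hf ->]]] e0 [w0 Hw]; split; first by rewrite scaler_eq0 negb_or e0.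
  by move=> i; have [d Hd] := Hf i; rewrite (hf_scale _ _ Hd) Hw mulr0.
move=> [Z [W [cZ cW ->]]] c0 [Zv nWv]; split; first exact: cl.
by move=> /(cl _ _ c^-1 cW); rewrite invr_eq0 scalerA mulVf // scale1r => /(_ c0).
Qed.

Definition aclosed N (A : set 'rV[K]_N) := exists (l : nat) (f : 'I_l -> 'rV[K]_N -> K),
  (forall i, pf (f i)) /\ A = [set v | forall i, f i v = 0].

Definition lclosed N (S : set 'rV[K]_N) := exists A B, [/\ aclosed A, aclosed B & S = A `\` B].

Lemma chartK N (S : set 'rV[K]_N) v : affine_chart S (row_mx 1 v) <-> S v.
Proof.
rewrite /affine_chart /= row_mxKl row_mxKr mxE eqxx invr1 scale1r.
by split=> [[]|] //; split=> //; exact: oner_neq0.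
Qed.

Lemma lclosed_qp N (S : set 'rV[K]_N) : lclosed S -> quasi_projective (affine_chart S).
Proof.
move=> [A [B [[l [f [Hf ->]]] [l' [g [Hg ->]]] ->]]].
have hom (h : 'rV[K]_N -> K) : pf h -> exists D, exists F : 'rV[K]_(1 + N) -> K, hf D F /\
    forall w, lsubmx w 0 0 != 0 -> F w = lsubmx w 0 0 ^+ D * h ((lsubmx w 0 0)^-1 *: rsubmx w).
  by move=> /homogenize[D /(_ D (leqnn D))[F ? ?]]; exists D, F.
have /choice[Df /choice[Ff HFf]] := fun i => hom _ (Hf i).
have /choice[Dg /choice[Fg HFg]] := fun i => hom _ (Hg i).
(* The factor w_0 in the equations of the removed set takes away the hyperplane at infinity together
   with B. *)
exists [set w : 'rV[K]_(1 + N) | w != 0 /\ forall i, Ff i w = 0],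
  [set w : 'rV[K]_(1 + N) | w != 0 /\ forall i, w 0 (lshift N 0) * Fg i w = 0]; split.
- by apply: proj_closed_fam => i; exists (Df i); exact: (HFf i).1.
- apply: proj_closed_fam => i; exists (1 + Dg i)%N; apply: hfM (HFg i).1; exact: hf_coord.
have lE (w : 'rV[K]_(1 + N)) : lsubmx w 0 0 = w 0 (lshift N 0) by rewrite mxE.
apply/seteqP; split=> w /=.
  move=> [w0 [Hf0 Hg0]]; have wn0 : w != 0 by apply: contraNneq w0 => ->; rewrite !mxE.
  split; first by split=> // i; rewrite (HFf i).2 // Hf0 mulr0.
  move=> [_ H]; apply: Hg0 => i; have := H i; rewrite -lE (HFg i).2 // => /eqP.
  by rewrite !mulf_eq0 expf_eq0 (negbTE w0) andbF => /eqP.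
move=> [[wn0 Hf0] H]; have w0 : lsubmx w 0 0 != 0.
  by apply/eqP => w0; apply: H; split=> // i; rewrite -lE w0 mul0r.
split=> //; split=> [i|Hg0].
  by have := Hf0 i; rewrite (HFf i).2 // => /eqP; rewrite mulf_eq0 expf_eq0 (negbTE w0) andbF => /eqP.
by apply: H; split=> // i; rewrite (HFg i).2 // Hg0 !mulr0.
Qed.

Lemma pf_row_mx1 N i : pf (fun v : 'rV[K]_N => (row_mx 1 v : 'rV_(1 + N)) 0 i).
Proof.
case: (split_ordP i) => j ->.
  by apply: pf_ext (pf_cst _ ((1 : 'M_1) 0 j)) => v; rewrite row_mxEl.
by apply: pf_ext (pf_coord j) => v; rewrite row_mxEr.
Qed.

Lemma qp_lclosed N (X : set 'rV[K]_(1 + N)) : quasi_projective X -> lclosed [set v | X (row_mx 1 v)].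
Proof.
have cl (Z : set 'rV[K]_(1 + N)) : proj_closed Z -> aclosed [set v | Z (row_mx 1 v)].
  move=> /proj_closedP[l [f [Hf ->]]]; exists l, (fun i v => f i (row_mx 1 v)); split.
    by move=> i; have [d /hf_pf Hd] := Hf i; apply: (pf_comp Hd); exact: pf_row_mx1.
  apply/seteqP; split=> v /=; first by case.
  move=> H; split=> //; apply/eqP => /(congr1 (fun w : 'rV_(1 + N) => w 0 (lshift N 0))) /eqP.
  by rewrite row_mxEl !mxE oner_eq0.
move=> [Z [W [cZ cW ->]]]; exists [set v | Z (row_mx 1 v)], [set v | W (row_mx 1 v)].
by split; [exact: cl|exact: cl|].
Qed.

Definition dehom N (w : 'rV[K]_(1 + N)) : 'rV[K]_N := (lsubmx w 0 0)^-1 *: rsubmx w.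

Lemma rehom N (w : 'rV[K]_(1 + N)) : lsubmx w 0 0 != 0 ->
  row_mx 1 (dehom w) = (lsubmx w 0 0)^-1 *: w.
Proof.
have wE : lsubmx w 0 0 = w 0 (lshift N 0) by rewrite mxE.
rewrite /dehom wE => w0; apply/rowP => i; case: (split_ordP i) => a ->.
  rewrite row_mxEl (ord1 a) [RHS]mxE; by rewrite mulVf // mxE.
by rewrite row_mxEr !mxE.
Qed.

Lemma qp_chart N (X : set 'rV[K]_(1 + N)) : quasi_projective X ->
  (forall w, X w -> lsubmx w 0 0 != 0) -> X = affine_chart [set v | X (row_mx 1 v)].
Proof.
move=> qX X0.
apply/seteqP; split=> w /=.
  move=> Xw; have w0 := X0 _ Xw; split=> //=; rewrite (rehom w0).
  by apply: qp_scale => //; rewrite invr_eq0.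
move=> [w0 /=]; rewrite (rehom w0) => /(qp_scale qX w0).
by rewrite scalerA mulfV // scale1r.
Qed.

Lemma aclosed_preim a b (g : 'rV[K]_a -> 'rV[K]_b) A : (forall i, pf (fun v => g v 0 i)) ->
  aclosed A -> aclosed (g @^-1` A).
Proof.
move=> Hg [l [f [Hf ->]]]; exists l, (fun i => f i \o g); split=> //.
by move=> i; exact: pf_comp.
Qed.

Lemma lclosed_preim a b (g : 'rV[K]_a -> 'rV[K]_b) S : (forall i, pf (fun v => g v 0 i)) ->
  lclosed S -> lclosed (g @^-1` S).
Proof.
move=> Hg [A [B [cA cB ->]]]; exists (g @^-1` A), (g @^-1` B).
by split; [exact: aclosed_preim|exact: aclosed_preim|].
Qed.

Lemma lclosedI N (S T : set 'rV[K]_N) : lclosed S -> lclosed T -> lclosed (S `&` T).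
Proof.
move=> /lclosed_qp qS /lclosed_qp qT.
have := qp_lclosed (qp_I qS qT); congr lclosed.
by apply/seteqP; split=> v; rewrite /= !chartK.
Qed.

Lemma aclosed1 N (f : 'rV[K]_N -> K) : pf f -> aclosed [set v | f v = 0].
Proof.
move=> Hf; exists 1%N, (fun=> f); split=> //.
by apply/seteqP; split=> v /=; [move=> fv _|move=> /(_ ord0)].
Qed.

Lemma aclosed0 N : aclosed (@set0 'rV[K]_N).
Proof.
have -> : @set0 'rV[K]_N = [set v | (1 : K) = 0].
  by apply/seteqP; split=> // v /eqP; rewrite oner_eq0.
by apply: aclosed1; exact: pf_cst.
Qed.

Lemma aclosedT N : aclosed [set: 'rV[K]_N].
Proof.
have -> : [set: 'rV[K]_N] = [set v | (0 : K) = 0] by apply/seteqP; split.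
by apply: aclosed1; exact: pf_cst.
Qed.

Lemma lclosed_eq0 N (f : 'rV[K]_N -> K) : pf f -> lclosed [set v | f v = 0].
Proof.
by move=> Hf; exists [set v | f v = 0], set0; split; [exact: aclosed1|exact: aclosed0|rewrite setD0].
Qed.

Lemma lclosed_neq0 N (f : 'rV[K]_N -> K) : pf f -> lclosed [set v | f v <> 0].
Proof.
move=> Hf; exists setT, [set v | f v = 0]; split; [exact: aclosedT|exact: aclosed1|].
by apply/seteqP; split=> // v [].
Qed.

End PolyFun.

Section Classes.
Variable K : closedFieldType.
Local Notation K0 := (K0L K).

(** A total version of [cls], with the value 0 on sets that are not quasi-projective, so that sums
    of classes can be written for sets. *)
Definition clsP n (X : set 'rV[K]_n) : K0 :=
  if pselect (quasi_projective X) is left H then cls (QPVar H) else 0.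

Lemma cls_iso a b (X : qpvar K a) (Y : qpvar K b) : isomorphic X Y -> cls X = cls Y.
Proof. by move=> XY; apply/K0L_eqP; exact: keq_iso. Qed.

Lemma same_point_refl n (v : 'rV[K]_n) : same_point v v.
Proof. by exists 1; rewrite ?oner_neq0 // scale1r. Qed.

Lemma regular_hf a b d (X : set 'rV[K]_a) (Y : set 'rV[K]_b) (f g : 'rV[K]_a -> 'rV[K]_b) :
  (forall v, X v -> Y (f v)) -> (forall i, hf d (fun v => g v 0 i)) ->
  (forall v, X v -> same_point (f v) (g v)) -> regular_map X Y f.
Proof.
move=> fXY Hg fg; split=> // v Xv.
have /choice[p Hp] : forall i, exists p : {mpoly K[a]}, p \is d.-homog /\ forall v, ev p v = g v 0 i.
  by move=> i; have [p ? ?] := Hg i; exists p.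
exists 1, d, p; split.
- by exists 0%N; exact: dhomog1.
- by move=> i; exact: (Hp i).1.
- by rewrite /ev meval1 oner_neq0.
- move=> w Xw _; rewrite (_ : \row_i ev (p i) w = g w); first exact: fg.
  by apply/rowP => i; rewrite mxE (Hp i).2.
Qed.

Lemma regular_id n (X : set 'rV[K]_n) : regular_map X X id.
Proof.
apply: (@regular_hf _ _ 1 _ _ _ id) => // [i|v _]; first exact: hf_coord.
exact: same_point_refl.
Qed.

Lemma iso_refl n (X : set 'rV[K]_n) : isomorphic X X.
Proof.
exists id, id; split; [exact: regular_id|exact: regular_id|..] => v _; exact: same_point_refl.
Qed.

Lemma clsPE n (X : qpvar K n) : clsP X = cls X.
Proof.
rewrite /clsP; case: pselect => [H|[]]; last exact: qpsetP.
by apply: cls_iso; exact: iso_refl.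
Qed.

Lemma clsP_iso a b (X : set 'rV[K]_a) (Y : set 'rV[K]_b) :
  quasi_projective X -> quasi_projective Y -> isomorphic X Y -> clsP X = clsP Y.
Proof.
move=> qX qY XY; rewrite -[X]/(qpset (QPVar qX)) -[Y]/(qpset (QPVar qY)) !clsPE.
exact: cls_iso.
Qed.

Lemma qp_capD n (X Z : set 'rV[K]_n) : quasi_projective X -> proj_closed Z ->
  quasi_projective (X `&` Z) /\ quasi_projective (X `\` Z).
Proof.
move=> qX cZ; split; first by apply: qp_I => //; exact: qp_closed.
have -> : X `\` Z = X `&` ([set v | v != 0] `\` Z).
  by apply/seteqP; split=> v [Xv]; [move=> ?; split=> //; split=> //; exact: qp_nonzero Xv|case].
by apply: qp_I => //; exact: qp_open.
Qed.

Lemma scissor n (X Z : set 'rV[K]_n) : quasi_projective X -> proj_closed Z ->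
  clsP X = clsP (X `&` Z) + clsP (X `\` Z).
Proof.
move=> qX cZ; have [q1 q2] := qp_capD qX cZ.
rewrite -[X in LHS]/(qpset (QPVar qX)) -[_ `&` _]/(qpset (QPVar q1)) -[_ `\` _]/(qpset (QPVar q2)).
rewrite !clsPE; apply: etrans (esym (K0L_pi_add _ _)); apply/K0L_eqP.
by apply: keq_scissor => /=; [exists Z|apply/seteqP; split=> v [Xv H]; split=> //; [move=> []|move=> Zv; apply: H]].
Qed.

Lemma clsP0 n : clsP (@set0 'rV[K]_n) = 0.
Proof.
have q0 : quasi_projective (@set0 'rV[K]_n).
  exists [set v | v != 0], [set v | v != 0]; split; [exact: proj_closed_all..|].
  by rewrite setDv.
have := scissor q0 (proj_closed_all K n); rewrite set0I set0D.
by move=> H; apply: (addrI (clsP set0)); rewrite addr0; exact: esym H.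
Qed.

(* Induction on the number of closed sets needed to tell the pieces apart. *)
Lemma cls_partition n r (C : nat -> set 'rV[K]_n) (X : set 'rV[K]_n) l (Y : 'I_l -> set 'rV[K]_n) :
  (forall c, (c < r)%N -> proj_closed (C c)) -> quasi_projective X ->
  (forall i, quasi_projective (Y i)) -> trivIset setT Y -> X = \bigcup_(i in setT) Y i ->
  (forall i v w, X v -> X w -> (forall c, (c < r)%N -> C c v <-> C c w) -> Y i v -> Y i w) ->
  clsP X = \sum_i clsP (Y i).
Proof.
elim: r C X Y => [|r IH] C X Y cC qX qY tY XE sat.
  have [[v Xv]|X0] := EM (exists v, X v); last first.
    have E (Z : set 'rV[K]_n) : (forall v, Z v -> X v) -> Z = set0.
      by move=> ZX; apply/seteqP; split=> // v /ZX Xv; case: X0; exists v.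
    rewrite (E X) // clsP0 big1 // => i _; rewrite (E (Y i)) ?clsP0 // => v Yv.
    by rewrite XE; exists i.
  have [i _ Yiv] : (\bigcup_(i in setT) Y i) v by rewrite -XE.
  (* With no closed set left to separate its points, X lies in a single piece. *)
  have XY : X = Y i.
    apply/seteqP; split=> w Hw; last by rewrite XE; exists i.
    by apply: sat Yiv.
  rewrite (bigD1 i) //= -XY big1 ?addr0 // => j ji.
  rewrite (_ : Y j = set0) ?clsP0 //; apply/seteqP; split=> // w Yjw.
  have Xw : X w by rewrite XE; exists j.
  move/eqP: ji; case; apply: (tY _ _ I I); exists w; split=> //.
  by rewrite -XY.
have cr := cC r (ltnSn r).
have [qX1 qX2] := qp_capD qX cr.
rewrite (scissor qX cr) (eq_bigr (fun i => clsP (Y i `&` C r) + clsP (Y i `\` C r))); last first.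
  by move=> i _; exact: scissor.
rewrite big_split /=; congr (_ + _); apply: (IH C) => //.
- by move=> c cr'; apply: cC; exact: leqW.
- by move=> i; have [] := qp_capD (qY i) cr.
- by move=> i j _ _ [v [[Yv _] [Yv' _]]]; apply: tY => //; exists v.
- by rewrite XE setI_bigcupl.
- move=> i v w [Xv Cv] [Xw Cw] H [Yv _]; split=> //; apply: sat Yv => // c.
  by rewrite ltnS leq_eqVlt => /orP[/eqP->|/H].
- by move=> c cr'; apply: cC; exact: leqW.
- by move=> i; have [] := qp_capD (qY i) cr.
- by move=> i j _ _ [v [[Yv _] [Yv' _]]]; apply: tY => //; exists v.
- apply/seteqP; split=> v.
    by move=> [+ nC]; rewrite {1}XE => -[i _ Yv]; exists i.
  by move=> [i _ [Yv nC]]; split=> //; rewrite XE; exists i.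
- move=> i v w [Xv Cv] [Xw Cw] H [Yv _]; split=> //; apply: sat Yv => // c.
  by rewrite ltnS leq_eqVlt => /orP[/eqP->|/H].
Qed.

Lemma cls_family n l (Y : 'I_l -> set 'rV[K]_n) (X : set 'rV[K]_n) :
  quasi_projective X -> (forall i, quasi_projective (Y i)) -> trivIset setT Y ->
  X `<=` \bigcup_(i in setT) Y i -> clsP X = \sum_i clsP (X `&` Y i).
Proof.
move=> qX qY tY XY.
have /choice[Z /choice[W HZW]] : forall i, exists Z W, [/\ proj_closed Z, proj_closed W & Y i = Z `\` W].
  by move=> i; have [Z [W ?]] := qY i; exists Z, W.
(* The closed sets Z_i and W_i of Y_i = Z_i \ W_i, interleaved as C (2 i) and C (2 i + 1). *)
pose C c : set 'rV[K]_n := if insub c./2 is Some i then (if odd c then W i else Z i) else set0.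
apply: (@cls_partition _ l.*2 C) => //.
- move=> c cl; rewrite /C; case: insubP => [i _ _|]; last by rewrite ltn_half_double cl.
  by have [? ?] := HZW i; case: ifP.
- by move=> i; exact: qp_I.
- by move=> i j _ _ [v [[_ Yv] [_ Yv']]]; apply: tY => //; exists v.
- apply/seteqP; split=> v; last by move=> [i _ []].
  by move=> Xv; have [i _ Yv] := XY v Xv; exists i.
- move=> i v w Xv Xw H [_ Yv]; split=> //; move: Yv; have [_ _ ->] := HZW i.
  have Hi : (i < l)%N := ltn_ord i.
  have := H i.*2; have := H i.*2.+1; rewrite /C /= uphalf_double doubleK odd_double /=.
  rewrite ltn_Sdouble ltn_double Hi.
  rewrite insubT /=; rewrite (_ : Sub _ _ = i) => [HW HZ|]; last exact: val_inj.
  by move=> [Zv Wv]; split; [apply/(HZ isT)|move=> /(HW isT)].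
Qed.

(** Both sides equal the sum over the common refinement. This makes the class of a constructible set
    independent of its decomposition. *)
Lemma cls_family_uniq n l l' (X : 'I_l -> set 'rV[K]_n) (Y : 'I_l' -> set 'rV[K]_n) :
  (forall i, quasi_projective (X i)) -> (forall i, quasi_projective (Y i)) ->
  trivIset setT X -> trivIset setT Y ->
  \bigcup_(i in setT) X i = \bigcup_(i in setT) Y i ->
  \sum_i clsP (X i) = \sum_i clsP (Y i).
Proof.
move=> qX qY tX tY XY.
transitivity (\sum_i \sum_j clsP (X i `&` Y j)).
  apply: eq_bigr => i _; apply: cls_family => //.
  by rewrite -XY => v Xv; exists i.
rewrite exchange_big /=; apply: eq_bigr => j _.
under eq_bigr => i _ do rewrite setIC.
symmetry; apply: cls_family => //.
by rewrite XY => v Yv; exists j.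
Qed.

(** The matrices of rank one are cut out by the 2 x 2 minors. Columns are multiples of v and rows
    are multiples of w, so the equations of the closed sets are imposed on all columns and rows. All
    products of an equation of W1 and one of W2 vanish exactly when v lies in W1 or w in W2. *)
Lemma segre_closed a b (X : set 'rV[K]_a) (Y : set 'rV[K]_b) :
  quasi_projective X -> quasi_projective Y -> quasi_projective (segre X Y).
Proof.
move=> [Z1 [W1 [/proj_closedP[l1 [f1 [Hf1 ->]]] /proj_closedP[m1 [g1 [Hg1 ->]]] ->]]].
move=> [Z2 [W2 [/proj_closedP[l2 [f2 [Hf2 ->]]] /proj_closedP[m2 [g2 [Hg2 ->]]] ->]]].
pose col_ (z : 'rV[K]_(a * b)) j : 'rV[K]_a := \row_i z 0 (mxvec_index i j).
pose row_ (z : 'rV[K]_(a * b)) i : 'rV[K]_b := \row_j z 0 (mxvec_index i j).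
have hcol d f j : hf d f -> hf d (fun z => f (col_ z j)).
  move=> Hf; rewrite -[d]muln1; apply: (@hf_comp _ _ _ d 1 f (fun z => col_ z j)) => // i.
  by apply: hf_ext (@hf_coord K _ (mxvec_index i j)) => z; rewrite mxE.
have hrow d f i : hf d f -> hf d (fun z => f (row_ z i)).
  move=> Hf; rewrite -[d]muln1; apply: (@hf_comp _ _ _ d 1 f (fun z => row_ z i)) => // j.
  by apply: hf_ext (@hf_coord K _ (mxvec_index i j)) => z; rewrite mxE.
pose I1 : finType := ((('I_a * 'I_b) * ('I_a * 'I_b)) + (('I_l1 * 'I_b) + ('I_l2 * 'I_a)))%type.
pose F (t : I1) (z : 'rV[K]_(a * b)) : K := match t with
  | inl p => z 0 (mxvec_index p.1.1 p.1.2) * z 0 (mxvec_index p.2.1 p.2.2)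
             - z 0 (mxvec_index p.1.1 p.2.2) * z 0 (mxvec_index p.2.1 p.1.2)
  | inr (inl p) => f1 p.1 (col_ z p.2)
  | inr (inr p) => f2 p.1 (row_ z p.2) end.
pose G (t : ('I_m1 * 'I_b) * ('I_m2 * 'I_a)) (z : 'rV[K]_(a * b)) : K :=
  g1 t.1.1 (col_ z t.1.2) * g2 t.2.1 (row_ z t.2.2).
exists [set z | z != 0 /\ forall t, F t z = 0], [set z | z != 0 /\ forall t, G t z = 0]; split.
- apply: proj_closed_fam => -[p|[p|p]] /=.
  + exists (1 + 1)%N; apply: hfD; first by apply: hfM; exact: hf_coord.
    apply: (@hf_ext _ _ _ (fun z => -1 * (z 0 (mxvec_index p.1.1 p.2.2) * z 0 (mxvec_index p.2.1 p.1.2)))).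
      by move=> z; rewrite mulN1r.
    by apply: hfZ; apply: hfM; exact: hf_coord.
  + by have [d Hd] := Hf1 p.1; exists d; exact: hcol.
  + by have [d Hd] := Hf2 p.1; exists d; exact: hrow.
- apply: proj_closed_fam => -[p q] /=; have [d Hd] := Hg1 p.1; have [e He] := Hg2 q.1.
  by exists (d + e)%N; apply: hfM; [exact: hcol|exact: hrow].
have colE (v : 'rV[K]_a) (w : 'rV[K]_b) j : col_ (mxvec (v^T *m w)) j = w 0 j *: v.
  by apply/rowP => i; rewrite !mxE mxvecE mxE big_ord1 !mxE mulrC.
have rowE (v : 'rV[K]_a) (w : 'rV[K]_b) i : row_ (mxvec (v^T *m w)) i = v 0 i *: w.
  by apply/rowP => j; rewrite !mxE mxvecE mxE big_ord1 !mxE.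
have nz n (v : 'rV[K]_n) : v != 0 -> exists i, v 0 i != 0.
  by move/rV0Pn.
apply/seteqP; split=> z.
  move=> [v [w [[[v0 Hv] nW1] [[w0 Hw] nW2] ->]]].
  have [i0 vi0] := nz _ _ v0; have [j0 wj0] := nz _ _ w0.
  have z0 : mxvec (v^T *m w) != 0.
    apply/eqP => /(congr1 (fun z : 'rV_(a * b) => z 0 (mxvec_index i0 j0))) /eqP.
    by rewrite mxvecE mxE big_ord1 !mxE mulf_eq0 (negbTE vi0) (negbTE wj0).
  split; first split=> // -[p|[p|p]] /=.
  - by rewrite !mxvecE !mxE !big_ord1 !mxE; ring.
  - by rewrite colE; have [d Hd] := Hf1 p.1; rewrite (hf_scale _ _ Hd) Hv mulr0.
  - by rewrite rowE; have [d Hd] := Hf2 p.1; rewrite (hf_scale _ _ Hd) Hw mulr0.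
  move=> [_ HG]; have /existsNP[p /eqP gp] : ~ forall p, g1 p v = 0 by move=> H; apply: nW1.
  have /existsNP[q /eqP gq] : ~ forall q, g2 q w = 0 by move=> H; apply: nW2.
  have /eqP := HG ((p, j0), (q, i0)); rewrite /G /= colE rowE.
  have [d Hd] := Hg1 p; have [e He] := Hg2 q; rewrite (hf_scale _ _ Hd) (hf_scale _ _ He).
  by rewrite !mulf_eq0 !expf_eq0 (negbTE gp) (negbTE gq) (negbTE vi0) (negbTE wj0) !andbF.
move=> [[z0 HF] nG].
have [k zk] := nz _ _ z0; case/mxvec_indexP: k zk => i0 j0 zk.
(* A matrix of rank one is the product of a column and a row through a nonzero entry, divided by
   that entry. *)
have zE : z = mxvec ((col_ z j0)^T *m ((z 0 (mxvec_index i0 j0))^-1 *: row_ z i0)).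
  apply/rowP => k; case/mxvec_indexP: k => i j; rewrite mxvecE mxE big_ord1 !mxE.
  have /eqP := HF (inl ((i, j), (i0, j0))); rewrite /= subr_eq0 => /eqP H.
  by rewrite mulrCA -H mulrCA mulVf // mulr1.
set v := col_ z j0 in zE; set w := _ *: row_ z i0 in zE.
have v0 : v != 0.
  by apply/eqP => /(congr1 (fun v : 'rV_a => v 0 i0)) /eqP; rewrite !mxE (negbTE zk).
have w0 : w != 0.
  apply/eqP => /(congr1 (fun v : 'rV_b => v 0 j0)) /eqP; rewrite !mxE.
  by rewrite mulf_eq0 invr_eq0 (negbTE zk).
exists v, w; split=> //.
- split; first by split=> // i; exact: (HF (inr (inl (i, j0)))).
  move=> [_ Hg]; apply: nG; split=> // -[[p j] [q i]]; rewrite /G /= {1}zE colE.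
  by have [d Hd] := Hg1 p; rewrite (hf_scale _ _ Hd) Hg mulr0 mul0r.
- have sc h : (exists d, hf d h) -> h w = 0 <-> h (row_ z i0) = 0.
    move=> [d Hd]; rewrite (hf_scale _ _ Hd); split=> [/eqP|->]; last by rewrite mulr0.
    by rewrite mulf_eq0 expf_eq0 invr_eq0 (negbTE zk) andbF => /eqP.
  split; first by split=> // i; apply/(sc _ (Hf2 i)); exact: (HF (inr (inr (i, i0)))).
  move=> [_ Hg]; apply: nG; split=> // -[[p j] [q i]]; rewrite /G /= {2}zE rowE.
  by have [d Hd] := Hg2 q; rewrite (hf_scale _ _ Hd) Hg !mulr0.
Qed.

Lemma clsP_segre a b (X : set 'rV[K]_a) (Y : set 'rV[K]_b) :
  quasi_projective X -> quasi_projective Y -> clsP (segre X Y) = clsP X * clsP Y.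
Proof.
move=> qX qY; have qXY := segre_closed qX qY.
rewrite -[segre X Y]/(qpset (QPVar qXY)) -[X in RHS]/(qpset (QPVar qX)) -[Y in RHS]/(qpset (QPVar qY)) !clsPE.
apply: esym; apply: etrans (K0L_pi_mul _ _) _; apply/K0L_eqP.
exact: keq_prod.
Qed.

End Classes.

(** * Classes of subsets of affine space *)

Section AffineClasses.
Variable K : closedFieldType.
Local Notation K0 := (K0L K).
Local Notation Lef := (Lef K).

Definition clsA N (S : set 'rV[K]_N) : K0 := clsP (affine_chart S).

Definition rational_on N M (S : set 'rV[K]_N) (f : 'rV[K]_N -> 'rV[K]_M) :=
  exists (h : 'rV[K]_N -> K) (P : 'rV[K]_N -> 'rV[K]_M),
    [/\ pf h, forall i, pf (fun v => P v 0 i), forall v, S v -> h v != 0 &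
        forall v, S v -> h v *: f v = P v].

Lemma rational_poly N M (S : set 'rV[K]_N) (f : 'rV[K]_N -> 'rV[K]_M) :
  (forall i, pf (fun v => f v 0 i)) -> rational_on S f.
Proof.
move=> Hf; exists (fun=> 1), f; split=> // [|v _|v _]; first exact: pf_cst.
  exact: oner_neq0.
by rewrite scale1r.
Qed.

Lemma dehom_row N (v : 'rV[K]_N) : dehom (row_mx 1 v) = v.
Proof. by rewrite /dehom row_mxKl row_mxKr mxE eqxx invr1 scale1r. Qed.

Lemma regular_affine N M (S : set 'rV[K]_N) (T : set 'rV[K]_M) f : rational_on S f ->
  (forall v, S v -> T (f v)) ->
  regular_map (affine_chart S) (affine_chart T) (fun w => row_mx 1 (f (dehom w))).
Proof.
move=> [h [P [ph pP h0 hP]]] fST.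
have [Dh HDh] := homogenize ph; have HPex (i : 'I_M) : exists D0, forall D, (D0 <= D)%N ->
    exists2 F : 'rV[K]_(1 + N) -> K, hf D F & forall w, lsubmx w 0 0 != 0 ->
      F w = lsubmx w 0 0 ^+ D * P ((lsubmx w 0 0)^-1 *: rsubmx w) 0 i.
  exact: homogenize (pP i).
have [DP HDP] := choice HPex.
pose D := maxn Dh (\max_i DP i).
have [H hH HE] := HDh D (leq_maxl _ _).
have HQex (i : 'I_M) : exists Q : 'rV[K]_(1 + N) -> K, hf D Q /\ forall w, lsubmx w 0 0 != 0 ->
    Q w = lsubmx w 0 0 ^+ D * P ((lsubmx w 0 0)^-1 *: rsubmx w) 0 i.
  have [|Q ? ?] := HDP i D; last by exists Q.
  by rewrite leq_max (leq_bigmax i) orbT.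
have [Q HQ] := choice HQex.
pose g (w : 'rV[K]_(1 + N)) : 'rV[K]_(1 + M) := row_mx (\row_(_ < 1) H w) (\row_i Q i w).
apply: (@regular_hf K _ _ D _ _ _ g).
- by move=> w [w0 Sw]; apply/chartK; exact: fST.
- move=> i; case: (split_ordP i) => j ->.
    by apply: hf_ext hH => w; rewrite /g row_mxEl mxE.
  by apply: hf_ext (HQ j).1 => w; rewrite /g row_mxEr mxE.
move=> w [w0 Sw]; pose c := lsubmx w 0 0 ^+ D * h (dehom w).
have c0 : c != 0 by rewrite mulf_neq0 ?expf_neq0 // h0.
exists c^-1; first by rewrite invr_eq0.
apply/rowP => i; case: (split_ordP i) => j ->.
  by rewrite [RHS]mxE /g !row_mxEl (ord1 j) !mxE HE // mulVf.
rewrite [RHS]mxE /g !row_mxEr mxE (HQ j).2 // -/(dehom w) -hP //.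
by rewrite [X in _ ^+ D * X]mxE (mulrA (_ ^+ _)) mulKf.
Qed.

Lemma clsA_iso N M (S : set 'rV[K]_N) (T : set 'rV[K]_M) f g : lclosed S -> lclosed T ->
  rational_on S f -> rational_on T g ->
  (forall v, S v -> T (f v)) -> (forall v, T v -> S (g v)) ->
  (forall v, S v -> g (f v) = v) -> (forall v, T v -> f (g v) = v) -> clsA S = clsA T.
Proof.
move=> lS lT rf rg fST gTS gf fg; apply: clsP_iso; [exact: lclosed_qp..|].
exists (fun w => row_mx 1 (f (dehom w))), (fun w => row_mx 1 (g (dehom w))); split.
- exact: regular_affine.
- exact: regular_affine.
- move=> w [w0 Sw]; rewrite dehom_row gf // rehom //; exists (lsubmx w 0 0)^-1 => //; by rewrite invr_eq0.
- move=> w [w0 Tw]; rewrite dehom_row fg // rehom //; exists (lsubmx w 0 0)^-1 => //; by rewrite invr_eq0.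
Qed.

Lemma clsA0 N : clsA (@set0 'rV[K]_N) = 0.
Proof.
rewrite /clsA (_ : affine_chart _ = set0) ?clsP0 //.
by apply/seteqP; split=> // w [].
Qed.

Lemma lclosed_point N : lclosed [set 0 : 'rV[K]_N].
Proof.
exists [set 0], set0; split; [|exact: aclosed0|by rewrite setD0].
exists N, (fun i v => v 0 i); split=> [i|]; first exact: pf_coord.
apply/seteqP; split=> v /=; first by move=> -> i; rewrite mxE.
by move=> H; apply/rowP => i; rewrite mxE.
Qed.

Lemma clsA_point N : clsA [set 0 : 'rV[K]_N] = 1.
Proof.
rewrite (@clsA_iso N 0 _ [set 0] (fun=> 0) (fun=> 0)) //; try exact: lclosed_point.
- transitivity (clsP (qpset (point K))); last first.
    by rewrite clsPE; apply/K0L_eqP; exact: keq_point.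
  congr clsP; apply/seteqP; split=> w /=.
    by move=> [w0 _]; apply: contraNneq w0 => ->; rewrite !mxE.
  move=> w0; split; last by rewrite thinmx0.
  apply: contraNneq w0 => w0; apply/eqP/rowP => i; rewrite (ord1 i) mxE -w0 mxE.
  by congr (w _ _); apply: val_inj.
- by apply: rational_poly => i; apply: pf_ext (@pf_cst K _ 0) => v; rewrite mxE.
- by apply: rational_poly => i; apply: pf_ext (@pf_cst K _ 0) => v; rewrite mxE.
Qed.

Definition zero_at N (i : 'I_N) (v : 'rV[K]_N) : 'rV[K]_N := v - v 0 i *: delta_mx 0 i.

Lemma zero_atE N (i : 'I_N) (v : 'rV[K]_N) j : zero_at i v 0 j = if j == i then 0 else v 0 j.
Proof.
rewrite !mxE eqxx /=; case: eqP => [->|_]; first by rewrite mulr1 subrr.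
by rewrite mulr0 subr0.
Qed.

Lemma pf_zero_at N (i j : 'I_N) : pf (fun v : 'rV[K]_N => zero_at i v 0 j).
Proof.
case: (eqVneq j i) => [ji|ji].
  by apply: pf_ext (@pf_cst K _ 0) => v; rewrite zero_atE ji eqxx.
by apply: pf_ext (@pf_coord K N j) => v; rewrite zero_atE (negbTE ji).
Qed.

Lemma zero_at_id N (i : 'I_N) (v : 'rV[K]_N) : v 0 i = 0 -> zero_at i v = v.
Proof. by move=> vi; rewrite /zero_at vi scale0r subr0. Qed.

Lemma zero_at_add N (i : 'I_N) (v : 'rV[K]_N) c : zero_at i (v + c *: delta_mx 0 i) = zero_at i v.
Proof.
apply/rowP => j; rewrite !zero_atE !mxE eqxx /=; case: eqP => // _.
by rewrite mulr0 addr0.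
Qed.

Lemma zero_atK N (i : 'I_N) (v : 'rV[K]_N) : zero_at i v + v 0 i *: delta_mx 0 i = v.
Proof. by rewrite subrK. Qed.

(** Sets with undetermined coordinates are kept in one fixed space K^N by setting these coordinates
    to 0. For S in the hyperplane v_i = 0, [cyl i S] is S times the line. *)
Definition cyl N (i : 'I_N) (S : set 'rV[K]_N) : set 'rV[K]_N := [set v | S (zero_at i v)].

Lemma lclosed_cyl N (i : 'I_N) (S : set 'rV[K]_N) : lclosed S -> lclosed (cyl i S).
Proof. by apply: lclosed_preim => j; exact: pf_zero_at. Qed.

(* A point z of the Segre product of S with the affine line corresponds to the
   point of the cylinder with coordinates z_(j, 0), except for z_(o, 1) instead
   of the vanishing z_(c, 0). *)
Lemma clsA_cyl N (i : 'I_N) (S : set 'rV[K]_N) : lclosed S -> (forall v, S v -> v 0 i = 0) ->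
  clsA (cyl i S) = clsA S * Lef.
Proof.
move=> lS S0; have qS := lclosed_qp lS; have qA := qp_affine_line K.
rewrite -[Lef]clsPE -(clsP_segre qS qA).
apply: clsP_iso; [exact/lclosed_qp/lclosed_cyl|exact: segre_closed|].
pose o : 'I_(1 + N) := lshift N 0; pose c : 'I_(1 + N) := rshift 1 i.
pose u (w : 'rV[K]_(1 + N)) : 'rV[K]_(1 + 1) := \row_j (if j == 0 then w 0 o else w 0 c).
pose f (w : 'rV[K]_(1 + N)) : 'rV[K]_((1 + N) * (1 + 1)) := mxvec ((zero_at c w)^T *m u w).
pose g (z : 'rV[K]_((1 + N) * (1 + 1))) : 'rV[K]_(1 + N) :=
  \row_a z 0 (mxvec_index a 0) + z 0 (mxvec_index o 1) *: delta_mx 0 c.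
have oc : o == c = false by rewrite eq_lrshift.
have lE (w : 'rV[K]_(1 + N)) : lsubmx w 0 0 = w 0 o by rewrite mxE.
have lE1 (w : 'rV[K]_(1 + 1)) : lsubmx w 0 0 = w 0 0.
  by rewrite mxE; congr (w _ _); apply: val_inj.
have zS (w : 'rV[K]_(1 + N)) : dehom (zero_at c w) = zero_at i (dehom w).
  apply/rowP => j; rewrite zero_atE /dehom !lE [LHS]mxE [rsubmx _ _ _]mxE !zero_atE oc.
  rewrite (inj_eq (@rshift_inj _ _)) !mxE; case: eqP => // _; by rewrite mulr0.
have gadd (v : 'rV[K]_(1 + N)) (a b : K) : a != 0 -> affine_chart S v ->
    affine_chart (cyl i S) (a *: v + b *: delta_mx 0 c).
  move=> a0 [v0 Sv]; rewrite /affine_chart /= lE; set w := a *: v + b *: delta_mx 0 c.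
  have wo : w 0 o = a * v 0 o by rewrite /w !mxE oc andbF mulr0 addr0.
  split; first by rewrite wo mulf_neq0 // -lE.
  rewrite /cyl /= -lE -/(dehom w) -zS.
  have -> : zero_at c w = a *: zero_at c v.
    rewrite /w zero_at_add; apply/rowP => j; rewrite zero_atE [RHS]mxE zero_atE mxE.
    by case: eqP; rewrite ?mulr0.
  have -> : dehom (a *: zero_at c v) = dehom (zero_at c v).
    rewrite /dehom; apply/rowP => j; rewrite !mxE invfM mulrACA mulVf ?mul1r //.
  by rewrite zS zero_at_id // S0.
exists f, g; split.
- apply: (@regular_hf K _ _ 2 _ _ _ f) => [w [w0 Sw]|k|w _]; last exact: same_point_refl.
    exists (zero_at c w), (u w); split=> //.
      split; first by rewrite lE zero_atE oc -lE.
      by change (S (dehom (zero_at c w))); rewrite zS.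
    split=> //; by rewrite mxE mxE /= -lE.
  case/mxvec_indexP: k => a b.
  apply: (@hf_ext _ _ _ (fun w => zero_at c w 0 a * u w 0 b)).
    by move=> w; rewrite /f mxvecE [RHS]mxE big_ord1 [in RHS]mxE.
  apply: (@hfM _ _ 1 1).
    case: (eqVneq a c) => ac.
      by apply: hf_ext (hf0 _ _ 1) => w; rewrite zero_atE ac eqxx.
    by apply: hf_ext (@hf_coord K _ a) => w; rewrite zero_atE (negbTE ac).
  case: (eqVneq b 0) => b0.
    by apply: hf_ext (@hf_coord K _ o) => w; rewrite mxE b0.
  by apply: hf_ext (@hf_coord K _ c) => w; rewrite mxE (negbTE b0).
- apply: (@regular_hf K _ _ 1 _ _ _ g) => [z [v [w [Sv [w0 _] ->]]]|a|z _]; last exact: same_point_refl.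
    rewrite /g; have -> : \row_a mxvec (v^T *m w) 0 (mxvec_index a 0) = w 0 0 *: v.
      by apply/rowP => a; rewrite mxE mxvecE mxE big_ord1 !mxE mulrC.
    by apply: gadd => //; rewrite -lE1.
  apply: (@hf_ext _ _ _ (fun z => z 0 (mxvec_index a 0) + (delta_mx 0 c : 'rV[K]_(1 + N)) 0 a * z 0 (mxvec_index o 1))).
    by move=> z; rewrite !mxE mulrC.
  by apply: hfD; [exact: hf_coord|apply: hfZ; exact: hf_coord].
- move=> w [w0 _]; exists (w 0 o); first by rewrite -lE.
  apply/rowP => a; rewrite !mxE !mxvecE !mxE !big_ord1 !mxE !eqxx /=.
  by case: eqP => [->|_]; ring.
- move=> z [v [w [[v0 Sv] [w0 _] ->]]].
  have w00 : w 0 0 != 0 by rewrite -lE1.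
  have vo : v 0 o != 0 by rewrite -lE.
  have vc : v 0 c = 0.
    have := S0 _ Sv; rewrite !mxE => /eqP; rewrite mulf_eq0 invr_eq0.
    by rewrite -[v 0 (lshift N 0)]/(v 0 o) (negbTE vo) => /eqP.
  exists (w 0 0 * v 0 o); first by rewrite mulf_neq0.
  have gE : g (mxvec (v^T *m w)) = w 0 0 *: v + (v 0 o * w 0 1) *: delta_mx 0 c.
    apply/rowP => a; rewrite !mxE !mxvecE !mxE !big_ord1 !mxE; ring.
  rewrite /f gE; apply/rowP => k; case/mxvec_indexP: k => a b.
  rewrite mxvecE [LHS]mxE big_ord1 [RHS]mxE mxvecE [(v^T *m w) a b]mxE big_ord1.
  rewrite mxE zero_at_add zero_atE [u _ _ _]mxE !mxE oc !eqxx /= !mulr0 !addr0 vc !mulr0 add0r mulr1.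
  case: (eqVneq a c) => [->|_]; first by rewrite vc !mul0r mulr0.
  case: (eqVneq b 0) => [->|b0]; first by ring.
  have -> : b = 1 by apply: val_inj; case: b b0 => -[|[|]].
  by ring.
Qed.

End AffineClasses.

(** * Constructible sets and uniqueness of the motivic measure *)

Section Constructible.
Variable K : closedFieldType.
Local Notation K0 := (K0L K).
Local Notation Lef := (Lef K).

Lemma affine_chart_bigcup N (I : Type) (T : I -> set 'rV[K]_N) :
  affine_chart (\bigcup_(i in setT) T i) = \bigcup_(i in setT) affine_chart (T i).
Proof.
apply/seteqP; split=> w; first by move=> [w0 [i _ Ti]]; exists i.
by move=> [i _ [w0 Ti]]; split=> //; exists i.
Qed.

Lemma trivIset_chart N (I : Type) (T : I -> set 'rV[K]_N) :
  trivIset setT T -> trivIset setT (fun i => affine_chart (T i)).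
Proof. by move=> tT i j _ _ [w [[_ Ti] [_ Tj]]]; apply: tT => //; eexists; split; eassumption. Qed.

Lemma constructible_pieces N (S : set 'rV[K]_N) a : constructible_class S a ->
  exists (l : nat) (T : 'I_l -> set 'rV[K]_N), [/\ forall i, lclosed (T i), trivIset setT T,
    S = \bigcup_(i in setT) T i & a = \sum_i clsA (T i)].
Proof.
move=> [l [X [tX SX ->]]]; exists l, (fun i => [set v | qpset (X i) (row_mx 1 v)]); split.
- by move=> i; apply: qp_lclosed; exact: qpsetP.
- by move=> i j _ _ [v [Xi Xj]]; apply: tX => //; eexists; split; eassumption.
- apply/seteqP; split=> v.
    by move=> /chartK; rewrite SX => -[i _ Xi]; exists i.
  by move=> [i _ Xi]; apply/chartK; rewrite SX; exists i.
- apply: eq_bigr => i _; rewrite /clsA -qp_chart ?clsPE //; first exact: qpsetP.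
  by move=> w Xw; have [] : affine_chart S w by rewrite SX; exists i.
Qed.

Lemma constructible_bigcup N (I : finType) (T : I -> set 'rV[K]_N) : (forall i, lclosed (T i)) ->
  trivIset setT T -> constructible_class (\bigcup_(i in setT) T i) (\sum_i clsA (T i)).
Proof.
move=> lT tT; exists #|I|, (fun i => QPVar (lclosed_qp (lT (enum_val i)))); split=> /=.
- move=> i j _ _ H; apply: enum_val_inj.
  exact: (trivIset_chart tT) H.
- rewrite affine_chart_bigcup; apply/seteqP; split=> w [i _ Ti]; last by exists (enum_val i).
  by exists (enum_rank i); rewrite //= enum_rankK.
rewrite (big_enum_val (fun i => clsA (T i))) /=.
by apply: eq_bigr => i _; rewrite -clsPE.
Qed.

Lemma constructible_uniq N (S : set 'rV[K]_N) a b :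
  constructible_class S a -> constructible_class S b -> a = b.
Proof.
move=> [l [X [tX SX ->]]] [l' [Y [tY SY ->]]].
under eq_bigr do rewrite -clsPE; under [RHS]eq_bigr do rewrite -clsPE.
by apply: cls_family_uniq => // [i|i|]; [exact: qpsetP|exact: qpsetP|rewrite -SX].
Qed.

Lemma constructible_lclosed N (S : set 'rV[K]_N) : lclosed S -> constructible_class S (clsA S).
Proof.
move=> lS; have := @constructible_bigcup N unit (fun=> S) (fun=> lS).
have -> : \bigcup_(i in [set: unit]) S = S.
  by apply/seteqP; split=> v; [case|exists tt].
by rewrite big_const card_unit /= addr0; apply=> -[] [].
Qed.

Lemma constructible0 N : constructible_class (@set0 'rV[K]_N) 0.
Proof.
rewrite -(clsA0 K N); apply: constructible_lclosed.
by exists set0, set0; split; [exact: aclosed0|exact: aclosed0|rewrite setD0].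
Qed.

Lemma constructibleU N (A B : set 'rV[K]_N) a b : constructible_class A a ->
  constructible_class B b -> A `&` B = set0 -> constructible_class (A `|` B) (a + b).
Proof.
move=> /constructible_pieces[l [S [lS tS AE ->]]] /constructible_pieces[l' [T [lT tT BE ->]]] AB.
pose U (i : 'I_l + 'I_l') := match i with inl i => S i | inr j => T j end.
have -> : A `|` B = \bigcup_(i in setT) U i.
  rewrite AE BE; apply/seteqP; split=> v.
    by case=> -[i _ Hv]; [exists (inl i)|exists (inr i)].
  by move=> [[i|i] _ Hv]; [left|right]; exists i.
have -> : \sum_i clsA (S i) + \sum_i clsA (T i) = \sum_i clsA (U i) by rewrite big_sumType.
have disj i j v : S i v -> T j v -> False.
  move=> Si Tj; have : (A `&` B) v by rewrite AE BE; split; [exists i|exists j].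
  by rewrite AB.
apply: constructible_bigcup => [[i|i]|]; [exact: lS|exact: lT|].
move=> [i|i] [j|j] _ _ [v [/= H1 H2]].
- by congr inl; apply: tS => //; exists v.
- by case: (disj i j v).
- by case: (disj j i v).
- by congr inr; apply: tT => //; exists v.
Qed.

(** A product formula over locally closed bases extends to constructible ones by cutting the base
    into pieces. *)
Lemma constructible_fibration N M (p : 'rV[K]_M -> 'rV[K]_N) (C : set 'rV[K]_M) (c : K0)
    (S : set 'rV[K]_N) a :
  (forall T, lclosed T -> T `<=` S -> lclosed ((p @^-1` T) `&` C) /\ clsA ((p @^-1` T) `&` C) = clsA T * c) ->
  constructible_class S a -> constructible_class ((p @^-1` S) `&` C) (a * c).
Proof.
move=> H /constructible_pieces[l [T [lT tT SE ->]]].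
have TS i : T i `<=` S by rewrite SE => v Tv; exists i.
rewrite SE preimage_bigcup setI_bigcupl.
rewrite mulr_suml (eq_bigr (fun i => clsA ((p @^-1` T i) `&` C))); last first.
  by move=> i _; rewrite (H _ (lT i) (TS i)).2.
apply: constructible_bigcup => [i|i j _ _ [v [[Ti _] [Tj _]]]]; first exact: (H _ (lT i) (TS i)).1.
by apply: tT => //; exists (p v).
Qed.

Lemma clsA_split N (S : set 'rV[K]_N) (f : 'rV[K]_N -> K) : lclosed S -> pf f ->
  clsA S = clsA (S `&` [set v | f v = 0]) + clsA (S `&` [set v | f v <> 0]).
Proof.
move=> lS Hf; have [D /(_ D (leqnn D))[F hF FE]] := homogenize Hf.
have cZ : proj_closed [set w : 'rV[K]_(1 + N) | w != 0 /\ forall i : 'I_1, F w = 0].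
  by apply: (@proj_closed_fam K _ 'I_1 (fun=> F)) => _; exists D.
rewrite /clsA (scissor (lclosed_qp lS) cZ).
have F0 (w : 'rV[K]_(1 + N)) : lsubmx w 0 0 != 0 ->
    F w = 0 <-> f ((lsubmx w 0 0)^-1 *: rsubmx w) = 0.
  move=> w0; rewrite FE //; split=> [/eqP|->]; last by rewrite mulr0.
  by rewrite mulf_eq0 expf_eq0 (negbTE w0) andbF => /eqP.
congr (_ + _); congr clsP; apply/seteqP; split=> w.
- by move=> [[w0 Sw] [_ /(_ ord0)/(F0 _ w0) fw]].
- move=> [w0 [Sw fw]]; split=> //; split; last by move=> _; apply/(F0 _ w0).
  by apply: contraNneq w0 => ->; rewrite !mxE.
- move=> [[w0 Sw] nZ]; split=> //; split=> // fw; apply: nZ; split; last by move=> _; apply/(F0 _ w0).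
  by apply: contraNneq w0 => ->; rewrite !mxE.
- by move=> [w0 [Sw fw]]; split=> // -[_ /(_ ord0)/(F0 _ w0)].
Qed.

Section OneCoordinate.
Variables (N : nat) (i : 'I_N).

Lemma constructible_cyl (S : set 'rV[K]_N) a : (forall v, S v -> v 0 i = 0) ->
  constructible_class S a -> constructible_class (cyl i S) (a * Lef).
Proof.
move=> S0; have := @constructible_fibration _ _ (zero_at i) setT Lef S a.
rewrite setIT; apply=> T lT TS; rewrite setIT; split; first exact: lclosed_cyl.
by apply: clsA_cyl => // v /TS /S0.
Qed.

Variables (q h P : 'rV[K]_N -> K) (S : set 'rV[K]_N).
Hypotheses (ph : pf h) (pP : pf P) (h0 : forall v, S v -> h v != 0)
  (hq : forall v, S v -> h v * q v = P v) (S0 : forall v, S v -> v 0 i = 0).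

Let g (v : 'rV[K]_N) : 'rV[K]_N := v - q v *: delta_mx 0 i.
(** The equation v_i + q = 0 with its denominator cleared: it is polynomial, and equivalent over S,
    where h does not vanish. *)
Let eqn (v : 'rV[K]_N) : K := h (zero_at i v) * v 0 i + P (zero_at i v).

Let pf_eqn : pf eqn.
Proof.
have Hz (f : 'rV[K]_N -> K) : pf f -> pf (fun v => f (zero_at i v)).
  by move=> Hf; apply: (@pf_comp K N N f (@zero_at K N i) Hf) => j; exact: pf_zero_at.
by apply: pfD; [apply: pfM; [exact: Hz|exact: pf_coord]|exact: Hz].
Qed.

Let eqnE (v : 'rV[K]_N) : S (zero_at i v) -> eqn v = 0 <-> v 0 i + q (zero_at i v) = 0.
Proof.
move=> Sv; rewrite /eqn -hq // -mulrDr; split=> [/eqP|->]; last by rewrite mulr0.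
by rewrite mulf_eq0 (negbTE (h0 Sv)) => /eqP.
Qed.

Let graphE (T : set 'rV[K]_N) : T `<=` S ->
  (zero_at i @^-1` T) `&` [set v : 'rV[K]_N | v 0 i + q (zero_at i v) = 0] = cyl i T `&` [set v : 'rV[K]_N | eqn v = 0].
Proof.
by move=> TS; apply/seteqP; split=> v [Tv Hv]; split=> //; apply/eqnE => //; exact: TS.
Qed.

Let clsA_graph (T : set 'rV[K]_N) : lclosed T -> T `<=` S ->
  clsA (cyl i T `&` [set v : 'rV[K]_N | eqn v = 0]) = clsA T.
Proof.
move=> lT TS; apply: (@clsA_iso K N N _ _ (@zero_at K N i) g) => //.
- by apply: lclosedI; [exact: lclosed_cyl|exact: lclosed_eq0].
- by apply: rational_poly => j; exact: pf_zero_at.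
- exists h, (fun v => h v *: v - P v *: delta_mx 0 i); split=> // [j|v /TS Sv|v /TS Sv].
  + apply: (@pf_ext K N (fun v => h v * v 0 j - P v * (delta_mx 0 i : 'rV[K]_N) 0 j)).
      by move=> v; rewrite !mxE.
    apply: pfD; first by apply: pfM => //; exact: pf_coord.
    by apply: pfN; apply: pfM => //; exact: pf_cst.
  + exact: h0.
  + by rewrite /g scalerBr scalerA hq.
- by move=> v [].
- move=> v Tv; have Sv := TS _ Tv; have gz : zero_at i (g v) = v.
    by rewrite /g -scaleNr zero_at_add zero_at_id // S0.
  split; first by rewrite /cyl /= gz.
  by apply/eqnE; rewrite gz // !mxE !eqxx mulr1 S0 // add0r addNr.
- move=> v [Tv Hv]; have Sv := TS _ Tv; have /(eqnE Sv)/eqP := Hv.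
  by rewrite addrC addr_eq0 /g => /eqP ->; rewrite scaleNr opprK zero_atK.
- by move=> v Tv; rewrite /g -scaleNr zero_at_add zero_at_id // S0 //; exact: TS.
Qed.

Lemma constructible_graph a : constructible_class S a ->
  constructible_class (cyl i S `&` [set v : 'rV[K]_N | v 0 i + q (zero_at i v) = 0]) a.
Proof.
rewrite -{2}[a]mulr1; apply: constructible_fibration => T lT TS.
rewrite graphE // mulr1 clsA_graph //; split=> //.
by apply: lclosedI; [exact: lclosed_cyl|exact: lclosed_eq0].
Qed.

Lemma constructible_off_graph a : constructible_class S a ->
  constructible_class (cyl i S `&` [set v : 'rV[K]_N | v 0 i + q (zero_at i v) <> 0]) (a * (Lef - 1)).
Proof.
apply: constructible_fibration => T lT TS.
have -> : (zero_at i @^-1` T) `&` [set v : 'rV[K]_N | v 0 i + q (zero_at i v) <> 0] = cyl i T `&` [set v : 'rV[K]_N | eqn v <> 0].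
  apply/seteqP; split=> v [Tv Hv]; split=> // Hv0; apply: Hv; exact/(eqnE (TS _ Tv)).
have lC := lclosed_cyl i lT.
split; first by apply: lclosedI => //; exact: lclosed_neq0.
have := clsA_split lC pf_eqn; rewrite clsA_graph // clsA_cyl //; last by move=> v /TS /S0.
by rewrite mulrBr mulr1 => ->; rewrite addrC addKr.
Qed.

End OneCoordinate.

Definition zero_seq N (s : seq 'I_N) (v : 'rV[K]_N) : 'rV[K]_N :=
  \row_j if j \in s then 0 else v 0 j.

Lemma constructible_cyls N (s : seq 'I_N) (S : set 'rV[K]_N) a : uniq s ->
  (forall v, S v -> forall j, j \in s -> v 0 j = 0) -> constructible_class S a ->
  constructible_class [set v | S (zero_seq s v)] (a * Lef ^+ size s).
Proof.
move=> us S0 cS; elim: s us S0 => [_ _|i s IH /andP[is_ us] S0] /=.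
  rewrite mulr1; congr constructible_class : cS; apply/seteqP; split=> v /=;
  by rewrite (_ : zero_seq _ v = v) //; apply/rowP => j; rewrite mxE.
have -> : [set v | S (zero_seq (i :: s) v)] = cyl i [set v | S (zero_seq s v)].
  apply/seteqP; split=> v; rewrite /cyl /= (_ : zero_seq (i :: s) v = zero_seq s (zero_at i v)) //;
  by apply/rowP => j; rewrite [LHS]mxE [RHS]mxE zero_atE inE; case: (j == i); case: (j \in s).
rewrite exprSr mulrA; apply: constructible_cyl.
  move=> v /S0/(_ i (mem_head _ _)); by rewrite mxE (negbTE is_).
by apply: IH => // v Sv j js; apply: S0 => //; rewrite inE js orbT.
Qed.

Definition coords M N (sg : 'I_M -> 'I_N) (v : 'rV[K]_N) : 'rV[K]_M := \row_j v 0 (sg j).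

Definition extend0 M N (sg : 'I_M -> 'I_N) (u : 'rV[K]_M) : 'rV[K]_N :=
  \row_j if [pick i | sg i == j] is Some i then u 0 i else 0.

Lemma coordsK M N (sg : 'I_M -> 'I_N) : injective sg -> cancel (extend0 sg) (coords sg).
Proof.
move=> isg u; apply/rowP => j; rewrite !mxE; case: pickP => [i /eqP/isg -> //|/(_ j)].
by rewrite eqxx.
Qed.

(** A is isomorphic to the part of its preimage where the N - M remaining coordinates vanish; these
    are then freed one at a time. *)
Lemma constructible_coords M N (sg : 'I_M -> 'I_N) (A : set 'rV[K]_M) a : injective sg ->
  constructible_class A a -> constructible_class (coords sg @^-1` A) (a * Lef ^+ (N - M)).
Proof.
move=> isg cA; pose C := [set v : 'rV[K]_N | forall j : 'I_N, (if j \in codom sg then 0 else v 0 j) = 0].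
have C0 v j : C v -> j \notin codom sg -> v 0 j = 0 by move=> /(_ j); case: ifP.
have pc j : pf (fun v : 'rV[K]_N => coords sg v 0 j).
  by apply: (@pf_ext K N (fun v => v 0 (sg j))) => [v|]; [rewrite mxE|exact: pf_coord].
have pe j : pf (fun u : 'rV[K]_M => extend0 sg u 0 j).
  case E : [pick i | sg i == j] => [i|].
    by apply: (@pf_ext K M (fun v => v 0 i)) => [v|]; [rewrite mxE E|exact: pf_coord].
  by apply: (@pf_ext K M (fun=> 0)) => [v|]; [rewrite mxE E|exact: pf_cst].
have lC : lclosed C.
  exists C, set0; split; [|exact: aclosed0|by rewrite setD0].
  exists N, (fun j v => if j \in codom sg then 0 else v 0 j); split=> // j.
  by case: (j \in codom sg); [exact: pf_cst|exact: pf_coord].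
have extC u : C (extend0 sg u).
  move=> j; case: ifPn => // jc; rewrite mxE; case: pickP => // i /eqP E.
  by rewrite -E codom_f in jc.
have := @constructible_fibration _ _ (coords sg) C 1 A a.
rewrite mulr1 => /(_ _ cA) cAC; have {cA}cAC : constructible_class (coords sg @^-1` A `&` C) a.
  apply: cAC => T lT _; have lTC : lclosed (coords sg @^-1` T `&` C).
    by apply: lclosedI lC; exact: lclosed_preim.
  split=> //; rewrite mulr1; apply: (@clsA_iso K N M _ _ (coords sg) (extend0 sg)) => //.
  - exact: rational_poly.
  - exact: rational_poly.
  - by move=> v [].
  - by move=> u Tu; split; rewrite /= ?coordsK.
  - move=> v [_ Cv]; apply/rowP => j; rewrite mxE; case: pickP => [i /eqP <-|H]; first by rewrite mxE.
    by rewrite (C0 _ _ Cv) //; apply/codomP => -[i E]; have := H i; rewrite E eqxx.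
  - by move=> u _; exact: coordsK.
pose s := enum [predC codom sg].
have ss : size s = (N - M)%N.
  rewrite -cardE; have := cardC (mem (codom sg)); rewrite (card_codom isg) !card_ord.
  by move/(congr1 (subn^~ M)); rewrite addKn.
have zc v : coords sg (zero_seq s v) = coords sg v.
  by apply/rowP => j; rewrite !mxE mem_enum inE codom_f.
rewrite -ss; have -> : coords sg @^-1` A = [set v | (coords sg @^-1` A `&` C) (zero_seq s v)].
  apply/seteqP; split=> v /=; last by rewrite zc => -[].
  move=> Av; rewrite zc; split=> // j; case: ifPn => // jc.
  by rewrite mxE mem_enum inE jc.
apply: constructible_cyls => //; first exact: enum_uniq.
by move=> v [_ /C0 Cv] j; rewrite mem_enum => /Cv.
Qed.

Lemma jet_surj n (v : 'rV[K]_(n + n)) : exists g, jet n g = v.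
Proof.
pose ser (u : 'rV[K]_n) : series K := fun l => if l is l'.+1 then
  (if insub l' is Some i then u 0 i else 0) else 0.
exists (@Arc K (ser (lsubmx v)) (ser (rsubmx v)) erefl erefl).
have E (u : 'rV[K]_n) : \row_(i < n) ser u i.+1 = u.
  by apply/rowP => i; rewrite mxE /ser insubT //= => H; congr (u _ _); apply: val_inj.
by rewrite /jet /= !E hsubmxK.
Qed.

(** Every jet comes from an arc, so for n <= n' the set of n'-jets is the preimage of the set of
    n-jets under truncation. Its class gains L^(2(n'-n)), which the normalisation cancels. *)
Lemma cylinder_measure_uniq (A : set (arc K)) g g' :
  cylinder_measure A g -> cylinder_measure A g' -> g = g'.
Proof.
move=> [n [An [a [AE cA ->]]]] [n' [An' [a' [AE' cA' ->]]]].
wlog nn' : n n' An An' a a' AE cA AE' cA' / (n <= n')%N.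
  move=> H; case: (leqP n n') => [|/ltnW] nn'; first exact: (H _ _ _ _ _ _ AE cA AE' cA').
  by symmetry; exact: (H _ _ _ _ _ _ AE' cA' AE cA).
pose sg (j : 'I_(n + n)) : 'I_(n' + n') := match fintype.split j with
  | inl i => lshift n' (widen_ord nn' i) | inr i => rshift n' (widen_ord nn' i) end.
have isg : injective sg.
  move=> i j; rewrite /sg; case: (split_ordP i) => x ->; case: (split_ordP j) => y ->.
  - by move=> /lshift_inj/(congr1 val) /= H; congr lshift; apply: val_inj.
  - by move=> /eqP; rewrite eq_lrshift.
  - by move=> /eqP; rewrite eq_rlshift.
  - by move=> /rshift_inj/(congr1 val) /= H; congr rshift; apply: val_inj.
have jE (u : arc K) : coords sg (jet n' u) = jet n u.
  apply/rowP => j; rewrite mxE /sg /jet; case: (split_ordP j) => i ->.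
    by rewrite !row_mxEl !mxE.
  by rewrite !row_mxEr !mxE.
have AnE : An' = coords sg @^-1` An.
  apply/seteqP; split=> v; have [u <-] := jet_surj v.
    by rewrite /= jE -[An' _]/((jet n' @^-1` An') u) -AE' AE.
  by rewrite /= jE -[An (jet n u)]/((jet n @^-1` An) u) -AE AE'.
have := constructible_coords isg cA; rewrite -AnE => /(constructible_uniq cA') ->.
have -> : (n' + n' - (n + n) = 2 * (n' - n))%N by lia.
congr toM; rewrite -mulrA; congr (a * _).
have -> : (2 * n' = 2 * (n' - n) + 2 * n)%N by lia.
by rewrite exprD mulrA -exprMn LefK expr1n mul1r.
Qed.

Lemma chi_gE (A : set (arc K)) n An a : A = jet n @^-1` An -> constructible_class An a ->
  chi_g A = toM (a * LefV K ^+ (2 * n)).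
Proof.
move=> AE cA; have H : cylinder_measure A (toM (a * LefV K ^+ (2 * n))) by exists n, An, a.
by apply: xget_unique => // g H'; exact: cylinder_measure_uniq H' H.
Qed.

End Constructible.

(** * Normalized parametrisations *)

Section Normalization.
Variable K : fieldType.
Hypothesis char0 : forall n, n.+1%:R != 0 :> K.
Implicit Types a b x y : ps K.

Definition agree N (a b : ps K) := forall n, (n <= N)%N -> a n = b n.

Lemma agreeM N a a' b b' : agree N a a' -> agree N b b' -> agree N (a * b) (a' * b').
Proof.
move=> aa bb n nN; rewrite !psM; apply: eq_bigr => i _.
by rewrite aa ?bb // ?(leq_trans (leq_subr _ _)) // (leq_trans _ nN) // -ltnS.
Qed.

Lemma agreeX N a a' j : agree N a a' -> agree N (a ^+ j) (a' ^+ j).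
Proof. by move=> aa; elim: j => // j IH; rewrite !exprS; exact: agreeM. Qed.

Section Root.
Variables (k : nat) (k0 : (0 < k)%N).

(** The k-th root with constant term 1. The recursion is part of the specification because it gives
    the dependence of the root on each coefficient of a. *)
Definition is_root1 a b := [/\ b ^+ k = a, b 0%N = 1 & forall n, (0 < n)%N ->
  b n = (\sum_(i < n) b i * a (n - i)%N * ((n - i)%:R - (k * i)%:R)) / (n * k)%:R].

Definition root1 a : ps K := xget 0 (is_root1 a).

Lemma root1P a : a 0%N = 1 -> is_root1 a (root1 a).
Proof.
move=> a0; apply: xgetPex.
have [||b [bk b0 bn]] := @ps_root K char0 k a 1 k0; rewrite ?a0 ?oner_neq0 ?expr1n //.
by exists b; split=> // n n0; rewrite bn // a0 mulr1.
Qed.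

Lemma root1_agree N a a' : a 0%N = 1 -> agree N a a' -> agree N (root1 a) (root1 a').
Proof.
move=> a0 aa; have [_ b0 bn] := root1P a0.
have [|_ b0' bn'] := @root1P a'; first by rewrite -aa.
elim/ltn_ind=> n IH nN; case: n IH nN => [|n] IH nN; first by rewrite b0 b0'.
rewrite bn // bn' //; congr (_ / _); apply: eq_bigr => i _.
by rewrite IH ?aa // ?leq_subr // ?(leq_trans (leq_subr _ _)) // ltnW // (leq_trans _ nN) // ltnW // ltnS ltn_ord.
Qed.

(* The parameter tau with tau^k = x / x_k, and the expansion of y in it. *)
Definition norm_quot x : ps K := fun n => x (n + k)%N / x k.
Definition norm_param x : ps K := psX * root1 (norm_quot x).
Definition norm_series x y : ps K := xget 0 [set Y | comp (norm_param x) Y = y].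

Lemma norm_quot0 x : x k != 0 -> norm_quot x 0%N = 1.
Proof. by move=> xk; rewrite /norm_quot divff. Qed.

Lemma leading_norm_param x : x k != 0 -> leading (norm_param x) 1 /\ norm_param x 1%N = 1.
Proof.
move=> /norm_quot0/root1P[_ b0 _]; rewrite /norm_param; split; last by rewrite psXM.
by split=> [[|] // _|]; rewrite psXM // b0; apply/eqP; exact: oner_neq0.
Qed.

Lemma norm_paramX x : (forall i, (i < k)%N -> x i = 0) -> x k != 0 ->
  x = psC (x k) * norm_param x ^+ k.
Proof.
move=> xlow xk; have [bk _ _] := root1P (norm_quot0 xk).
rewrite exprMn bk mulrCA [LHS](low_fact xlow); congr (_ * _).
by apply: psP => n; rewrite psCM /norm_quot mulrC divfK.
Qed.

Lemma norm_seriesP x y : x k != 0 -> comp (norm_param x) (norm_series x y) = y.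
Proof.
by move=> /leading_norm_param[lt _]; apply: (@xgetPex _ 0 [set Y | comp (norm_param x) Y = y]); exact: comp_surj.
Qed.

Lemma norm_series_rec x y n : x k != 0 -> norm_series x y n =
  y n - \sum_(i < n) norm_series x y i * (norm_param x ^+ i) n.
Proof.
move=> xk; have [[t0 _] t1] := leading_norm_param xk.
rewrite -[in y n](norm_seriesP y xk) compE z0_id ?t0 // big_ord_recr /=.
have -> : (norm_param x ^+ n) n = 1.
  elim: n => // n IH; rewrite exprS -[in LHS]add1n mul_at ?IH ?t1 ?mulr1 //.
  by move=> i; apply: powlow; rewrite t0.
by rewrite mulr1 addrAC subrr add0r.
Qed.

Lemma norm_series_agree N x x' y y' : x k != 0 -> x' k != 0 ->
  agree N (norm_param x) (norm_param x') -> agree N y y' ->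
  agree N (norm_series x y) (norm_series x' y').
Proof.
move=> xk xk' tt yy; elim/ltn_ind=> n IH nN.
rewrite !norm_series_rec // yy //; congr (_ - _); apply: eq_bigr => i _.
rewrite IH ?(agreeX _ tt) //.
by rewrite (leq_trans _ nN) // ltnW.
Qed.

(** Dividing x by s^k shifts its coefficients, so an N-jet determines the parameter, and with it Y,
    with a loss of k degrees at most. *)
Lemma norm_series_agree_jet N x x' y y' : x k != 0 -> (k <= N)%N -> agree N x x' -> agree N y y' ->
  agree (N - k) (norm_series x y) (norm_series x' y').
Proof.
move=> xk kN xx yy; apply: norm_series_agree => //.
- by rewrite -xx.
- move=> [|n] nN; rewrite /norm_param !psXM //.
  apply: (root1_agree (norm_quot0 xk)) (ltnW nN) => i iN.
  by rewrite /norm_quot !xx //; lia.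
- by move=> n nN; apply: yy; lia.
Qed.

End Root.
End Normalization.

(** * Rational dependence of the normalised series on the coefficients of the arc *)

Section Rational.
Variables (K : closedFieldType) (M : nat) (c : 'I_M).
Hypothesis char0 : forall n, n.+1%:R != 0 :> K.

(** Only powers of the coordinate c, which is the leading coefficient x_k, occur as denominators. *)
Definition rat (f : 'rV[K]_M -> K) := exists d, exists2 P : 'rV[K]_M -> K, pf P &
  forall v : 'rV[K]_M, v 0 c != 0 -> v 0 c ^+ d * f v = P v.

Lemma rat_ext f g : (forall v : 'rV[K]_M, v 0 c != 0 -> f v = g v) -> rat f -> rat g.
Proof. by move=> fg [d [P pP HP]]; exists d, P => // v vc; rewrite -fg // HP. Qed.

Lemma rat_pf f : pf f -> rat f.
Proof. by move=> Hf; exists 0%N, f => // v _; rewrite mul1r. Qed.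

Lemma rat_cst a : rat (fun=> a).
Proof. exact/rat_pf/pf_cst. Qed.

Let pc d : pf (fun v : 'rV[K]_M => v 0 c ^+ d).
Proof. apply: pfX; exact: pf_coord. Qed.

Lemma ratD f g : rat f -> rat g -> rat (fun v => f v + g v).
Proof.
move=> [d [P pP HP]] [e [Q pQ HQ]].
exists (d + e)%N, (fun v : 'rV[K]_M => v 0 c ^+ e * P v + v 0 c ^+ d * Q v).
  by apply: pfD; apply: pfM.
by move=> v vc; rewrite -HP // -HQ // exprD; ring.
Qed.

Lemma ratM f g : rat f -> rat g -> rat (fun v => f v * g v).
Proof.
move=> [d [P pP HP]] [e [Q pQ HQ]]; exists (d + e)%N, (fun v => P v * Q v); first exact: pfM.
by move=> v vc; rewrite -HP // -HQ // exprD; ring.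
Qed.

Lemma ratN f : rat f -> rat (fun v => - f v).
Proof.
move=> [d [P pP HP]]; exists d, (fun v => - P v); first exact: pfN.
by move=> v vc; rewrite -HP // mulrN.
Qed.

Lemma rat_inv : rat (fun v => (v 0 c)^-1).
Proof. by exists 1%N, (fun=> 1); [exact: pf_cst|move=> v vc; rewrite expr1 mulfV]. Qed.

Lemma rat_sum n (f : 'I_n -> 'rV[K]_M -> K) : (forall i, rat (f i)) ->
  rat (fun v => \sum_(i < n) f i v).
Proof.
move=> Hf; elim: n f Hf => [|n IH] f Hf.
  by apply: rat_ext (rat_cst 0) => v _; rewrite big_ord0.
by apply: rat_ext (ratD (IH _ (fun i => Hf (widen_ord (leqnSn n) i))) (Hf ord_max)) => v _; rewrite big_ord_recr.
Qed.

Definition ratps (u : 'rV[K]_M -> ps K) := forall n, rat (fun v => u v n).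

Lemma ratpsM u w : ratps u -> ratps w -> ratps (fun v => u v * w v).
Proof.
move=> Hu Hw n; apply: (@rat_ext (fun v => \sum_(i < n.+1) u v i * w v (n - i)%N)).
  by move=> v _; rewrite psM.
by apply: rat_sum => i; apply: ratM.
Qed.

Lemma ratpsX u j : ratps u -> ratps (fun v => u v ^+ j).
Proof.
move=> Hu; elim: j => [|j IH] n.
  by apply: rat_ext (rat_cst ((n == 0%N)%:R)) => v _; rewrite expr0 ps1.
by apply: rat_ext (ratpsM Hu IH n) => v _; rewrite exprS.
Qed.

Variables (k : nat) (x y : 'rV[K]_M -> ps K).
Hypotheses (k0 : (0 < k)%N) (Hx : forall n, pf (fun v => x v n)) (Hy : forall n, pf (fun v => y v n))
  (xk : forall v, x v k = v 0 c).

Lemma ratps_norm_param : ratps (fun v => norm_param k (x v)).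
Proof.
have Hw n : rat (fun v => norm_quot k (x v) n).
  apply: rat_ext (ratM (rat_pf (Hx (n + k))) rat_inv) => v _.
  by rewrite /norm_quot xk.
have Hr n : rat (fun v => root1 k (norm_quot k (x v)) n).
  elim/ltn_ind: n => -[|n] IH.
    apply: rat_ext (rat_cst 1) => v vc.
    by have [|_ -> _] := @root1P _ char0 _ k0 (norm_quot k (x v)); rewrite ?norm_quot0 ?xk.
  pose F v := (\sum_(i < n.+1) root1 k (norm_quot k (x v)) i * norm_quot k (x v) (n.+1 - i)%N
      * ((n.+1 - i)%:R - (k * i)%:R)) * (n.+1 * k)%:R^-1.
  apply: (@rat_ext F) => [v vc|].
    have [|_ _ H] := @root1P _ char0 _ k0 (norm_quot k (x v)); first by rewrite ?norm_quot0 ?xk.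
    by rewrite [RHS]H.
  apply: ratM; last exact: rat_cst.
  by apply: rat_sum => i; apply: ratM; [apply: ratM; [exact: IH|exact: Hw]|exact: rat_cst].
move=> [|n]; first by apply: rat_ext (rat_cst 0) => v _; rewrite /norm_param psXM.
by apply: rat_ext (Hr n) => v _; rewrite /norm_param psXM.
Qed.

Lemma ratps_norm_series : ratps (fun v => norm_series k (x v) (y v)).
Proof.
elim/ltn_ind=> n IH; pose F v := y v n + - \sum_(i < n) norm_series k (x v) (y v) i * (norm_param k (x v) ^+ i) n.
apply: (@rat_ext F) => [v vc|].
  by rewrite [RHS]norm_series_rec ?xk.
apply: ratD; first exact: rat_pf.
apply: ratN; apply: rat_sum => i; apply: ratM; first exact: IH.
exact: (ratpsX _ ratps_norm_param).
Qed.

End Rational.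

(** * Evaluation of integral polynomials at the class of the affine line *)

Section EvalLef.
Variable K : closedFieldType.
Local Notation Lef := (Lef K).
Implicit Types p q : {poly int}.

(* Not an instance of horner evaluation, as K0L is only a possibly zero ring. *)
Definition evL q : K0L K := \sum_(j < size q) Lef ^+ j *~ q`_j.

Lemma evLE n q : (size q <= n)%N -> evL q = \sum_(j < n) Lef ^+ j *~ q`_j.
Proof.
move=> qn; rewrite /evL (big_ord_widen n (fun j => Lef ^+ j *~ q`_j)) // big_mkcond /=.
apply: eq_bigr => j _; case: ltnP => // qj; by rewrite nth_default.
Qed.

Lemma evLD p q : evL (p + q) = evL p + evL q.
Proof.
pose n := maxn (size p) (size q).
rewrite (@evLE n (p + q)) ?size_polyD // (@evLE n p) ?leq_maxl // (@evLE n q) ?leq_maxr //.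
by rewrite -big_split /=; apply: eq_bigr => j _; rewrite coefD mulrzDr.
Qed.

Lemma evL0 : evL 0 = 0.
Proof. by rewrite /evL size_poly0 big_ord0. Qed.

Lemma evLC c : evL c%:P = 1 *~ c.
Proof. by rewrite (@evLE 1) ?size_polyC_leq1 // big_ord1 coefC. Qed.

Lemma evLXM q : evL ('X * q) = Lef * evL q.
Proof.
have sq : (size ('X * q)%R <= (size q).+1)%N.
  by have := size_polyMleq 'X q; rewrite size_polyX.
rewrite (evLE sq) mulrC big_ord_recl coefMX /= mulr0z add0r mulr_sumr.
by apply: eq_bigr => j _; rewrite coefMX /= exprS mulrzAr.
Qed.

Lemma evLCM c q : evL (c%:P * q) = evL q *~ c.
Proof.
rewrite (@evLE (size q)); last by rewrite mul_polyC size_scale_leq.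
rewrite /evL mulrz_suml; apply: eq_bigr => j _.
by rewrite coefCM mulrC mulrzA.
Qed.

Lemma evLM p q : evL (p * q) = evL p * evL q.
Proof.
elim/poly_ind: p => [|p c IH]; first by rewrite mul0r evL0 mul0r.
rewrite mulrDl -mulrA [in LHS]mulrCA !evLD evLXM IH evLCM evLC mulrDl mulrzAl mul1r.
by rewrite mulrA [p * 'X]mulrC evLXM.
Qed.

Lemma evL1 : evL 1 = 1. Proof. exact: evLC. Qed.

Lemma evLN p : evL (- p) = - evL p.
Proof. by apply: (addrI (evL p)); rewrite -evLD !subrr evL0. Qed.

Lemma evLX : evL 'X = Lef.
Proof. by rewrite -[X in evL X]mulr1 evLXM evL1 mulr1. Qed.

Lemma evLXn p n : evL (p ^+ n) = evL p ^+ n.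
Proof. by elim: n => [|n IH]; rewrite ?evL1 // !exprS evLM IH. Qed.

Lemma toMD (a b : K0L K) : toM (a + b) = toM a + toM b.
Proof.
rewrite /toM -[RHS]pi_addr; congr (\pi_(Mcompl K) _).
by apply: val_inj; apply/funext.
Qed.

Lemma toM0 : toM (0 : K0L K) = 0.
Proof. by apply: (addrI (toM 0)); rewrite -toMD !addr0. Qed.

Lemma toMN (a : K0L K) : toM (- a) = - toM a.
Proof. by apply: (addrI (toM a)); rewrite -toMD !subrr toM0. Qed.

Lemma toM_sum n (F : 'I_n -> K0L K) : toM (\sum_i F i) = \sum_i toM (F i).
Proof. by elim/big_rec2: _ => [|i x y _ <-]; rewrite ?toM0 ?toMD. Qed.

Lemma toMz (a : K0L K) z : toM (a *~ z) = toM a *~ z.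
Proof.
have Hn n : toM (a *+ n) = toM a *+ n.
  by elim: n => [|n IH]; rewrite ?toM0 // !mulrS toMD IH.
case: z => n; first by rewrite -!pmulrn Hn.
by rewrite NegzE !mulrNz toMN -!pmulrn Hn.
Qed.

Lemma Lefact_toM (a : K0L K) j : iter j (@Lefact K) (toM a) = toM (Lef ^+ j * a).
Proof.
elim: j => [|j IH]; first by rewrite mul1r.
rewrite iterS IH /toM Lefact_pi; congr (\pi_(Mcompl K) _).
by apply: val_inj; apply/funext => i; rewrite /= exprS mulrA.
Qed.

Lemma polyact_toM q (a : K0L K) : polyact q (toM a) = toM (evL q * a).
Proof.
rewrite /polyact /evL mulr_suml toM_sum; apply: eq_bigr => j _.
by rewrite Lefact_toM -toMz mulrzAl.
Qed.

End EvalLef.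

(** * Level sets of the Milnor number *)

Section LevelSets.
Variable K : closedFieldType.
Hypothesis char0 : forall n, n.+1%:R != 0 :> K.
Local Notation Lef := (Lef K).
Variables (k m N : nat).
Hypotheses (k0 : (0 < k)%N) (m0 : (0 < m)%N) (kN : (k <= N)%N) (mN : (m <= N)%N).

Definition row_series (u : 'rV[K]_N) : ps K := fun l =>
  if l is l'.+1 then (if insub l' is Some i then u 0 i else 0) else 0.

Lemma row_seriesS (u : 'rV[K]_N) (i : 'I_N) : row_series u i.+1 = u 0 i.
Proof. by rewrite /row_series valK. Qed.

Lemma row_series_out (u : 'rV[K]_N) l : (N < l)%N -> row_series u l = 0.
Proof. by case: l => //= l Nl; rewrite insubF // ltnNge -ltnS Nl. Qed.

Local Notation xs v := (row_series (lsubmx (v : 'rV[K]_(N + N)))).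
Local Notation ys v := (row_series (rsubmx (v : 'rV[K]_(N + N)))).
Local Notation Ys v := (norm_series k (xs v) (ys v)).
Local Notation ee i v := (egcd_seq k (Ys v) i).

Lemma xsS (v : 'rV[K]_(N + N)) (i : 'I_N) : xs v i.+1 = v 0 (lshift N i).
Proof. by rewrite row_seriesS mxE. Qed.

Lemma ysS (v : 'rV[K]_(N + N)) (i : 'I_N) : ys v i.+1 = v 0 (rshift N i).
Proof. by rewrite row_seriesS mxE. Qed.

Lemma pf_row_series M (g : 'rV[K]_M -> 'rV[K]_N) l : (forall i, pf (fun v => g v 0 i)) ->
  pf (fun v => row_series (g v) l).
Proof.
move=> Hg; case: l => [|l]; first by apply: (@pf_ext K M (fun=> 0)) => //; exact: pf_cst.
rewrite /row_series; case: insub => [i|]; first exact: Hg.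
exact: pf_cst.
Qed.

Lemma pf_xs l : pf (fun v => xs v l).
Proof.
apply: pf_row_series => i; apply: (@pf_ext K _ (fun v => v 0 (lshift N i))) => [v|]; first by rewrite mxE.
exact: pf_coord.
Qed.

Lemma pf_ys l : pf (fun v => ys v l).
Proof.
apply: pf_row_series => i; apply: (@pf_ext K _ (fun v => v 0 (rshift N i))) => [v|]; first by rewrite mxE.
exact: pf_coord.
Qed.

Lemma predk_lt : (k.-1 < N)%N. Proof. by rewrite prednK. Qed.
Lemma predm_lt : (m.-1 < N)%N. Proof. by rewrite prednK. Qed.

Definition xcoord : 'I_(N + N) := lshift N (Ordinal predk_lt).
Definition ycoord : 'I_(N + N) := rshift N (Ordinal predm_lt).

Lemma xs_k v : xs v k = v 0 xcoord.
Proof. by rewrite -{1}(prednK k0) -[k.-1]/(nat_of_ord (Ordinal predk_lt)) xsS. Qed.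

Lemma ys_m v : ys v m = v 0 ycoord.
Proof. by rewrite -{1}(prednK m0) -[m.-1]/(nat_of_ord (Ordinal predm_lt)) ysS. Qed.

(* Forgets the coefficients of degree > i of y. *)
Definition trunc_y i (v : 'rV[K]_(N + N)) : 'rV[K]_(N + N) :=
  \row_j if (N + i <= j)%N then 0 else v 0 j.

Lemma trunc_yS (i : 'I_N) v : trunc_y i v = zero_at (rshift N i) (trunc_y i.+1 v).
Proof.
apply/rowP => j; rewrite zero_atE !mxE addnS -val_eqE /= eq_sym.
by case: ltngtP.
Qed.

Lemma trunc_y_full v : trunc_y N v = v.
Proof. by apply/rowP => j; rewrite mxE leqNgt ltn_ord. Qed.

Lemma xs_agree (v w : 'rV[K]_(N + N)) : (forall j : 'I_(N + N), (j < N)%N -> v 0 j = w 0 j) -> xs v = xs w.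
Proof.
move=> vw; rewrite (_ : lsubmx v = lsubmx w) //.
by apply/rowP => j; rewrite !mxE vw //=.
Qed.

Lemma ys_agree i (v w : 'rV[K]_(N + N)) : (forall j : 'I_(N + N), (j < N + i)%N -> v 0 j = w 0 j) ->
  agree i (ys v) (ys w).
Proof.
move=> vw [|l] li //; case: (ltnP l N) => lN; last by rewrite !row_series_out.
by rewrite -[l]/(nat_of_ord (Ordinal lN)) !ysS vw //= ltn_add2l.
Qed.

Lemma Ys_agree i (v w : 'rV[K]_(N + N)) : v 0 xcoord != 0 ->
  (forall j : 'I_(N + N), (j < N + i)%N -> v 0 j = w 0 j) -> agree i (Ys v) (Ys w).
Proof.
move=> vc vw; have xE : xs v = xs w by apply: xs_agree => j jN; apply: vw; exact: ltn_addr.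
by rewrite xE; apply: norm_series_agree => //; rewrite -?xE ?xs_k //; exact: ys_agree.
Qed.

Lemma ee_agree i (v w : 'rV[K]_(N + N)) : v 0 xcoord != 0 ->
  (forall j : 'I_(N + N), (j < N + i)%N -> v 0 j = w 0 j) -> ee i v = ee i w.
Proof.
move=> vc vw; apply: (@egcd_seq_eq _ _ _ _ i) => // l li.
by rewrite (Ys_agree vc vw).
Qed.

Section Step.
Variables (i : 'I_N).
Local Notation d := (rshift N i).
Let q (v : 'rV[K]_(N + N)) : K := Ys v i.+1 - ys v i.+1.

(** The correction q involves x and the coefficients of y of degree at most i only, so it is
    unaffected by setting to 0 the coordinate d, which holds the coefficient of degree i + 1. *)
Lemma Ys_step (v : 'rV[K]_(N + N)) : v 0 xcoord != 0 -> Ys v i.+1 = v 0 d + q (zero_at d v).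
Proof.
move=> vc; set w := zero_at d v.
have vw (j : 'I_(N + N)) : (j < N + i)%N -> v 0 j = w 0 j.
  by move=> jN; rewrite zero_atE -val_eqE /= ltn_eqF.
have xE : xs v = xs w by apply: xs_agree => j jN; apply: vw; exact: ltn_addr.
have xk : xs v k != 0 by rewrite xs_k.
rewrite /q !norm_series_rec // -?xE // addrAC subrr add0r ysS.
congr (_ - _); apply: eq_bigr => l _; congr (_ * _).
rewrite [in RHS]xE; by apply: (Ys_agree vc vw); rewrite -ltnS.
Qed.

Variables (S : set 'rV[K]_(N + N)) (a : K0L K).
Hypotheses (Sc : forall v, S v -> v 0 xcoord != 0) (S0 : forall v, S v -> v 0 d = 0)
  (cS : constructible_class S a).

Let zc (v : 'rV[K]_(N + N)) : zero_at d v 0 xcoord = v 0 xcoord.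
Proof. by rewrite zero_atE eq_lrshift. Qed.

(** The condition Y_(i+1) = 0 is the graph y_(i+1) = - q over S, where q is rational with a power of
    x_k as denominator. *)
Lemma constructible_next0 : constructible_class (cyl d S `&` [set v | Ys v i.+1 = 0]) a /\
  constructible_class (cyl d S `&` [set v | Ys v i.+1 <> 0]) (a * (Lef - 1)).
Proof.
have [e [P pP HP]] : rat xcoord q.
  apply: ratD; first exact: (ratps_norm_series char0 k0 pf_xs pf_ys xs_k).
  by apply: ratN; apply: rat_pf; exact: pf_ys.
have ph : pf (fun v : 'rV[K]_(N + N) => v 0 xcoord ^+ e) by apply: pfX; exact: pf_coord.
have h0 v : S v -> v 0 xcoord ^+ e != 0 by move=> Sv; rewrite expf_neq0 // Sc.
have hq v : S v -> v 0 xcoord ^+ e * q v = P v by move=> Sv; rewrite HP // Sc.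
have E v : cyl d S v -> Ys v i.+1 = v 0 d + q (zero_at d v).
  by move=> /Sc; rewrite zc; exact: Ys_step.
have := constructible_graph ph pP h0 hq S0 cS.
have := constructible_off_graph ph pP h0 hq S0 cS.
have -> : cyl d S `&` [set v : 'rV[K]_(N + N) | v 0 d + q (zero_at d v) = 0] = cyl d S `&` [set v | Ys v i.+1 = 0].
  by apply/seteqP; split=> v [Sv Hv]; split=> //; move: Hv; rewrite /= E.
have -> : cyl d S `&` [set v : 'rV[K]_(N + N) | v 0 d + q (zero_at d v) <> 0] = cyl d S `&` [set v | Ys v i.+1 <> 0].
  by apply/seteqP; split=> v [Sv Hv]; split=> //; move: Hv; rewrite /= E.
by [].
Qed.

End Step.

(* The jets in S prescribe x and y up to degree i, with value e of the i-th gcd. *)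
Definition stage i e (S : set 'rV[K]_(N + N)) := forall v, S v -> [/\ v 0 xcoord != 0,
  forall j : 'I_(N + N), (N + i <= j)%N -> v 0 j = 0 & ee i v = e].

Definition tail i (v : 'rV[K]_(N + N)) := (\sum_(i <= l < N) (ee l.+1 v).-1)%N.

(** Induction on the number j of coefficients of y still to be chosen; the case distinction is that
    of [wt]. *)
Lemma stage_count j i e S a r : (i + j = N)%N -> stage i e S -> constructible_class S a ->
  constructible_class [set v | S (trunc_y i v) /\ tail i v = r] (a * evL K (wt j i e)`_r).
Proof.
elim: j i e S a r => [|j IH] i e S a r.
  rewrite addn0 => -> _ cS; case: r => [|r] /=.
    rewrite coef1 evL1 mulr1; congr constructible_class : cS; apply/seteqP; split=> v.
      by rewrite /= trunc_y_full /tail big_geq.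
    by rewrite /= trunc_y_full => -[].
  rewrite coef1 evL0 mulr0 (_ : [set v | _] = set0); first exact: constructible0.
  by apply/seteqP; split=> // v [_]; rewrite /tail big_geq.
rewrite addnS -addSn => iN stS cS.
have iltN : (i < N)%N by rewrite -iN addSn ltnS leq_addr.
pose o := Ordinal iltN; pose d : 'I_(N + N) := rshift N o.
(* The coefficient of degree i + 1 adds e' - 1 to [tail], which is the factor t^(e'-1) in the
   recursion of [wt]. *)
have sub e' T b : stage i.+1 e' T -> constructible_class T b ->
    constructible_class [set v | T (trunc_y i.+1 v) /\ tail i v = r]
      (b * evL K ('X^(e'.-1) * wt j i.+1 e')`_r).
  move=> stT cT; rewrite coefXnM.
  have tE v : T (trunc_y i.+1 v) -> tail i v = (e'.-1 + tail i.+1 v)%N.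
    move=> Tv; rewrite /tail big_ltn //; congr (_.-1 + _)%N.
    have [tc _ <-] := stT _ Tv; symmetry; apply: ee_agree => // l lN.
    by rewrite mxE leqNgt lN.
  case: ltnP => re.
    rewrite evL0 mulr0 (_ : [set v | _] = set0); first exact: constructible0.
    by apply/seteqP; split=> // v [/tE ->] E; move: re; rewrite -E ltnNge leq_addr.
  rewrite (_ : [set v | _] = [set v | T (trunc_y i.+1 v) /\ tail i.+1 v = (r - e'.-1)%N]).
    exact: IH.
  by apply/seteqP; split=> v [Tv]; [move=> E|move=> E]; split=> //; move: E; rewrite tE //; lia.
have S0 v : S v -> v 0 d = 0 by move=> /stS[_ H _]; apply: H.
have Sc v : S v -> v 0 xcoord != 0 by move=> /stS[].
have cylE v : S (trunc_y i v) <-> cyl d S (trunc_y i.+1 v).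
  by rewrite /cyl /= -trunc_yS.
have stC v : cyl d S v -> [/\ v 0 xcoord != 0,
    forall j : 'I_(N + N), (N + i.+1 <= j)%N -> v 0 j = 0 & ee i v = e].
  move=> Sv; have [vc v0 ve] := stS _ Sv.
  have vc' : v 0 xcoord != 0 by move: vc; rewrite zero_atE eq_lrshift.
  split=> // [l lN|].
    have := v0 l; rewrite zero_atE -val_eqE /= gtn_eqF; last by rewrite addnS in lN.
    by apply; apply: leq_trans lN; rewrite addnS.
  rewrite -ve; apply: ee_agree => // l lN.
  by rewrite zero_atE -val_eqE /= ltn_eqF.
rewrite /=; case: ifP => ei.
  have := @sub e (cyl d S) (a * Lef); rewrite -!mulrA [('X%:P * _)`_r]coefCM evLM evLX.
  have -> : [set v | S (trunc_y i v) /\ tail i v = r] = [set v | cyl d S (trunc_y i.+1 v) /\ tail i v = r].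
    by apply/seteqP; split=> v [/cylE].
  apply; last exact: constructible_cyl.
  move=> v /stC[vc v0 ve]; split=> //; rewrite /= ve; case: eqP => // _.
  exact/gcdn_idPl.
set e1 := gcdn e i.+1.
have [c0 c1] := @constructible_next0 o S a Sc S0 cS.
set T0 := _ `&` _ in c0; set T1 := _ `&` _ in c1.
have st0 : stage i.+1 e T0.
  by move=> v [/stC[vc v0 ve] /= Y0]; split=> //; rewrite /= ve Y0 eqxx.
have st1 : stage i.+1 e1 T1.
  move=> v [/stC[vc v0 ve] /= /eqP Y0]; split=> //; by rewrite /= ve (negbTE Y0).
move: c0 c1; set lm := Lef - 1 => c0 c1.
have := constructibleU (sub _ _ _ st0 c0) (sub _ _ _ st1 c1).
have -> : ('X%:P - 1) * 'X^(e1.-1) * wt j i.+1 e1 = ('X - 1)%:P * ('X^(e1.-1) * wt j i.+1 e1).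
  by rewrite rmorphB mulrA.
rewrite coefD coefCM evLD evLM evLD evLN evLX evL1 -/lm [a * (_ + lm * _)]mulrDr [a * (lm * _)]mulrA.
have -> : [set v | S (trunc_y i v) /\ tail i v = r] =
    [set v | T0 (trunc_y i.+1 v) /\ tail i v = r] `|` [set v | T1 (trunc_y i.+1 v) /\ tail i v = r].
  apply/seteqP; split=> v.
    move=> [/cylE Sv tv]; case: (EM (Ys (trunc_y i.+1 v) i.+1 = 0)) => H; [left|right]; split=> //; split=> //.
  by case=> -[[/cylE Sv _] tv].
apply; apply/seteqP; split=> // v [[[_ H0] _] [[_ H1] _]]; exact: H1 H0.
Qed.


Local Notation c := xcoord.
Local Notation d := ycoord.

(** The jets with only x_k and y_m, both nonzero. All other coordinates are freed starting from this
    set. *)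
Definition leading_jets : set 'rV[K]_(N + N) := [set v | [/\ v 0 c <> 0, v 0 d <> 0 &
  forall j, j != c -> j != d -> v 0 j = 0]].

Let cd : c == d = false. Proof. exact: eq_lrshift. Qed.

Lemma constructible_leading_jets : constructible_class leading_jets ((Lef - 1) ^+ 2).
Proof.
have c1 : constructible_class [set 0 : 'rV[K]_(N + N)] 1.
  by rewrite -(clsA_point K (N + N)); apply: constructible_lclosed; exact: lclosed_point.
have p1 : pf (fun _ : 'rV[K]_(N + N) => 1) by exact: pf_cst.
have p0 : pf (fun _ : 'rV[K]_(N + N) => 0) by exact: pf_cst.
have Z0 v : [set 0 : 'rV[K]_(N + N)] v -> v 0 c = 0 by move=> ->; rewrite mxE.
(* With q = 0 the complement of the graph is the condition that the coordinate be nonzero. *)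
have := @constructible_off_graph K (N + N) c (fun=> 0) (fun=> 1) (fun=> 0) [set 0] p1 p0
  (fun _ _ => oner_neq0 _) (fun _ _ => mulr0 _) Z0 1 c1.
set S1 := _ `&` _; rewrite mul1r => c2.
have Z1 v : S1 v -> v 0 d = 0.
  move=> [/(congr1 (fun w : 'rV[K]_(N + N) => w 0 d))].
  by rewrite zero_atE mxE eq_sym cd.
have := @constructible_off_graph K (N + N) d (fun=> 0) (fun=> 1) (fun=> 0) S1 p1 p0
  (fun _ _ => oner_neq0 _) (fun _ _ => mulr0 _) Z1 _ c2.
rewrite -expr2; congr constructible_class; apply/seteqP; split=> v.
  move=> [[/rowP v0 /=]]; rewrite !addr0 zero_atE cd => vc vd; split=> // j jc jd.
  by have := v0 j; rewrite !zero_atE (negbTE jc) (negbTE jd) mxE.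
move=> [vc vd v0]; split=> /=; last by rewrite addr0.
split=> /=; last by rewrite addr0 zero_atE cd.
apply/rowP => j; rewrite !zero_atE mxE; case: eqP => // /eqP jc; case: eqP => // /eqP jd; exact: v0.
Qed.

(** The entry i holds the coefficient of degree i + 1, so k <= i selects the degrees above k. *)
Definition free_x : seq 'I_(N + N) := [seq lshift N i | i <- enum [pred i : 'I_N | (k <= i)%N]].

Lemma size_free_x : size free_x = (N - k)%N.
Proof.
rewrite size_map -cardE -sum1_card -[RHS]muln1 -sum_nat_const_nat big_geq_mkord.
by apply: eq_bigl => i; rewrite inE.
Qed.

Lemma mem_free_x (i : 'I_N) : (lshift N i \in free_x) = (k <= i)%N.
Proof. by rewrite mem_map ?mem_enum ?inE //; exact: lshift_inj. Qed.

Lemma mem_free_xr (i : 'I_N) : (rshift N i \in free_x) = false.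
Proof. by apply/mapP => -[l _ /eqP]; rewrite eq_rlshift. Qed.

Definition first_jets := [set v | leading_jets (zero_seq free_x v)].

Let cfree : c \in free_x = false.
Proof. by rewrite mem_free_x /= leqNgt prednK // leqnn. Qed.

Lemma first_jetsP v : first_jets v <-> [/\ v 0 c <> 0, v 0 d <> 0 &
  forall j, j \notin free_x -> j != c -> j != d -> v 0 j = 0].
Proof.
rewrite /first_jets /leading_jets /= ![zero_seq _ _ _ _]mxE cfree mem_free_xr.
split=> -[vc vd v0]; split=> // j.
  by move=> jf jc jd; have := v0 _ jc jd; rewrite mxE (negbTE jf).
by move=> jc jd; rewrite mxE; case: ifPn => // jf; exact: v0.
Qed.

Lemma constructible_first_jets : constructible_class first_jets ((Lef - 1) ^+ 2 * Lef ^+ (N - k)).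
Proof.
rewrite -size_free_x; apply: constructible_cyls; last exact: constructible_leading_jets.
  by rewrite map_inj_uniq ?enum_uniq //; exact: lshift_inj.
by move=> v [_ _ v0] j jf; apply: v0; apply: contraTneq jf => ->; rewrite ?cfree ?mem_free_xr.
Qed.

(** The parameter has linear coefficient 1, so Y and y have the same leading term y_m s^m, and the
    gcd first changes at m. *)
Lemma ee_start (v : 'rV[K]_(N + N)) : v 0 c != 0 -> (forall l, (l < m)%N -> ys v l = 0) -> ys v m != 0 ->
  (forall l, (l < m)%N -> ee l v = k) /\ ee m v = gcdn k m.
Proof.
move=> vc y0 ym; have xk : xs v k != 0 by rewrite xs_k.
have Y0 l : (l < m)%N -> Ys v l = 0.
  elim/ltn_ind: l => l IH lm; rewrite norm_series_rec // y0 // big1 ?subrr // => i _.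
  by rewrite IH ?mul0r // (ltn_trans _ lm).
have Ym : Ys v m = ys v m.
  by rewrite norm_series_rec // big1 ?subr0 // => i _; rewrite Y0 ?mul0r.
have el l : (l < m)%N -> ee l v = k.
  by elim: l => //= l IH lm; rewrite Y0 // eqxx IH // ltnW.
split=> //; case: m m0 Ym ym el => //= m' _ -> /negbTE -> el.
by rewrite el.
Qed.

Definition level_jets n : set 'rV[K]_(N + N) := [set v | [/\ forall l, (l < k)%N -> xs v l = 0,
  v 0 c != 0, forall l, (l < m)%N -> ys v l = 0, v 0 d != 0 & tail 0 v = n]].

Lemma first_jets_trunc v : first_jets (trunc_y m v) <-> [/\ forall l, (l < k)%N -> xs v l = 0,
  v 0 c != 0, forall l, (l < m)%N -> ys v l = 0 & v 0 d != 0].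
Proof.
have tx (i : 'I_N) : trunc_y m v 0 (lshift N i) = v 0 (lshift N i).
  by rewrite mxE ifF //; apply/negbTE; rewrite -ltnNge /=; have := ltn_ord i; lia.
have ty (i : 'I_N) : (i < m)%N -> trunc_y m v 0 (rshift N i) = v 0 (rshift N i).
  by move=> im; rewrite mxE /= leq_add2l leqNgt im.
rewrite first_jetsP tx ty ?prednK //; split=> [[/eqP vc /eqP vd v0]|[x0 vc y0 vd]].
  split=> // -[|l] // lk.
    have lN : (l < N)%N by apply: ltnW; apply: leq_trans lk kN.
    rewrite -[l]/(nat_of_ord (Ordinal lN)) xsS -tx; apply: v0.
    - by rewrite mem_free_x -ltnNge /= ltnW.
    - by rewrite -val_eqE /=; lia.
    - by rewrite eq_lrshift.
  have lN : (l < N)%N by apply: ltnW; apply: leq_trans lk mN.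
  rewrite -[l]/(nat_of_ord (Ordinal lN)) ysS -(ty (Ordinal lN) (ltnW lk)); apply: v0.
  - by rewrite mem_free_xr.
  - by rewrite eq_rlshift.
  - by rewrite -val_eqE /=; lia.
split; [exact/eqP|exact/eqP|move=> j; case: (split_ordP j) => i ->].
  rewrite mem_free_x -ltnNge => ik ic _; rewrite tx -xsS x0 //.
  by rewrite ltn_neqAle ik andbT; apply: contraNneq ic => E; rewrite -val_eqE /= -E.
move=> _ _ id; case: (leqP m i) => im; first by rewrite mxE /= leq_add2l im.
rewrite ty // -ysS y0 //.
by rewrite ltn_neqAle im andbT; apply: contraNneq id => E; rewrite -val_eqE /= -E.
Qed.

Lemma stage_first : stage m (gcdn k m) first_jets.
Proof.
move=> v Fv; have [/eqP vc /eqP vd v0] := (first_jetsP v).1 Fv.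
have vout (j : 'I_(N + N)) : (N + m <= j)%N -> v 0 j = 0.
  case: (split_ordP j) => i -> /= iN; first by have := ltn_ord i; lia.
  apply: v0; rewrite ?mem_free_xr ?eq_rlshift // -val_eqE /=; lia.
split=> //.
have [] : [/\ forall l, (l < k)%N -> xs v l = 0,
  v 0 c != 0, forall l, (l < m)%N -> ys v l = 0 & v 0 d != 0].
  apply/first_jets_trunc; rewrite (_ : trunc_y m v = v) //; apply/rowP => j; rewrite mxE.
  by case: ifP => // /vout ->.
by move=> _ _ y0 _; have [] := @ee_start v vc y0; rewrite ?ys_m.
Qed.

Lemma constructible_level_jets n :
  constructible_class (level_jets n) (evL K (level_poly k m N)`_n).
Proof.
pose e := gcdn k m; pose M0 := ((m - 1) * (k - 1) + e.-1)%N.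
(* The degrees 1, ..., m - 1 add k - 1 each, and the degree m adds gcd(k, m) - 1. *)
have tailE v : first_jets (trunc_y m v) -> tail 0 v = (M0 + tail m v)%N.
  move=> /first_jets_trunc[_ vc y0 vd]; have [|el em] := @ee_start v vc y0; first by rewrite ys_m.
  rewrite /tail [LHS](@big_cat_nat _ _ _ m) //=; congr (_ + _)%N.
  have -> : (\sum_(0 <= l < m) (ee l.+1 v).-1 =
      \sum_(0 <= l < m.-1) (ee l.+1 v).-1 + (ee m.-1.+1 v).-1)%N.
    by rewrite -big_nat_recr // prednK.
  rewrite prednK // em; congr (_ + _)%N.
  rewrite (eq_big_nat _ _ (F2 := fun=> k.-1)) => [|l /andP[_ lm]].
    by rewrite sum_nat_const_nat subn0 !subn1.
  by rewrite el //; lia.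
have -> : (level_poly k m N)`_n = ('X - 1) ^+ 2 * 'X ^+ (N - k) * ('X^M0 * wt (N - m) m e)`_n.
  rewrite -coefCM rmorphM !rmorphXn /= rmorphB /= -/e.
  by rewrite mulrA.
rewrite evLM evLM !evLXn evLD evLN evLX evL1 coefXnM.
have [nM|Mn] := ltnP n M0.
  rewrite evL0 mulr0 (_ : level_jets n = set0); first exact: constructible0.
  apply/seteqP; split=> // v [x0 vc y0 vd tn].
  have : first_jets (trunc_y m v) by apply/first_jets_trunc.
  by move/tailE; rewrite tn; lia.
rewrite (_ : level_jets n = [set v | first_jets (trunc_y m v) /\ tail m v = (n - M0)%N]).
  apply: stage_count stage_first constructible_first_jets.
  by rewrite subnKC.
apply/seteqP; split=> v.
  move=> [x0 vc y0 vd tn]; have Fv : first_jets (trunc_y m v) by apply/first_jets_trunc.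
  by split=> //; move: tn; rewrite tailE //; lia.
move=> [Fv tn]; have [x0 vc y0 vd] := (first_jets_trunc v).1 Fv.
by split=> //; rewrite tailE // tn subnKC.
Qed.

End LevelSets.

(** * Finite determinacy of the level sets *)

Section LevelSetIsCylinder.
Variable K : closedFieldType.
Hypothesis char0 : forall n, n.+1%:R != 0 :> K.
Variables (k m N n : nat).
Hypotheses (k0 : (0 < k)%N) (m0 : (0 < m)%N) (kN : (k <= N)%N) (mN : (m <= N)%N)
  (nN : (n < N - k)%N).
Local Notation xs v := (row_series (lsubmx (v : 'rV[K]_(N + N)))).
Local Notation ys v := (row_series (rsubmx (v : 'rV[K]_(N + N)))).

Lemma milnor_norm (g : arc K) M : has_order (arcx g) k -> (n < M)%N ->
  milnor g = Some n <-> (\sum_(i < M)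
    (egcd_seq k (norm_series k (arcx g) (arcy g)) i.+1).-1)%N = n.
Proof.
move=> [xlow xk] nM; apply: (milnor_level char0 k0 xk _ _ _ nM).
- exact: (leading_norm_param char0 k0 xk).1.
- exact: norm_paramX.
- by rewrite norm_seriesP.
Qed.

Lemma jet_xs (g : arc K) : agree N (arcx g) (xs (jet N g)).
Proof.
move=> [|l] lN; first exact: arcx0.
by rewrite -[l]/(nat_of_ord (Ordinal lN)) xsS /jet row_mxEl mxE.
Qed.

Lemma jet_ys (g : arc K) : agree N (arcy g) (ys (jet N g)).
Proof.
move=> [|l] lN; first exact: arcy0.
by rewrite -[l]/(nat_of_ord (Ordinal lN)) ysS /jet row_mxEr mxE.
Qed.

(* Compares the arc with the arc of its jet: both Milnor numbers are read off
  the normalized series up to the order N - k, where these agree. *)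
Lemma milnor_jet (g : arc K) : has_order (arcx g) k ->
  milnor g = Some n <-> tail k 0 (jet N g) = n.
Proof.
move=> ox; set v := jet N g; pose g' := @Arc K (xs v) (ys v) erefl erefl.
have ox' : has_order (arcx g') k.
  case: ox => xlow xk; split=> [l lk|]; rewrite /= -jet_xs //; first exact: xlow.
  exact: leq_trans (ltnW lk) kN.
have nN' : (n < N)%N by apply: leq_trans nN (leq_subr _ _).
(* Any bound above n computes the Milnor number: for the arc of the jet the bound N is exchanged for
   N - k, below which the two normalised series can be compared. *)
rewrite /tail big_mkord; apply: iff_trans (milnor_norm ox' nN').
apply: iff_trans (milnor_norm ox nN) _; apply: iff_trans (iff_sym (milnor_norm ox' nN)).
rewrite (eq_bigr (fun i : 'I_(N - k) => (egcd_seq k (norm_series k (arcx g') (arcy g')) i.+1).-1)) // => i _.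
congr _.-1; apply: (@egcd_seq_eq _ _ _ _ (N - k)) => // l lN.
have [_ xk] := ox; rewrite (norm_series_agree_jet char0 k0 xk kN (@jet_xs g) (@jet_ys g)) //.
Qed.

Lemma level_set_cylinder : @level_set K k m n = jet N @^-1` level_jets k0 m0 kN mN n.
Proof.
have ordP (a b : ps K) p : (p <= N)%N -> agree N a b ->
    has_order a p <-> (forall l, (l < p)%N -> b l = 0) /\ b p != 0.
  move=> pN ab; rewrite /has_order ab //; split=> -[H ?]; split=> // l lp; have lN : (l <= N)%N by lia.
    by rewrite -ab // H.
  by rewrite ab // H.
apply/seteqP; split=> g.
  move=> [ox oy /(milnor_jet ox) tn].
  have [x0 xk] := (ordP _ _ _ kN (jet_xs g)).1 ox; have [y0 ym] := (ordP _ _ _ mN (jet_ys g)).1 oy.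
  by split=> //; [rewrite -xs_k|rewrite -ys_m].
move=> [x0 xk y0 ym tn].
have ox : has_order (arcx g) k by apply/(ordP _ _ _ kN (jet_xs g)); rewrite xs_k.
split=> //; last by apply/(milnor_jet ox).
by apply/(ordP _ _ _ mN (jet_ys g)); rewrite ys_m.
Qed.

Lemma GseriesE : Gseries K k m n = toM (evL K (level_poly k m N)`_n * LefV K ^+ (2 * N)).
Proof.
apply: (@chi_gE _ _ N (level_jets k0 m0 kN mN n)); first exact: level_set_cylinder.
exact: constructible_level_jets.
Qed.

End LevelSetIsCylinder.

Theorem corollary1 (R : realType) (k m : nat) (hk : (1 <= k)%N) (hm : (1 <= m)%N) :
  exists G : {fraction {poly {poly int}}},
    is_expansion G (Gseries R[i] k m) /\
    subst_inv G =
      tvar ^- (2 * (k - 1) * (m - 1)) * Lvar ^+ (2 * k + 2 * m - 2) * G.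
Proof.
have [G [P [Q [mQ GE GI HPQ]]]] := rational_generating_function hk hm.
exists G; split=> //; exists P, Q; split=> // n.
have char0 j : j.+1%:R != 0 :> R[i] by rewrite pnatr_eq0.
(* One order of jets serves all coefficients up to n: N exceeds n + k, so that jets decide the level
   sets, and n + m, as the generating function requires. *)
pose N := (n + m + k + 1)%N.
have kN : (k <= N)%N by rewrite /N; lia.
have mN : (m <= N)%N by rewrite /N; lia.
under eq_bigr => i _.
  rewrite (GseriesE char0 hk hm kN mN); last by rewrite /N; lia.
  rewrite polyact_toM mulrA -evLM; over.
rewrite -toM_sum -mulr_suml polyact_toM mulr1.
have <- : evL R[i] (\sum_(i < n.+1) Q`_i * (level_poly k m N)`_(n - i)) =
    \sum_(i < n.+1) evL R[i] (Q`_i * (level_poly k m N)`_(n - i)).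
  by elim/big_rec2: _ => [|i p q _ <-]; rewrite ?evL0 ?evLD.
rewrite HPQ //; last by rewrite /N; lia.
(* The factor L^(2N) from the count of jets cancels the normalisation L^(-2N) of the measure. *)
rewrite evLM evLXn evLX mulrAC -exprMn LefK expr1n mul1r.
by [].
Qed.
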